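(* Let $(\Omega,\Sigma,\mu)$ be a positive measure space and write $L^p = L^p(\Omega,\Sigma,\mu)$. Let $1 \le r < \infty$, let $\sigma\subseteq\mathbb{R}$ be a nonempty compact set, and let $T$ be a linear transformation defining real $\mathrm{AC}(\sigma)$ operators $T_r \in B(L^r)$ and $T_\infty \in B(L^\infty)$. If $T_\infty = S^*$ for some operator $S \in B(L^1)$, then $T_\infty$ has a $\mathrm{BV}(\sigma)$ functional calculus.
   Context: For a nonempty compact set $\sigma \subseteq \mathbb{R}$, $\mathrm{BV}(\sigma)$ is the Banach algebra (pointwise operations) of all functions $f:\sigma \to \mathbb{C}$ of bounded variation, i.e. with $\mathrm{var}_\sigma f = \sup \sum_{i=1}^n |f(t_i)-f(t_{i-1})| < \infty$ (supremum over all finite increasing sequences $t_0<\dots<t_n$ in $\sigma$), with norm $\|f\|_{\mathrm{BV}(\sigma)} = \sup_{\sigma}|f| + \mathrm{var}_\sigma f$. $\mathrm{AC}(\sigma)$ is the closure in $\mathrm{BV}(\sigma)$ of the (restrictions to $\sigma$ of) polynomials, with the same norm. An operator $T \in B(X)$ on a Banach space $X$ is a real $\mathrm{AC}(\sigma)$ operator if there is a bounded algebra homomorphism $\mathrm{AC}(\sigma) \to B(X)$, $f \mapsto f(T)$ (necessarily unique), sending $1$ to $I$ and $t\mapsto t$ to $T$. It has a $\mathrm{BV}(\sigma)$ functional calculus if there is a norm continuous algebra homomorphism $\Psi: \mathrm{BV}(\sigma) \to B(X)$ with $\Psi(f) = f(T)$ for all $f \in \mathrm{AC}(\sigma)$.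 A linear transformation $T$, whose domain $\mathrm{Dom}(T)$ consists of equivalence classes of measurable functions $\Omega \to \mathbb{C}$, defines a bounded operator on $L^p$ if $L^p \subseteq \mathrm{Dom}(T)$ and there is $K_p<\infty$ with $\|Tx\|_p \le K_p\|x\|_p$ for all $x \in L^p$; $T_p \in B(L^p)$ denotes the restriction of $T$ to $L^p$. $L^\infty$ is regarded as the dual of $L^1$ via the pairing $\langle y,x\rangle = \int_\Omega y x\, d\mu$ ($y\in L^1$, $x \in L^\infty$), and $T_\infty = S^*$ means $\langle y, T_\infty x\rangle = \langle Sy, x\rangle$ for all $y \in L^1$, $x \in L^\infty$.
   Formalization: The measure is assumed to be such that the pairing identifies L^∞ with the full dual of L^1 (true for every σ-finite measure); for an arbitrary positive measure the claim fails, for example when every nonempty set has infinite measure. *)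

(* Defs.v *)
From HB Require Import structures.
From mathcomp Require Import all_boot all_order all_algebra.
From mathcomp Require Import complex.
From mathcomp Require Import all_classical all_reals all_analysis.
From mathcomp Require Import measurable_realfun ess_sup_inf.
Set Implicit Arguments.
Unset Strict Implicit.
Unset Printing Implicit Defensive.
Import Order.TTheory GRing.Theory Num.Theory.
Import numFieldNormedType.Exports.
Import ComplexField.Normc.
Local Open Scope classical_set_scope.
Local Open Scope ring_scope.
Local Open Scope complex_scope.

Section normc_facts.
Context {R : realType}.
Implicit Types z w : R[i].

Lemma normr_normc z : `|z| = (normc z)%:C.
Proof. by rewrite normc_def; case: z. Qed.

Lemma normc_ge0 z : 0 <= normc z.
Proof. by case: z => a b /=; exact: sqrtr_ge0. Qed.

Lemma normcD z w : normc (z + w) <= normc z + normc w.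
Proof. by rewrite -lecR raddfD/= -!normr_normc ler_normD. Qed.

Lemma normc_real (a : R) : normc a%:C = `|a|.
Proof. by rewrite /normc /= expr0n/= addr0 sqrtr_sqr. Qed.

Lemma normc_realB (a b : R) : normc (a%:C - b%:C) = `|a - b|.
Proof. by rewrite -normc_real; congr normc; rewrite -rmorphB. Qed.

Lemma realCD (a b : R) : (a + b)%:C = a%:C + b%:C.
Proof. exact: rmorphD. Qed.

Lemma realCM (a b : R) : (a * b)%:C = a%:C * b%:C.
Proof. exact: rmorphM. Qed.

Lemma realC_ge0 (a : R) : (0 <= a%:C) = (0 <= a).
Proof. exact: ler0c. Qed.

End normc_facts.


Section bounded_operators.
Context {R : realType} (X : normedModType R[i]).

Definition bounded_op : {pred X -> X} := [pred A : X -> X | `[< linear A /\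
  exists K : R, forall x, `|A x| <= K%:C * `|x| >]].

Lemma bounded_opP A : reflect
  (linear A /\ exists K : R, forall x, `|A x| <= K%:C * `|x|)
  (A \in bounded_op).
Proof. exact: asboolP. Qed.

Lemma bounded_op_submod_closed : submod_closed bounded_op.
Proof.
split.
  apply/bounded_opP; split=> [a x y|]; first by rewrite /= scaler0 addr0.
  by exists 0 => x; rewrite normr0 mul0r.
move=> a A B /bounded_opP[lA [K AK]] /bounded_opP[lB [L BL]].
apply/bounded_opP; split=> [b x y|].
  rewrite !fctE lA lB !scalerDr !scalerA [a * b]mulrC.
  by rewrite addrACA.
exists (normc a * K + L) => x; rewrite !fctE (le_trans (ler_normD _ _))//.
rewrite realCD mulrDl lerD// normrZ realCM -mulrA -normr_normc.
by rewrite ler_wpM2l.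
Qed.
HB.instance Definition _ :=
  GRing.isSubmodClosed.Build _ _ bounded_op bounded_op_submod_closed.

Record bop := Bop { bop_val :> X -> X; _ : bop_val \in bounded_op }.
HB.instance Definition _ := [isSub for bop_val].
HB.instance Definition _ := [Choice of bop by <:].
HB.instance Definition _ := [SubChoice_isSubLmodule of bop by <:].

(* Norms of vectors live in R[i] (with zero imaginary part), hence [Re]. *)
Definition opnorm (A : bop) : R :=
  sup [set complex.Re `|A x| | x in [set x : X | `|x| <= 1]].

Lemma norm_RRe (x : X) : `|x| = (complex.Re `|x|)%:C.
Proof. by rewrite RRe_real// normr_real. Qed.

Lemma bop_linear (A : bop) : linear A.
Proof. by case: A => A /= /bounded_opP[]. Qed.

Lemma bopZ (A : bop) a x : A (a *: x) = a *: A x.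
Proof.
have A0 : A 0 = 0 
  by have := bop_linear A (-1) 0 0; rewrite scaler0 addr0 scaleN1r addNr.
by have := bop_linear A a x 0; rewrite !addr0 A0 addr0.
Qed.

Lemma le_opnorm (A : bop) x : `|A x| <= (opnorm A)%:C * `|x|.
Proof.
have [->|x0] := eqVneq x 0; first by rewrite -(scale0r (0 : X)) bopZ !scale0r normr0 mulr0.
rewrite -ler_pdivrMr ?normr_gt0// mulrC.
have -> : `|x|^-1 * `|A x| = `|A (`|x|^-1 *: x)|.
  by rewrite bopZ normrZ normfV normr_id.
rewrite norm_RRe lecR; apply: sup_ubound; last first.
  exists (`|x|^-1 *: x) => //=.
  by rewrite normrZ normfV normr_id mulVf// normr_eq0.
case: A => A /= /bounded_opP[_ [K AK]].
exists `|K| => _ [y /= y1 <-]; rewrite -lecR -norm_RRe (le_trans (AK y))//.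
rewrite (@le_trans _ _ (`|K|%:C * `|y|))//.
  by rewrite ler_wpM2r// lecR ler_norm.
by rewrite -[leRHS]mulr1 ler_wpM2l// realC_ge0.
Qed.

Lemma opnorm_le (A : bop) (c : R) : 0 <= c ->
  (forall x, `|A x| <= c%:C * `|x|) -> opnorm A <= c.
Proof.
move=> c0 Ac; apply: ge_sup; first by exists (complex.Re `|A 0|), 0 => //=; rewrite normr0.
move=> _ [x /= x1 <-]; rewrite -lecR -norm_RRe (le_trans (Ac x))//.
by rewrite -[leRHS]mulr1 ler_wpM2l// realC_ge0.
Qed.

Lemma opnorm_ge0 (A : bop) : 0 <= opnorm A.
Proof.
have [[x x0]|X0] := pselect (exists x : X, x != 0).
  have := le_opnorm A x; move=> /(le_trans (normr_ge0 _)).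
  by rewrite pmulr_lge0 ?normr_gt0// realC_ge0.
rewrite /opnorm.
have -> : [set complex.Re `|A x| | x in [set x : X | `|x| <= 1]] = [set 0].
  have h (x : X) : `|x| = 0.
    by apply/eqP; rewrite normr_eq0; apply: contra_notT X0 => x0; exists x.
  apply/seteqP; split=> [_ [x _ <-]|_ ->] /=; first by rewrite h.
  by exists 0 => /=; rewrite h.
by rewrite sup1.
Qed.

Definition bop_norm (A : bop) : R[i] := (opnorm A)%:C.

Fact bop_ler_normD A B : bop_norm (A + B) <= bop_norm A + bop_norm B.
Proof.
rewrite -realCD lecR; apply: opnorm_le; first by rewrite addr_ge0 ?opnorm_ge0.
move=> x; rewrite realCD mulrDl (le_trans (ler_normD (A x) (B x)))//.
by rewrite lerD// le_opnorm.
Qed.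

Lemma opnormZ_le a A : opnorm (a *: A) <= normc a * opnorm A.
Proof.
apply: opnorm_le; first by rewrite mulr_ge0 ?normc_ge0 ?opnorm_ge0.
move=> x; rewrite -[_ x]/(a *: A x) normrZ realCM -normr_normc -mulrA.
by rewrite ler_wpM2l// le_opnorm.
Qed.

Fact bop_normrZ a A : bop_norm (a *: A) = `|a| * bop_norm A.
Proof.
rewrite normr_normc -realCM; congr (_%:C); apply/eqP; rewrite eq_le opnormZ_le/=.
have [->|a0] := eqVneq a 0; first by rewrite normc0 mul0r opnorm_ge0.
rewrite -{1}(scale1r A) -(mulVf a0) -scalerA.
rewrite (le_trans (ler_wpM2l (normc_ge0 _) (opnormZ_le _ _)))//.
by rewrite mulrA -normcM mulfV// normc1 mul1r.
Qed.

Fact bop_normr0_eq0 A : bop_norm A = 0 -> A = 0.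
Proof.
move=> [A0]; apply: val_inj; apply/funext => x; apply/eqP.
by rewrite -normr_le0 (le_trans (le_opnorm A x))// A0 mul0r.
Qed.

HB.instance Definition _ := Lmodule_isNormed.Build R[i] bop
  bop_ler_normD bop_normrZ bop_normr0_eq0.

Fact bounded_op_id : idfun \in bounded_op.
Proof. by apply/bounded_opP; split => //; exists 1 => x; rewrite mul1r. Qed.
Definition bop_id : bop := Bop bounded_op_id.

Fact bounded_op_comp (A B : bop) : A \o B \in bounded_op.
Proof.
apply/bounded_opP; split=> [a x y|]; first by rewrite /= !bop_linear.
exists (opnorm A * opnorm B) => x; rewrite (le_trans (le_opnorm _ _))//.
rewrite realCM -mulrA ler_wpM2l ?le_opnorm//.
by rewrite realC_ge0 opnorm_ge0.
Qed.
Definition bop_comp (A B : bop) : bop := Bop (bounded_op_comp A B).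

End bounded_operators.

Section BV.
Context {R : realType} (sigma : set R).
Implicit Types (f g : sigma -> R[i]) (s : seq sigma).

(* The empty sequence is allowed: it contributes the variation 0, like the
   sequences of length 1. *)
Definition increasing_on s : bool :=
  sorted (fun x y : sigma => \val x < \val y) s.

Definition variation_on f s : R :=
  \sum_(p <- zip s (behead s)) normc (f p.2 - f p.1).

Definition variations_on f : set R :=
  [set variation_on f s | s in [set s | increasing_on s]].

Definition BV_pred : {pred sigma -> R[i]} :=
  [pred f | `[< has_ubound (variations_on f) >]].

Lemma BV_predP f : reflect (has_ubound (variations_on f)) (f \in BV_pred).
Proof. exact: asboolP. Qed.

Lemma variation_on_ge0 f s : 0 <= variation_on f s.
Proof. by apply: sumr_ge0 => p _; exact: normc_ge0. Qed.

Lemma variation_on_cons f x y s :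
  variation_on f [:: x, y & s] = normc (f y - f x) + variation_on f (y :: s).
Proof. exact: big_cons. Qed.

Lemma variations_on0 f : variations_on f 0.
Proof. by exists [::] => //; rewrite /variation_on big_nil. Qed.

Lemma le_variation_on f g h s (a b : R) :
  (forall x y, normc (h y - h x) <=
     a * normc (f y - f x) + b * normc (g y - g x)) ->
  variation_on h s <= a * variation_on f s + b * variation_on g s.
Proof.
move=> le_h; rewrite /variation_on !mulr_sumr -big_split/=.
by apply: ler_sum => p _; exact: le_h.
Qed.

Lemma BV_le f g h (a b : R) : 0 <= a -> 0 <= b ->
  (forall x y, normc (h y - h x) <=
     a * normc (f y - f x) + b * normc (g y - g x)) ->
  f \in BV_pred -> g \in BV_pred -> h \in BV_pred.
Proof.
move=> a0 b0 le_h /BV_predP[M fM] /BV_predP[N gN]; apply/BV_predP.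
exists (a * M + b * N) => _ [s si <-].
rewrite (le_trans (le_variation_on s le_h))// lerD//.
  by rewrite ler_wpM2l//; apply: fM; exists s.
by rewrite ler_wpM2l//; apply: gN; exists s.
Qed.

Lemma BV_cst c : (fun=> c) \in BV_pred.
Proof.
apply/BV_predP; exists 0 => _ [s _ <-].
by rewrite /variation_on big1// => p _; rewrite subrr normc0.
Qed.

Lemma BV_submod_closed : submod_closed BV_pred.
Proof.
split; first exact: BV_cst.
move=> a f g fBV gBV.
apply: (@BV_le f g _ (normc a) 1) => //; first exact: normc_ge0.
move=> x y; rewrite mul1r -normcM !fctE.
have -> : a *: f y + g y - (a *: f x + g x) = a * (f y - f x) + (g y - g x).
  by rewrite mulrBr opprD addrACA.
exact: normcD.
Qed.
HB.instance Definition _ :=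
  GRing.isSubmodClosed.Build _ _ BV_pred BV_submod_closed.

Lemma BV_bounded f : f \in BV_pred ->
  has_ubound (range (fun t => normc (f t))).
Proof.
move=> /BV_predP[M fM].
have [[t0 _]|s0] := pselect (exists t : sigma, True); last first.
  by exists 0 => _ [t _ <-]; exfalso; apply: s0; exists t.
have lt_var x y : \val x < \val y -> normc (f x - f y) <= M.
  move=> xy; apply: (@le_trans _ _ (variation_on f [:: x; y])).
    rewrite /variation_on/= big_cons big_nil addr0/=.
    by rewrite -[_ - _]opprB; case: (_ - _) => u v; rewrite /= !sqrrN.
  by apply: fM; exists [:: x; y] => //=; rewrite /increasing_on/= xy.
exists (M + normc (f t0)) => _ [t _ <-].
have -> : f t = (f t - f t0) + f t0 by rewrite subrK.
rewrite (le_trans (normcD _ _))// lerD2r.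
have [tt0|t0t|/val_inj ->] := ltgtP (\val t) (\val t0); first exact: lt_var.
  rewrite -[f t - _]opprB; have := lt_var _ _ t0t.
  by case: (f t0 - f t) => u v; rewrite /= !sqrrN.
by rewrite subrr normc0; apply: fM; exact: variations_on0.
Qed.

Lemma BV_mulr_closed : mulr_closed BV_pred.
Proof.
split; first exact: BV_cst.
move=> f g fBV gBV.
have [M fM] := BV_bounded fBV; have [N gN] := BV_bounded gBV.
apply: (@BV_le f g _ `|N| `|M|) => // x y; rewrite !fctE.
have -> : f y * g y - f x * g x = g y * (f y - f x) + f x * (g y - g x).
  by rewrite !mulrBr [g y * f y]mulrC [g y * f x]mulrC addrA subrK.
rewrite (le_trans (normcD _ _))// !normcM lerD//.
  rewrite ler_wpM2r ?normc_ge0// (le_trans _ (ler_norm _))//.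
  by apply: gN; exists y.
rewrite ler_wpM2r ?normc_ge0// (le_trans _ (ler_norm _))//.
by apply: fM; exists x.
Qed.
HB.instance Definition _ := GRing.isMulClosed.Build _ BV_pred BV_mulr_closed.

Record BV := { BV_val :> sigma -> R[i]; _ : BV_val \in BV_pred }.
HB.instance Definition _ := [isSub for BV_val].
HB.instance Definition _ := [Choice of BV by <:].
Fact BV_subring_closed : subring_closed BV_pred.
Proof. by split; [exact: rpred1|exact: rpredB|exact: rpredM]. Qed.
HB.instance Definition _ :=
  GRing.SubChoice_isSubComPzRing.Build _ _ BV BV_subring_closed.
HB.instance Definition _ := [SubZmodule_isSubLmodule of BV by <:].

Definition supnorm (f : BV) : R := sup (range (fun t => normc (f t))).
Definition total_variation_on (f : BV) : R := sup (variations_on f).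

Definition BV_norm (f : BV) : R[i] := (supnorm f + total_variation_on f)%:C.

Lemma sup_le0 (A : set R) (c : R) : 0 <= c -> ubound A c -> sup A <= c.
Proof.
have [->|A0] := eqVneq A set0; first by rewrite sup0.
by move=> _ Ac; apply: ge_sup => //; exact/set0P.
Qed.

Lemma le_supnorm (f : BV) t : normc (f t) <= supnorm f.
Proof.
apply: ub_le_sup; last by exists t.
by apply: BV_bounded; case: f.
Qed.

Lemma supnorm_ge0 (f : BV) : 0 <= supnorm f.
Proof.
have [[t _]|s0] := pselect (exists t : sigma, True).
  exact: le_trans (normc_ge0 _) (le_supnorm f t).
rewrite /supnorm [X in sup X](_ : _ = set0) ?sup0//.
by apply/seteqP; split => // _ [t _ <-]; case: s0; exists t.
Qed.

Lemma le_total_variation (f : BV) s : increasing_on s ->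
  variation_on f s <= total_variation_on f.
Proof.
move=> si; apply: ub_le_sup; last by exists s.
by apply/BV_predP; case: f.
Qed.

Lemma total_variation_ge0 (f : BV) : 0 <= total_variation_on f.
Proof.
apply: ub_le_sup; last exact: variations_on0.
by apply/BV_predP; case: f.
Qed.

Fact BV_ler_normD (f g : BV) : BV_norm (f + g) <= BV_norm f + BV_norm g.
Proof.
rewrite -realCD lecR addrACA lerD//; apply: sup_le0.
- by rewrite addr_ge0 ?supnorm_ge0.
- by move=> _ [t _ <-]; rewrite (le_trans (normcD _ _))// lerD ?le_supnorm.
- by rewrite addr_ge0 ?total_variation_ge0.
move=> _ [s si <-].
rewrite (le_trans (_ : _ <= 1 * variation_on f s + 1 * variation_on g s))//.
  apply: le_variation_on => x y; rewrite !mul1r.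
  have -> : (f + g : BV) y - (f + g : BV) x = (f y - f x) + (g y - g x).
    by rewrite -[LHS]/(f y + g y - (f x + g x)) opprD addrACA.
  exact: normcD.
by rewrite !mul1r lerD ?le_total_variation.
Qed.

Lemma BV_normZ_le a (f : BV) : BV_norm (a *: f) <= `|a| * BV_norm f.
Proof.
rewrite normr_normc -realCM lecR mulrDr lerD//; apply: sup_le0.
- by rewrite mulr_ge0 ?normc_ge0 ?supnorm_ge0.
- move=> _ [t _ <-]; rewrite (_ : normc _ = normc a * normc (f t)); last exact: normcM.
  by rewrite ler_wpM2l ?normc_ge0 ?le_supnorm.
- by rewrite mulr_ge0 ?normc_ge0 ?total_variation_ge0.
move=> _ [s si <-].
rewrite (le_trans (_ : _ <= normc a * variation_on f s + 0 * variation_on f s))//.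
  apply: le_variation_on => x y; rewrite mul0r addr0 -normcM.
  by rewrite -[X in normc X <= _]/(a * f y - a * f x) mulrBr.
by rewrite mul0r addr0 ler_wpM2l ?normc_ge0 ?le_total_variation.
Qed.

Lemma BV_norm_ge0 (f : BV) : 0 <= BV_norm f.
Proof. by rewrite realC_ge0 addr_ge0 ?supnorm_ge0 ?total_variation_ge0. Qed.

Fact BV_normrZ a (f : BV) : BV_norm (a *: f) = `|a| * BV_norm f.
Proof.
apply/eqP; rewrite eq_le BV_normZ_le/=.
have [->|a0] := eqVneq a 0; first by rewrite normr0 mul0r BV_norm_ge0.
rewrite -{1}(scale1r f) -(mulVf a0) -scalerA.
rewrite (le_trans (ler_wpM2l (normr_ge0 _) (BV_normZ_le _ _)))//.
by rewrite mulrA -normrM mulfV// normr1 mul1r.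
Qed.

Fact BV_normr0_eq0 (f : BV) : BV_norm f = 0 -> f = 0.
Proof.
move=> [/eqP]; rewrite paddr_eq0 ?supnorm_ge0 ?total_variation_ge0//.
move=> /andP[/eqP f0 _]; apply: val_inj; apply/funext => t.
by apply: eq0_normc; apply/eqP; rewrite eq_le normc_ge0 -f0 le_supnorm.
Qed.

HB.instance Definition _ := Lmodule_isNormed.Build R[i] BV
  BV_ler_normD BV_normrZ BV_normr0_eq0.

Section AC.
Hypothesis csigma : compact sigma.

Lemma BV_id : (fun t : sigma => (\val t)%:C) \in BV_pred.
Proof.
have [M [_ sM]] := compact_bounded csigma.
have {}sM (t : sigma) : `|\val t| <= M + 1.
  by apply: sM => /=; [rewrite ltrDl|exact: set_valP].
have tel s x : increasing_on (x :: s) ->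
    variation_on (fun t : sigma => (\val t)%:C) (x :: s) =
    \val (last x s) - \val x.
  elim: s x => [|y s IH] x; first by rewrite /variation_on big_nil subrr.
  move=> /= /andP[xy ys]; have := IH y ys.
  rewrite variation_on_cons => ->; rewrite normc_realB.
  by rewrite gtr0_norm ?subr_gt0// addrC addrA subrK.
apply/BV_predP; exists (`|M + 1| + `|M + 1|) => _ [[|x s] si <-].
  rewrite /variation_on big_nil.
  by rewrite addr_ge0.
rewrite tel// lerD// (le_trans (ler_norm _))// ?normrN.
  by rewrite (le_trans (sM _))// ler_norm.
by rewrite (le_trans (sM _))// ler_norm.
Qed.

Lemma BV_poly (p : {poly R[i]}) :
  (fun t : sigma => p.[(\val t)%:C]) \in BV_pred.
Proof.
elim/poly_ind: p => [|p c IHp].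
  by under eq_fun do rewrite horner0; exact: BV_cst.
under eq_fun do rewrite hornerMXaddC.
by rewrite rpredD ?rpredM//; [exact: BV_id|exact: BV_cst].
Qed.

(* [csigma] is needed for polynomials to be of bounded variation on sigma. *)
Definition polyBV (p : {poly R[i]}) : BV := Build_BV (BV_poly p).

(* closure in the topology of the BV norm *)
Definition ACfun : set BV := closure (range polyBV).

End AC.

End BV.

Section complex_measurable_functions.
Context d (T : measurableType d) (R : realType).

Definition cmfun : {pred T -> R[i]} := [pred f | `[<
  measurable_fun [set: T] (fun t => complex.Re (f t)) /\
  measurable_fun [set: T] (fun t => complex.Im (f t)) >]].

Lemma cmfunP f : reflect
  (measurable_fun [set: T] (fun t => complex.Re (f t)) /\
   measurable_fun [set: T] (fun t => complex.Im (f t))) (f \in cmfun).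
Proof. exact: asboolP. Qed.

Lemma cmfun_submod_closed : submod_closed cmfun.
Proof.
split; first by apply/cmfunP; split; exact: measurable_cst.
move=> a f g /cmfunP[mf1 mf2] /cmfunP[mg1 mg2]; apply/cmfunP; split.
- under eq_fun do rewrite fctE/=.
  have -> : (fun t => complex.Re (a *: f t + g t)) =
     (fun t => complex.Re a * complex.Re (f t) - complex.Im a * complex.Im (f t)
       + complex.Re (g t)).
    by apply/funext => t; case: a (f t) (g t) => [? ?] [? ?] [? ?].
  by apply: measurable_funD => //; apply: measurable_funB;
    apply: measurable_funM.
- have -> : (fun t => complex.Im ((a *: f + g) t)) =
     (fun t => complex.Re a * complex.Im (f t) + complex.Im a * complex.Re (f t)
       + complex.Im (g t)).
    by apply/funext => t; rewrite !fctE; case: a (f t) (g t) => [? ?] [? ?] [? ?].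
  by apply: measurable_funD => //; apply: measurable_funD;
    apply: measurable_funM.
Qed.
HB.instance Definition _ :=
  GRing.isSubmodClosed.Build _ _ cmfun cmfun_submod_closed.

Record CMfun := { CMfun_val :> T -> R[i]; _ : CMfun_val \in cmfun }.
HB.instance Definition _ := [isSub for CMfun_val].
HB.instance Definition _ := [Choice of CMfun by <:].
HB.instance Definition _ := [SubChoice_isSubLmodule of CMfun by <:].

Lemma measurable_normc (f : CMfun) :
  measurable_fun [set: T] (fun t => normc (f t)).
Proof.
case: f => f /= /cmfunP[m1 m2].
have -> : (fun t => normc (f t)) = (fun t =>
    Num.sqrt (complex.Re (f t) ^+ 2 + complex.Im (f t) ^+ 2)).
  by apply/funext => t; case: (f t).
apply: (@measurableT_comp _ _ _ _ _ _ (@Num.sqrt R)).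
  by apply: continuous_measurable_fun; exact: sqrt_continuous.
by apply: measurable_funD; exact: measurable_funX.
Qed.

End complex_measurable_functions.

Section L0.
Context d (T : measurableType d) (R : realType).
Variable mu : {measure set T -> \bar R}.

Definition cnull : {pred CMfun T R} :=
  [pred f : CMfun T R | `[< (f : T -> R[i]) = cst 0 %[ae mu] >]].

Lemma cnull_zmod_closed : zmod_closed cnull.
Proof.
split; first by apply/asboolP; exact: aeW.
move=> f g /asboolP hf /asboolP hg; apply/asboolP.
apply: filterS2 hf hg => t /= ft gt _.
by rewrite -[LHS]/(f t - g t) ft// gt// subr0.
Qed.
HB.instance Definition _ := GRing.isZmodClosed.Build _ cnull cnull_zmod_closed.

Lemma cnullZ a f : f \in cnull -> a *: f \in cnull.
Proof.
move=> /asboolP hf; apply/asboolP; apply: filterS hf => t /= ft _.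
by rewrite -[LHS]/(a *: f t) ft// scaler0.
Qed.

Definition L0 : Type := Quotient.quot cnull.
HB.instance Definition _ := GRing.Zmodule.on L0.
HB.instance Definition _ := EqQuotient.on L0.

Local Open Scope quotient_scope.

Definition L0_fun (f : L0) : CMfun T R := repr f.

Lemma L0_eqP (f g : CMfun T R) :
  reflect ((f : T -> R[i]) = g %[ae mu]) (\pi_L0 f == \pi_L0 g).
Proof.
rewrite -[_ == _]/(f == g %[mod Quotient.quot cnull]) -Quotient.idealrBE.
apply: (iffP (asboolP _)); apply: filterS => t /= fg _.
  by apply: subr0_eq; exact: fg.
by rewrite -[LHS]/(f t - g t) fg// subrr.
Qed.

Lemma L0_repr (f : CMfun T R) : (repr (\pi_L0 f) : T -> R[i]) = f %[ae mu].
Proof. by apply/L0_eqP; rewrite reprK. Qed.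

Lemma L0_pi_add f g : \pi_L0 f + \pi_L0 g = \pi_L0 (f + g).
Proof. exact: esym (Quotient.pi_add cnull f g). Qed.

Lemma L0_reprD (f g : L0) :
  (repr (f + g) : T -> R[i]) = (repr f + repr g : CMfun T R) %[ae mu].
Proof.
have -> : f + g = \pi_L0 (repr f + repr g).
  by rewrite -L0_pi_add !reprK.
exact: L0_repr.
Qed.

Definition L0_scale (a : R[i]) (f : L0) : L0 := \pi_L0 (a *: repr f).

Lemma L0_scale_pi a f : L0_scale a (\pi_L0 f) = \pi_L0 (a *: f).
Proof.
apply/eqP/L0_eqP; apply: filterS (L0_repr f) => t /= ft _.
by rewrite -[LHS]/(a *: _ t) ft.
Qed.

Fact L0_scalerA a b v : L0_scale a (L0_scale b v) = L0_scale (a * b) v.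
Proof. by rewrite -[v]reprK; move: (repr v) => u; rewrite (L0_scale_pi b u) !L0_scale_pi scalerA. Qed.
Fact L0_scale1r : left_id 1 L0_scale.
Proof. by move=> v; rewrite -[v]reprK; move: (repr v) => u; rewrite L0_scale_pi scale1r. Qed.
Fact L0_scalerDr : right_distributive L0_scale +%R.
Proof.
move=> a u v; rewrite -[v]reprK -[u]reprK; move: (repr u) (repr v) => f g.
by rewrite L0_pi_add !L0_scale_pi L0_pi_add scalerDr.
Qed.
Fact L0_scalerDl v : {morph L0_scale^~ v : a b / a + b}.
Proof. move=> a b /=; rewrite -[v]reprK; move: (repr v) => u.
by rewrite !L0_scale_pi L0_pi_add scalerDl.
 Qed.
HB.instance Definition _ := GRing.Zmodule_isLmodule.Build R[i] L0
  L0_scalerA L0_scale1r L0_scalerDr L0_scalerDl.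

Lemma L0_reprZ a (f : L0) :
  (repr (a *: f) : T -> R[i]) = (a *: repr f : CMfun T R) %[ae mu].
Proof. exact: (L0_repr (a *: repr f)). Qed.

End L0.
Coercion L0_fun : L0 >-> CMfun.

Section Lnormc.
Context d (T : measurableType d) (R : realType).
Variable mu : {measure set T -> \bar R}.
Implicit Types (f g : CMfun T R) (p : \bar R).
Local Open Scope ereal_scope.

Definition Lnormc p (f : T -> R[i]) : \bar R :=
  Lnorm mu p (EFin \o (fun t => normc (f t))).

Lemma Lnormc_ge0 p (f : T -> R[i]) : 0 <= Lnormc p f.
Proof. exact: Lnorm_ge0. Qed.

Lemma measurable_normc_powR f (r : R) :
  measurable_fun [set: T] (fun t => `|(normc (f t))%:E| `^ r).
Proof.
apply/measurable_EFinP => /=.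
apply: (@measurableT_comp _ _ _ _ _ _ (@powR R ^~ r)) => //.
by apply: measurableT_comp => //; exact: measurable_normc.
Qed.

Lemma ae_eq_Lnormc p f g : 1 <= p -> (f : T -> R[i]) = g %[ae mu] ->
  Lnormc p f = Lnormc p g.
Proof.
rewrite /Lnormc unlock; case: p => [r||//] p1 fg /=.
- congr (_ `^ _); apply: ge0_ae_eq_integral => //.
  + exact: measurable_normc_powR.
  + exact: measurable_normc_powR.
  + by apply: filterS fg => t /= /[apply] ->.
- case: ifPn => // _; apply: eq_ess_sup.
  by apply: filterS fg => t /= ->.
Qed.

Lemma le_Lnorm p (F G : T -> R) : 1 <= p ->
  measurable_fun [set: T] F -> measurable_fun [set: T] G ->
  (forall t, (0 <= F t <= G t)%R) ->
  Lnorm mu p (EFin \o F) <= Lnorm mu p (EFin \o G).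
Proof.
rewrite unlock; case: p => [r||//] p1 mF mG FG /=.
- have r0 : (0 <= r)%R by rewrite -lee_fin (le_trans _ p1).
  have mpow (H : T -> R) : measurable_fun [set: T] H ->
      measurable_fun [set: T] (fun t => (`|H t| `^ r)%:E).
    move=> mH; apply/measurable_EFinP => /=.
    apply: (@measurableT_comp _ _ _ _ _ _ (@powR R ^~ r)) => //.
    exact: measurableT_comp.
  have int0 (H : T -> R) : 0 <= \int[mu]_t (`|H t| `^ r)%:E.
    by apply: integral_ge0 => t _; rewrite lee_fin powR_ge0.
  apply: gt0_ler_poweR; rewrite ?invr_ge0 ?in_itv/= ?int0 ?leey//.
  apply: ge0_le_integral => //; do ?exact: mpow.
  move=> t _; rewrite lee_fin; apply: ge0_ler_powR; rewrite ?nnegrE//.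
  by have /andP[F0 FGt] := FG t; rewrite !ger0_norm// (le_trans F0).
- case: ifPn => // _; apply: le_ess_sup; apply: nearW => t /=.
  by have /andP[F0 FGt] := FG t; rewrite lee_fin !ger0_norm// (le_trans F0).
Qed.

Lemma LnormcD p f g : 1 <= p ->
  Lnormc p (f + g)%R <= Lnormc p f + Lnormc p g.
Proof.
move=> p1; apply: le_trans (eminkowski mu _ _ p1); try exact: measurable_normc.
apply: le_Lnorm => //; first exact: measurable_normc.
  by apply: measurable_realfun.measurable_funD; exact: measurable_normc.
by move=> t /=; rewrite normc_ge0/= normcD.
Qed.

Lemma LnormcZ p a f : 1 <= p -> Lnormc p f < +oo ->
  Lnormc p (a *: f)%R = (normc a)%:E * Lnormc p f.
Proof.
move=> p1 foo.
have fL : (fun t => normc (f t)) \in Lfun mu p.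
  by rewrite inE/=; apply/andP; split; rewrite inE//=; exact: measurable_normc.
have := LnormZ (Lfun_Sub p1 fL) (normc a).
rewrite ger0_norm ?normc_ge0// => <-.
by congr (Lnorm mu p _); apply/funext => t; congr EFin; exact: normcM.
Qed.

Lemma Lnormc_eq0 p f : 1 <= p -> Lnormc p f = 0 ->
  (f : T -> R[i]) = cst 0%R %[ae mu].
Proof.
move=> p1 /Lnorm_eq0_eq0 h.
have /h : measurable_fun [set: T] (EFin \o (fun t => normc (f t))).
  by apply/measurable_EFinP; exact: measurable_normc.
move=> /(_ (lt_le_trans lte01 p1)); apply: filterS => t /= /[apply].
by case=> /eq0_normc.
Qed.

End Lnormc.

Section Lp.
Context d (T : measurableType d) (R : realType).
Variable mu : {measure set T -> \bar R}.
Implicit Types (f g : L0 mu) (p : \bar R).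

Definition L0norm p f : \bar R := Lnormc mu p f.

Definition Lp_pred p (p1 : (1 <= p)%E) : {pred L0 mu} := [pred f | (L0norm p f < +oo)%E].

Lemma L0norm_ge0 p f : (0 <= L0norm p f)%E. Proof. exact: Lnormc_ge0. Qed.

Lemma L0normD p f g : (1 <= p)%E ->
  (L0norm p (f + g)%R <= L0norm p f + L0norm p g)%E.
Proof.
move=> p1; rewrite /L0norm (ae_eq_Lnormc p1 (L0_reprD f g)).
exact: LnormcD.
Qed.

Lemma L0normZ p (p1 : (1 <= p)%E) a f : f \in Lp_pred p1 ->
  L0norm p (a *: f) = ((normc a)%:E * L0norm p f)%E.
Proof.
move=> foo; rewrite /L0norm (ae_eq_Lnormc p1 (L0_reprZ a f)).
exact: LnormcZ.
Qed.

Lemma L0_pi0 : 0 = \pi_(L0 mu)%qT (0 : CMfun T R).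
Proof. by apply: (@addrI _ (\pi_(L0 mu)%qT 0)); rewrite L0_pi_add !addr0. Qed.

Lemma L0norm_eq0 p f : (1 <= p)%E -> L0norm p f = 0%E -> f = 0.
Proof.
move=> p1 /(Lnormc_eq0 p1) h; rewrite -[f]reprK L0_pi0.
exact/eqP/L0_eqP.
Qed.

Lemma L0norm0 p : (1 <= p)%E -> L0norm p 0 = 0%E.
Proof.
move=> p1; rewrite /L0norm L0_pi0 (ae_eq_Lnormc p1 (L0_repr mu 0)).
rewrite /Lnormc -[RHS](@Lnorm0 _ _ _ mu p) ?gt_eqF ?(lt_le_trans lte01 p1)//.
by apply: eq_Lnorm => t; congr EFin; exact: normc0.
Qed.

Lemma Lp_submod_closed p (p1 : (1 <= p)%E) : submod_closed (Lp_pred p1).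
Proof.
split; first by rewrite inE/= L0norm0.
move=> a f g foo goo; rewrite inE/= (le_lt_trans (L0normD _ _ p1))//.
by rewrite lte_add_pinfty// L0normZ// lte_mul_pinfty// ?lee_fin ?normc_ge0.
Qed.

Section Lp_type.
Variables (p : \bar R) (p1 : (1 <= p)%E).

HB.instance Definition _ :=
  GRing.isSubmodClosed.Build _ _ (Lp_pred p1) (Lp_submod_closed p1).

Record Lp := { Lp_val :> L0 mu; _ : Lp_val \in Lp_pred p1 }.
HB.instance Definition _ := [isSub for Lp_val].
HB.instance Definition _ := [Choice of Lp by <:].
HB.instance Definition _ := [SubChoice_isSubLmodule of Lp by <:].

Definition Lp_norm (f : Lp) : R[i] := (fine (L0norm p f))%:C.

Lemma Lp_fin (f : Lp) : (fine (L0norm p f))%:E = L0norm p f.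
Proof. by rewrite fineK// ge0_fin_numE ?L0norm_ge0//; case: f. Qed.

Fact Lp_ler_normD (f g : Lp) : Lp_norm (f + g) <= Lp_norm f + Lp_norm g.
Proof.
by rewrite -rmorphD lecR -lee_fin EFinD !Lp_fin; exact: L0normD.
Qed.

Fact Lp_normrZ a (f : Lp) : Lp_norm (a *: f) = `|a| * Lp_norm f.
Proof.
rewrite normr_normc -rmorphM; congr (_%:C); apply: EFin_inj.
by rewrite EFinM !Lp_fin; apply: L0normZ => //; case: f.
Qed.

Fact Lp_normr0_eq0 (f : Lp) : Lp_norm f = 0 -> f = 0.
Proof.
move=> [f0]; apply: val_inj; apply: (L0norm_eq0 p1).
by rewrite -Lp_fin f0.
Qed.

HB.instance Definition _ := Lmodule_isNormed.Build R[i] Lp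
  Lp_ler_normD Lp_normrZ Lp_normr0_eq0.

End Lp_type.

End Lp.

Notation L1 mu := (@Lp _ _ _ mu 1%E (lexx 1%E)).
Notation Linfty mu := (@Lp _ _ _ mu +oo%E (leey 1%E)).

Section pairing.
Context d (T : measurableType d) (R : realType).
Variable mu : {measure set T -> \bar R}.

Definition cintegral (f : T -> R[i]) : R[i] :=
  (\int[mu]_t complex.Re (f t)) +i* (\int[mu]_t complex.Im (f t)).

Definition pairing (y : L1 mu) (x : Linfty mu) : R[i] :=
  cintegral (fun t => y t * x t).

(* L^oo is the dual of L^1 via the pairing.  This can fail for an arbitrary
   positive measure (it amounts to mu being localizable); it always holds when
   mu is sigma-finite. *)
Definition Linfty_is_dual_of_L1 : Prop :=
  forall phi : {linear L1 mu -> R[i]^o}, continuous phi ->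
  exists! x : Linfty mu, forall y : L1 mu, phi y = pairing y x.

Definition is_adjoint (A : bop (Linfty mu)) (S : bop (L1 mu)) : Prop :=
  forall (y : L1 mu) (x : Linfty mu), pairing y (A x) = pairing (S y) x.

End pairing.

(* The values of [pl_fun] outside [pl_dom] are irrelevant. *)
Record partial_linear (K : pzRingType) (V : lmodType K) := PartialLinear {
  pl_dom : {pred V};
  pl_fun :> V -> V;
  pl_dom_closed : submod_closed pl_dom;
  pl_linear : forall (a : K) (x y : V), x \in pl_dom -> y \in pl_dom ->
    pl_fun (a *: x + y) = a *: pl_fun x + pl_fun y
}.

Section operator_on_Lp.
Context d (T : measurableType d) (R : realType).
Variable mu : {measure set T -> \bar R}.
Variable A : partial_linear (L0 mu).
Local Open Scope ereal_scope.

Definition defines_bounded_on (p : \bar R) : Prop :=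
  (forall x : L0 mu, L0norm p x < +oo -> x \in pl_dom A) /\
  exists K : R, forall x : L0 mu, L0norm p x < +oo ->
    L0norm p (A x) <= K%:E * L0norm p x.

Variables (p : \bar R) (p1 : 1 <= p) (hA : defines_bounded_on p).

Lemma Lp_finite (x : Lp mu p1) : L0norm p x < +oo.
Proof. by case: x. Qed.

Fact Lp_restrict_subproof (x : Lp mu p1) : A (Lp_val x) \in Lp_pred p1.
Proof.
have [_ [K AK]] := hA; rewrite inE/= (le_lt_trans (AK _ (Lp_finite x)))//.
by rewrite -Lp_fin -EFinM ltry.
Qed.

Definition Lp_restrict_fun (x : Lp mu p1) : Lp mu p1 :=
  Build_Lp (Lp_restrict_subproof x).

Fact Lp_restrict_bounded : Lp_restrict_fun \in @bounded_op R (Lp mu p1).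
Proof.
have [domA [K AK]] := hA; apply/bounded_opP; split=> [a x y|].
  by apply: val_inj; apply: pl_linear; apply: domA; exact: Lp_finite.
exists K => x.
change (Lp_norm (Lp_restrict_fun x) <= K%:C * Lp_norm x)%R.
rewrite -realCM lecR -lee_fin EFinM !Lp_fin.
exact: AK (Lp_finite x).
Qed.

(* the restriction [A_p] of [A] to [L^p], as an element of [B(L^p)] *)
Definition Lp_restrict : bop (Lp mu p1) := Bop Lp_restrict_bounded.

End operator_on_Lp.

Section functional_calculus.
Context {R : realType} (sigma : set R) (csigma : compact sigma).
Context {X : normedModType R[i]}.

(* [Phi] is an algebra homomorphism on the subalgebra [A] of BV(sigma); its
   values outside [A] are irrelevant. *)
Definition algebra_hom_on (A : set (BV sigma)) (Phi : BV sigma -> bop X) :=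
  (forall (a : R[i]) f g, A f -> A g ->
    Phi (a *: f + g) = a *: Phi f + Phi g) /\
  (forall f g, A f -> A g -> Phi (f * g) = bop_comp (Phi f) (Phi g)).

Definition AC_functional_calculus (T : bop X) (Phi : BV sigma -> bop X) :=
  [/\ algebra_hom_on (ACfun csigma) Phi,
      exists K : R, forall f, ACfun csigma f -> `|Phi f| <= K%:C * `|f|,
      Phi 1 = bop_id X &
      Phi (polyBV csigma 'X) = T].

Definition real_AC_operator (T : bop X) : Prop :=
  exists Phi, AC_functional_calculus T Phi.

Definition has_BV_functional_calculus (T : bop X) : Prop :=
  exists Phi Psi : BV sigma -> bop X,
  [/\ AC_functional_calculus T Phi,
      algebra_hom_on setT Psi,
      continuous Psi &
      forall f, ACfun csigma f -> Psi f = Phi f].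

End functional_calculus.

(* Main.v *)
Require Import Defs.
From HB Require Import structures.
From mathcomp Require Import all_boot all_order all_algebra.
From mathcomp Require Import complex.
From mathcomp Require Import all_classical all_reals all_analysis.
From mathcomp Require Import measurable_realfun ess_sup_inf.
From mathcomp Require Import lra ring.
Set Implicit Arguments.
Unset Strict Implicit.
Unset Printing Implicit Defensive.
Import Order.TTheory GRing.Theory Num.Theory.
Import numFieldNormedType.Exports.
Import ComplexField.Normc.
Local Open Scope classical_set_scope.
Local Open Scope ring_scope.
Local Open Scope complex_scope.

(** The operator [T] on [L^oo] is the adjoint of [S], so a polynomial [p(T)] is the
    adjoint of [p(S)], and it is enough to extend [p |-> p(S)] from polynomials to
    functions of bounded variation on [L^1] and to take adjoints. On a reflexive
    space this extension rests on the weak compactness of bounded sets. Here it is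
    [L^r] that supplies a substitute for compactness.

    On a bounded function [x] in [L^r], [p(T)] is controlled in the [L^r] norm and in
    the [L^oo] norm at the same time. Therefore [p(S)] is bounded by a multiple of
    the variation norm of [p] in each of the norms
      [nu_a y = sup { |<y, x>| : a ||x||_r + ||x||_oo <= 1 }]
    on [L^1], with a constant independent of [a] ([dual_norm], [dual_norm_adjoint]).
    The norm [nu_0] is equivalent to the [L^1] norm, and [nu_a y] tends to [0] when
    [a] grows, for every [y] ([dual_norm_small]). So the set of all [z] with
    [nu_a z <= K nu_a y] for all [a] has a kind of uniform integrability: each
    sequence in it has convex combinations of its tails that converge in [nu_1]
    ([dual_norm_hull_compact]). To find them, minimize the strictly convex functional
    [v |-> \int (sqrt (1 + |v|^2) - 1)] over the tails. Almost minimizers are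
    Cauchy in measure ([close_in_measure]), Fatou's lemma puts the limit in measure
    in [L^1] ([limit_in_measure]), and the domination by [y] improves convergence in
    measure to convergence in [nu_1] ([dual_norm_cvg]).

    The rest of the construction on [L^1] uses only this compactness, which is the
    notion of a [compact_family]. A dominated Cauchy sequence converges, which extends
    the calculus to absolutely continuous functions. By an argument of Lorch, a
    sequence of operators each of which absorbs the later ones, like a decreasing
    sequence of projections, converges at each vector
    ([decreasing_projections_cvgs]); applied to the operators of the continuous,
    piecewise affine functions that descend from [1] to [0] just to the right of
    [l], it yields projections [E l], increasing in [l], continuous from the right
    and with limits from the left. For [y] fixed, [sigma] has partitions between the
    points of which [E l y] hardly varies ([chain_exists]). The Riemann-Stieltjes
    sums of [\int f dE y] along them converge for every [f] of bounded variation,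
    since summation by parts ([abel]) bounds a sum by the variation norm of [f]. On
    one partition the sums are exactly multiplicative in [f], hence so is the limit
    ([BV_calculus_mul]). For [f t = t] the limit is [S], because on [sigma] the
    function [t] is a combination of the piecewise affine functions attached to
    consecutive points ([calc_id], [BV_calculus_id]). *)

(** * Seminorm families and convex compactness *)

(** The bound is asked only for small [e], so that error terms of higher order in [e]
    can be absorbed in [c]. *)
Lemma le0_of_le_mul_eps {R : realType} (x c : R) :
  (forall e, 0 < e -> e <= 1 -> x <= c * e) -> x <= 0.
Proof.
move=> xc; rewrite leNgt; apply/negP => x0.
have c0 : 0 < `|c| + 1 by rewrite ltr_wpDl.
pose e := Num.min 1 (x / (`|c| + 1) / 2).
have e0 : 0 < e by rewrite /e lt_min ltr01/= !divr_gt0.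
have := xc e e0; rewrite {1}/e ge_min lexx/= => /(_ isT).
have ce : c * e <= (`|c| + 1) * e.
  by rewrite ler_wpM2r ?(ltW e0)// (le_trans (ler_norm _))// lerDl.
have : (`|c| + 1) * e <= x / 2.
  by rewrite mulrC -ler_pdivlMr// mulrAC ge_min lexx orbT.
by lra.
Qed.

Lemma normc_half {R : realType} : normc (2^-1 : R[i]) = 2^-1 :> R.
Proof.
have -> : (2^-1 : R[i]) = (2^-1)%:C by rewrite rmorphV ?unitfE ?pnatr_eq0//= rmorph_nat.
by rewrite normc_real ger0_norm// invr_ge0.
Qed.

Section Families.
Context {R : realType} {W : lmodType R[i]} {I : Type}.
Variables (nu : I -> W -> R) (i0 : I).

Definition dominated (K : R) (z y : W) := forall i, nu i z <= K * nu i y.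

Definition midpoint_convex (P : W -> Prop) :=
  forall u v, P u -> P v -> P (2^-1 *: (u + v)).

(** The intersection of all midpoint-convex sets that contain the tail [z k, z k.+1, ...]:
    the convex combinations of the tail with dyadic weights, without the bookkeeping of
    the weights. *)
Definition tail_hull (z : nat -> W) (k : nat) (v : W) :=
  forall P, midpoint_convex P -> (forall n, (k <= n)%N -> P (z n)) -> P v.

(** A family of seminorms with a weak form of compactness for the sets of vectors
    dominated by a fixed vector. Convergence is taken in the single norm [nu i0], in
    which the other seminorms need not be continuous, only lower semicontinuous. *)
Record compact_family : Prop := CompactFamily {
  family_sublinear : forall i a u v, nu i (a *: u + v) <= normc a * nu i u + nu i v;
  family0 : forall i, nu i 0 = 0;
  family_separates : forall u, nu i0 u <= 0 -> u = 0;
  family_lsc : forall i c u,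
    (forall e, 0 < e -> exists2 v, nu i0 (u - v) <= e & nu i v <= c + e) ->
    nu i u <= c;
  family_hull_compact : forall K y z, (forall n, dominated K (z n) y) ->
    exists u, forall e k, 0 < e -> exists2 v, tail_hull z k v & nu i0 (v - u) <= e }.

Definition cvgs (z : nat -> W) (u : W) :=
  forall e, 0 < e -> exists m, forall n, (m <= n)%N -> nu i0 (z n - u) <= e.

(** Domination in all seminorms at once is what keeps the orbits of [A] inside the sets
    to which [family_hull_compact] applies. *)
Definition dominated_linear (K : R) (A : W -> W) :=
  (forall a u v, A (a *: u + v) = a *: A u + A v) /\
  (forall y, dominated K (A y) y).

Hypothesis H : compact_family.

Lemma familyD i u v : nu i (u + v) <= nu i u + nu i v.
Proof. by have := family_sublinear H i 1 u v; rewrite scale1r normc1 mul1r. Qed.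

Lemma familyZ_le i a u : nu i (a *: u) <= normc a * nu i u.
Proof. by have := family_sublinear H i a u 0; rewrite !addr0 (family0 H) addr0. Qed.

Lemma familyN i u : nu i (- u) = nu i u.
Proof.
have le_opp v : nu i (- v) <= nu i v.
  by rewrite -scaleN1r (le_trans (familyZ_le _ _ _))// normcN normc1 mul1r.
by apply/eqP; rewrite eq_le le_opp -{1}(opprK u) le_opp.
Qed.

Lemma familyB i u v : nu i (u - v) <= nu i u + nu i v.
Proof. by rewrite -(familyN i v) familyD. Qed.

Lemma family_distC i u v : nu i (u - v) = nu i (v - u).
Proof. by rewrite -familyN opprB. Qed.

Lemma family_dist_trans i v u w : nu i (u - w) <= nu i (u - v) + nu i (v - w).
Proof. by rewrite (le_trans _ (familyD _ _ _))// addrA subrK. Qed.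

Lemma family_ge0 i u : 0 <= nu i u.
Proof.
have := familyB i u u; rewrite subrr (family0 H).
by rewrite -mulr2n pmulrn_lge0.
Qed.

Lemma familyZ_real i (a : R) u : 0 <= a -> nu i (a%:C *: u) <= a * nu i u.
Proof. by move=> a0; rewrite (le_trans (familyZ_le _ _ _))// normc_real ger0_norm. Qed.

Lemma family_half i u : nu i (2^-1 *: u) <= nu i u / 2.
Proof. by rewrite (le_trans (familyZ_le _ _ _))// normc_half mulrC. Qed.

Lemma family_eq_small u v c :
  (forall e, 0 < e -> e <= 1 -> nu i0 (u - v) <= c * e) -> u = v.
Proof.
by move=> uv; apply: subr0_eq; apply: (family_separates H); apply: le0_of_le_mul_eps uv.
Qed.

Lemma midpoint_convex_ball i w c : midpoint_convex (fun v => nu i (v - w) <= c).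
Proof.
move=> u v uc vc; have -> : 2^-1 *: (u + v) - w = 2^-1 *: ((u - w) + (v - w)).
  have -> : u - w + (v - w) = u + v - 2 *: w by rewrite scaler_nat mulr2n opprD addrACA.
  by rewrite [RHS]scalerBr scalerA mulVf ?pnatr_eq0// scale1r.
rewrite (le_trans (family_half _ _))// ler_pdivrMr// mulr_natr mulr2n.
by rewrite (le_trans (familyD _ _ _))// lerD.
Qed.

Lemma cvgs_unique z u v : cvgs z u -> cvgs z v -> u = v.
Proof.
move=> zu zv; apply: (@family_eq_small _ _ 2) => e e0 _.
have [m zm] := zu e e0; have [n zn] := zv e e0.
rewrite (le_trans (family_dist_trans _ (z (maxn m n)) _ _))// mulr_natl mulr2n.
apply: lerD; last by apply: zn; exact: leq_maxr.
by rewrite family_distC; apply: zm; exact: leq_maxl.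
Qed.

Lemma dominated_le K L z y : K <= L -> dominated K z y -> dominated L z y.
Proof.
by move=> KL zy i; rewrite (le_trans (zy i))// ler_wpM2r ?family_ge0.
Qed.

Lemma dominated_cvgs K z u y : (forall n, dominated K (z n) y) -> cvgs z u ->
  dominated K u y.
Proof.
move=> zy zu i; apply: (family_lsc H) => e e0.
have [m zm] := zu e e0; exists (z m); first by rewrite family_distC zm.
by rewrite (le_trans (zy m i))// lerDl ltW.
Qed.

(** Dominated sequences have limits of convex combinations of their tails; a Cauchy sequence
    stays close to these combinations, hence converges to the same limit. *)
Lemma dominated_cauchy_cvgs K y z : (forall n, dominated K (z n) y) ->
  (forall e, 0 < e -> exists m, forall n p, (m <= n)%N -> (m <= p)%N ->
     nu i0 (z n - z p) <= e) ->
  exists u, cvgs z u.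
Proof.
move=> zy zc; have [u uh] := family_hull_compact H zy.
exists u => e e0; have e20 : 0 < e / 2 by rewrite divr_gt0.
have [m zm] := zc _ e20; exists m => n mn.
have [v vh vu] := uh _ m e20.
rewrite (le_trans (family_dist_trans _ v _ _))// [leRHS]splitr lerD// family_distC.
apply: (vh (fun w => nu i0 (w - z n) <= e / 2)); first exact: midpoint_convex_ball.
by move=> p mp; exact: zm.
Qed.

Definition limit (z : nat -> W) : W := xget 0 (cvgs z).

Lemma limitP z : (exists u, cvgs z u) -> cvgs z (limit z).
Proof. by move=> [u zu]; exact: (xgetI 0 zu). Qed.

Lemma limit_eq z u : cvgs z u -> limit z = u.
Proof. by move=> zu; apply: (cvgs_unique _ zu); apply: limitP; exists u. Qed.

Lemma cvgs_linear z u z' u' a : cvgs z u -> cvgs z' u' ->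
  cvgs (fun n => a *: z n + z' n) (a *: u + u').
Proof.
move=> zu zu' e e0; have c0 : 0 < normc a + 1 by rewrite ltr_wpDl ?normc_ge0.
have e1 : 0 < e / (normc a + 1) by rewrite divr_gt0.
have [m zm] := zu _ e1; have [n zn] := zu' _ e1.
exists (maxn m n) => p; rewrite geq_max => /andP[mp np].
have -> : a *: z p + z' p - (a *: u + u') = a *: (z p - u) + (z' p - u').
  by rewrite scalerBr opprD addrACA.
rewrite (le_trans (family_sublinear H _ _ _ _))//.
rewrite (@le_trans _ _ (normc a * (e / (normc a + 1)) + e / (normc a + 1)))//.
  by rewrite lerD ?ler_wpM2l ?normc_ge0 ?zm ?zn.
by rewrite -[X in _ + X]mul1r -mulrDl mulrC divfK// gt_eqF.
Qed.

Lemma linear_sub A (K : R) u v : dominated_linear K A -> A (u - v) = A u - A v.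
Proof.
move=> [lA _]; have := lA (-1) v u; rewrite !scaleN1r addrC => ->.
by rewrite addrC.
Qed.

Lemma linear_zero A (K : R) : dominated_linear K A -> A 0 = 0.
Proof. by move=> lA; have := linear_sub 0 0 lA; rewrite !subrr. Qed.

Lemma linear_scale A (K : R) a u : dominated_linear K A -> A (a *: u) = a *: A u.
Proof. by move=> lA; have := lA.1 a u 0; rewrite (linear_zero lA) !addr0. Qed.

Lemma linear_add A (K : R) u v : dominated_linear K A -> A (u + v) = A u + A v.
Proof. by move=> lA; have := lA.1 1 u v; rewrite !scale1r. Qed.

Lemma cvgs_op K A z u : 0 <= K -> dominated_linear K A -> cvgs z u ->
  cvgs (fun n => A (z n)) (A u).
Proof.
move=> K0 lA zu e e0; have c0 : 0 < K + 1 by rewrite ltr_wpDl.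
have e1 : 0 < e / (K + 1) by rewrite divr_gt0.
have [m zm] := zu _ e1; exists m => n mn.
rewrite -(linear_sub _ _ lA) (le_trans (lA.2 _ _))//.
rewrite (@le_trans _ _ (K * (e / (K + 1))))//.
  by rewrite ler_wpM2l// zm.
by rewrite mulrA ler_pdivrMr// mulrC ler_pM2l// lerDl.
Qed.

Lemma dominated_linear_limit K (A : nat -> W -> W) :
  (forall n, dominated_linear K (A n)) ->
  (forall y, exists u, cvgs (A ^~ y) u) ->
  dominated_linear K (fun y => limit (A ^~ y)).
Proof.
move=> lA cA; split=> [a u v|y].
  apply: limit_eq; have := cvgs_linear a (limitP (cA u)) (limitP (cA v)).
  by under [X in cvgs X]eq_fun do rewrite -(lA _).1.
by apply: (@dominated_cvgs _ (A ^~ y)); [move=> n; exact: (lA n).2|exact: limitP].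
Qed.

(** Lorch's argument: hull limits [u] of [Q n y] are fixed by every [Q m], while
    [y - u] is a norm limit of vectors that [Q m] kills for large [m]; hence
    [Q m y] converges to [u]. *)
Lemma decreasing_projections_cvgs K (Q : nat -> W -> W) : 0 <= K ->
  (forall n, dominated_linear K (Q n)) ->
  (forall m n y, (m < n)%N -> Q n (Q m y) = Q n y /\ Q m (Q n y) = Q n y) ->
  forall y, exists u, cvgs (Q ^~ y) u.
Proof.
move=> K0 lQ QQ y.
have [u uh] := family_hull_compact H (fun n => (lQ n).2 y).
have half m (v w : W) : Q m (2^-1 *: (v + w)) = 2^-1 *: (Q m v + Q m w).
  by rewrite (linear_scale _ _ (lQ m)) (linear_add _ _ (lQ m)).
have Qu m : Q m u = u.
  apply: (@family_eq_small _ _ (K + 1)) => e e0 _.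
  have [v vh vu] := uh e m.+1 e0.
  have Qv : Q m v = v.
    apply: (vh (fun w => Q m w = w)) => [v1 v2 h1 h2|n mn]; first by rewrite half h1 h2.
    by have [] := QQ m n y mn.
  rewrite (le_trans (family_dist_trans _ v _ _))// mulrDl mul1r lerD//.
  rewrite -{1}Qv -(linear_sub _ _ (lQ m)) (le_trans ((lQ m).2 _ _))//.
  by rewrite ler_wpM2l// family_distC.
exists u => e e0; have c0 : 0 < K + 1 by rewrite ltr_wpDl.
have e1 : 0 < e / (K + 1) by rewrite divr_gt0.
have [v vh vu] := uh _ 0 e1.
have [M QM] : exists M, forall m, (M <= m)%N -> Q m v = Q m y.
  apply: (vh (fun w => exists M, forall m, (M <= m)%N -> Q m w = Q m y)).
    move=> v1 v2 [M1 h1] [M2 h2].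
    exists (maxn M1 M2) => m; rewrite geq_max => /andP[M1m M2m].
    rewrite half h1// h2//.
    by rewrite -mulr2n -(scaler_nat 2 (Q m y)) scalerA mulVf ?pnatr_eq0// scale1r.
  by move=> n _; exists n.+1 => m nm; have [] := QQ n m y nm.
exists M => m Mm; rewrite -(Qu m) -QM// -(linear_sub _ _ (lQ m)).
rewrite (le_trans ((lQ m).2 _ _))// (@le_trans _ _ (K * (e / (K + 1))))//.
  by rewrite ler_wpM2l.
by rewrite mulrA ler_pdivrMr// mulrC ler_pM2l// lerDl.
Qed.

End Families.

(** * The spectral family of a system of ramps *)

Lemma exists_half_pow_le {R : realType} (d : R) : 0 < d ->
  exists m, forall n, (m <= n)%N -> 2^-1 ^+ n <= d.
Proof.
move=> d0; have h : (fun n => (2^-1 : R) ^+ n) @ \oo --> 0.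
  by apply: cvg_expr; rewrite ger0_norm ?invr_ge0// invf_lt1// ltr1n.
move/cvgrPdist_le : h => /(_ _ d0)[m _ hm]; exists m => n mn.
by have := hm n mn; rewrite sub0r normrN ger0_norm// exprn_ge0// invr_ge0.
Qed.

Section SpectralFamily.
Context {R : realType} {W : lmodType R[i]} {I : Type}.
Variables (nu : I -> W -> R) (i0 : I) (sigma : set R).
Hypothesis H : compact_family nu i0.

(** The properties shared by the operators [rho a b] that a functional calculus on [sigma]
    assigns to the functions that equal [1] up to [a], [0] from [b] on, and are affine in
    between. Such a function acts as an identity on any other that vanishes where it is
    not [1] ([ramp_absorb]), and only its values on [sigma] matter ([ramp_eq_on]). *)
Record ramp_system (K : R) (rho : R -> R -> W -> W) : Prop := RampSystem {
  ramp_bound_ge0 : 0 <= K;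
  ramp_linear : forall a b, a < b -> dominated_linear nu K (rho a b);
  ramp_absorb : forall a b c d y, a < b -> b <= c -> c < d ->
    rho a b (rho c d y) = rho a b y /\ rho c d (rho a b y) = rho a b y;
  ramp_split : forall a m b y, a < m -> m < b ->
    (b - a)%:C *: rho a b y = (m - a)%:C *: rho a m y + (b - m)%:C *: rho m b y;
  ramp_eq_on : forall a b a' b' y, a < b -> a' < b' ->
    (forall t, sigma t -> (t <= a /\ t <= a') \/ (b <= t /\ b' <= t)) ->
    rho a b y = rho a' b' y;
  ramp_id : forall a b y, a < b -> (forall t, sigma t -> t <= a) -> rho a b y = y }.

Variables (K : R) (rho : R -> R -> W -> W).
Hypothesis HR : ramp_system K rho.

Local Notation h n := (2^-1 ^+ n : R).

Let h_gt0 n : 0 < h n. Proof. by rewrite exprn_gt0// invr_gt0. Qed.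

Let h_lt n : h n.+1 < h n.
Proof. by rewrite exprS -{2}(mul1r (h n)) ltr_pM2r// invf_lt1// ltr1n. Qed.

Let h_le m n : (m <= n)%N -> h n <= h m.
Proof. by move=> mn; rewrite ler_wiXn2l// ?invr_ge0// invf_le1// ler1n. Qed.

Let K0 : 0 <= K := ramp_bound_ge0 HR.

(** The descents over the disjoint intervals [[l + h n.+1, l + h n]] absorb one another, so
    these operators behave like a decreasing sequence of projections; they decrease to the
    indicator function of [(-oo, l]]. *)
Definition spectral_ramp (l : R) (n : nat) := rho (l + h n.+1) (l + h n).

Definition spectral (l : R) (y : W) : W := limit nu i0 (fun n => spectral_ramp l n y).

Let ramp_lt l n : l + h n.+1 < l + h n. Proof. by rewrite ltrD2l. Qed.

Lemma spectral_ramp_linear l n : dominated_linear nu K (spectral_ramp l n).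
Proof. exact: (ramp_linear HR). Qed.

Lemma spectral_ramp_cvgs l y : exists u, cvgs nu i0 (fun n => spectral_ramp l n y) u.
Proof.
apply: (decreasing_projections_cvgs H K0 (spectral_ramp_linear l)) => m n z mn.
by apply: (ramp_absorb HR) => //; rewrite lerD2l h_le.
Qed.

Lemma spectral_cvgs l y : cvgs nu i0 (fun n => spectral_ramp l n y) (spectral l y).
Proof. exact/limitP/spectral_ramp_cvgs. Qed.

Lemma spectral_linear l : dominated_linear nu K (spectral l).
Proof.
exact: (dominated_linear_limit H (spectral_ramp_linear l) (spectral_ramp_cvgs l)).
Qed.

Lemma cvgs_eventually z u : (exists m, forall n, (m <= n)%N -> z n = u) ->
  cvgs nu i0 z u.
Proof.
move=> [m zm] e e0; exists m => n mn.
by rewrite zm// subrr (family0 H) ltW.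
Qed.

Lemma ramp_spectral_above l a b y : l < a -> a < b ->
  rho a b (spectral l y) = spectral l y /\ spectral l (rho a b y) = spectral l y.
Proof.
move=> la ab; have [m hm] := @exists_half_pow_le R (a - l) ltac:(by rewrite subr_gt0).
have abs n z : (m <= n)%N -> spectral_ramp l n (rho a b z) = spectral_ramp l n z /\
    rho a b (spectral_ramp l n z) = spectral_ramp l n z.
  by move=> /hm mn; apply: (ramp_absorb HR) => //; lra.
split.
  have := cvgs_op K0 (ramp_linear HR ab) (spectral_cvgs l y).
  move=> /(cvgs_unique H); apply; move=> e e0.
  have [p hp] := spectral_cvgs l y e0; exists (maxn m p) => n.
  by rewrite geq_max => /andP[mn pn]; rewrite (abs n y mn).2 hp.
apply: (limit_eq H) => e e0.
have [p hp] := spectral_cvgs l y e0; exists (maxn m p) => n.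
by rewrite geq_max => /andP[mn pn]; rewrite (abs n y mn).1 hp.
Qed.

Lemma ramp_spectral_below l a b y : a < b -> b <= l ->
  rho a b (spectral l y) = rho a b y /\ spectral l (rho a b y) = rho a b y.
Proof.
move=> ab bl; have abs n z : rho a b (spectral_ramp l n z) = rho a b z /\
    spectral_ramp l n (rho a b z) = rho a b z.
  by apply: (ramp_absorb HR) => //; rewrite (le_trans bl)// lerDl ltW.
split.
  have := cvgs_op K0 (ramp_linear HR ab) (spectral_cvgs l y).
  move=> /(cvgs_unique H); apply; apply: cvgs_eventually.
  by exists 0 => n _; rewrite (abs n y).1.
by apply/(limit_eq H)/cvgs_eventually; exists 0 => n _; rewrite (abs n y).2.
Qed.

Lemma spectral_mul l m y : l <= m ->
  spectral m (spectral l y) = spectral l y /\ spectral l (spectral m y) = spectral l y.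
Proof.
move=> lm.
have lmh n : l < m + h n.+1 by rewrite (le_lt_trans lm)// ltrDl.
split.
  apply/(limit_eq H)/cvgs_eventually; exists 0 => n _.
  by have [] := ramp_spectral_above y (lmh n) (ramp_lt m n).
have := cvgs_op K0 (spectral_linear l) (spectral_cvgs m y).
move=> /(cvgs_unique H); apply; apply: cvgs_eventually.
by exists 0 => n _; have [] := ramp_spectral_above y (lmh n) (ramp_lt m n).
Qed.

(** For [m] close enough to [l], applying [spectral m] to the [n]-th approximation of
    [spectral l y] gives [spectral m y], and applying it to [spectral l y] changes nothing. *)
Lemma spectral_right_cvg l y e : 0 < e ->
  exists2 d, 0 < d & forall m, l <= m -> m < l + d ->
    nu i0 (spectral m y - spectral l y) <= e.
Proof.
move=> e0; have c0 : 0 < K + 1 by rewrite ltr_wpDl.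
have [n hn] := spectral_cvgs l y (divr_gt0 e0 c0).
exists (h n.+1) => // m lm mh.
have <- : spectral m (spectral_ramp l n y) = spectral m y.
  by have [] := ramp_spectral_above y mh (ramp_lt l n).
have <- : spectral m (spectral l y) = spectral l y by have [] := spectral_mul y lm.
rewrite -(linear_sub _ _ (spectral_linear m)) (le_trans ((spectral_linear m).2 _ _))//.
rewrite (@le_trans _ _ (K * (e / (K + 1))))//; first by rewrite ler_wpM2l// hn.
by rewrite mulrA ler_pdivrMr// mulrC ler_pM2l// lerDl.
Qed.

(** To the left of [l] the complements of the ramps decrease, so the same
    convergence argument applies to them. *)
Lemma left_ramps_cauchy l y e : 0 < e ->
  exists m, forall n p, (m <= n)%N -> (m <= p)%N ->
    nu i0 (rho (l - h n) (l - h n.+1) y - rho (l - h p) (l - h p.+1) y) <= e.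
Proof.
move=> e0; pose Q n y := y - rho (l - h n) (l - h n.+1) y.
have lt n : l - h n < l - h n.+1 by rewrite ltrD2l ltrN2.
have lQ n : dominated_linear nu (1 + K) (Q n).
  have [lr dr] := ramp_linear HR (lt n); split=> [a u v|z].
    by rewrite /Q lr scalerBr opprD addrACA.
  move=> i; rewrite (le_trans (familyB H _ _ _))// mulrDl mul1r lerD2l.
  exact: dr.
have QQ m n z : (m < n)%N -> Q n (Q m z) = Q n z /\ Q m (Q n z) = Q n z.
  move=> mn; have nm : l - h m.+1 <= l - h n by rewrite lerD2l lerN2 h_le.
  have [r1 r2] := ramp_absorb HR z (lt m) nm (lt n).
  rewrite /Q !(linear_sub _ _ (ramp_linear HR (lt _))) r1 r2 subrr subr0; split=> //.
  by rewrite opprB addrA subrK.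
have K10 : 0 <= 1 + K by rewrite addr_ge0.
have [u Qu] := decreasing_projections_cvgs H K10 lQ QQ y.
have e20 : 0 < e / 2 by rewrite divr_gt0.
have [m hm] := Qu _ e20.
exists m => n p mn mp.
have -> : rho (l - h n) (l - h n.+1) y - rho (l - h p) (l - h p.+1) y = Q p y - Q n y.
  by rewrite /Q opprB [RHS]addrC addrA subrK.
rewrite (le_trans (family_dist_trans H _ u _ _))// [leRHS]splitr lerD ?hm//.
by rewrite (family_distC H) hm.
Qed.

(** Any [m] slightly to the left of [l] lies between the descents of two of the ramps of
    [left_ramps_cauchy]: [spectral m] fixes the earlier ramp and sends the later one to
    [spectral m y]. *)
Lemma spectral_left_cauchy l y e : 0 < e ->
  exists2 d, 0 < d & forall m m', l - d < m -> m < l -> l - d < m' -> m' < l ->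
    nu i0 (spectral m y - spectral m' y) <= e.
Proof.
move=> e0; have c0 : 0 < 2 * (K + 1) by rewrite mulr_gt0// ltr_wpDl.
have [n hn] := left_ramps_cauchy l y (divr_gt0 e0 c0).
have near m : l - h n.+1 < m -> m < l ->
    nu i0 (spectral m y - rho (l - h n) (l - h n.+1) y) <= e / 2.
  move=> nm ml; have [p hp] := @exists_half_pow_le R ((l - m) / 2) ltac:(lra).
  pose q := maxn p n; have hq : h q <= (l - m) / 2 by apply: hp; exact: leq_maxl.
  have lt k : l - h k < l - h k.+1 by rewrite ltrD2l ltrN2.
  have mq : m < l - h q by lra.
  have [_ <-] := ramp_spectral_above y mq (lt q).
  have [_ <-] := ramp_spectral_below y (lt n) (ltW nm).
  rewrite -(linear_sub _ _ (spectral_linear m)) (le_trans ((spectral_linear m).2 _ _))//.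
  rewrite (@le_trans _ _ (K * (e / (2 * (K + 1)))))//.
    by rewrite ler_wpM2l// hn// leq_maxr.
  have t0 : 0 < e / (2 * (K + 1)) by rewrite divr_gt0.
  have := divfK (lt0r_neq0 c0) e; move: t0; set t := e / (2 * (K + 1)) => t0; nra.
exists (h n.+1) => // m m' nm ml nm' ml'.
rewrite (le_trans (family_dist_trans H _ (rho (l - h n) (l - h n.+1) y) _ _))//.
by rewrite [leRHS]splitr lerD ?near// (family_distC H) near.
Qed.

Lemma spectral_gap a b l y : a < b -> (forall t, sigma t -> t <= a \/ b <= t) ->
  a <= l -> l < b -> spectral l y = spectral a y.
Proof.
move=> ab gap al lb; apply: (limit_eq H) => e e0.
have [m hm] := spectral_cvgs a y e0.
have [p hp] := @exists_half_pow_le R (b - l) ltac:(lra).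
exists (maxn m p) => n; rewrite geq_max => /andP[mn /hp pn].
suff -> : spectral_ramp l n y = spectral_ramp a n y by exact: hm.
have h1 := h_gt0 n; have h2 := h_gt0 n.+1.
apply: (ramp_eq_on HR) => // t /gap[ta|bt]; [left|right]; split; lra.
Qed.

Lemma spectral_top l y : (forall t, sigma t -> t <= l) -> spectral l y = y.
Proof.
move=> le_l; apply/(limit_eq H)/cvgs_eventually; exists 0 => n _.
apply: (ramp_id HR) => // t /le_l; have := h_gt0 n.+1; lra.
Qed.

(** On a ramp that descends over [[a, b]], only the oscillation of the spectral
    family on [[a, b[[ counts: away from the two ends the ramp sees [y] only through
    [spectral c y - spectral a y] with [c < b], and the ends have small weight. *)
Lemma ramp_near_spectral a b e y : a < b -> 0 <= e ->
  (forall l, a <= l -> l < b -> nu i0 (spectral l y - spectral a y) <= e) ->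
  nu i0 ((b - a)%:C *: (rho a b y - spectral a y)) <= (b - a) * (K * e).
Proof.
move=> ab e0 osc; rewrite -subr_le0.
apply: (@le0_of_le_mul_eps _ _ ((b - a) * (4 * K * nu i0 y))) => d d0 d1.
pose c1 := a + (b - a) * (d / 3); pose c2 := b - (b - a) * (d / 3).
have ba : 0 < b - a by lra.
have w0 : 0 < (b - a) * (d / 3) by rewrite mulr_gt0// divr_gt0.
have w1 : (b - a) * (d / 3) <= (b - a) * (1 / 3) by rewrite ler_pM2l//; lra.
have ac1 : a < c1 by rewrite /c1; lra.
have c12 : c1 < c2 by rewrite /c1 /c2; lra.
have c2b : c2 < b by rewrite /c2; lra.
have E0 := family_ge0 H i0 y.
have end_le p q : p < q -> nu i0 (rho p q y - spectral a y) <= 2 * K * nu i0 y.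
  move=> pq; rewrite (le_trans (familyB H _ _ _))//.
  have := (ramp_linear HR pq).2 y i0; have := (spectral_linear a).2 y i0; lra.
have mid_le : nu i0 (rho c1 c2 y - spectral a y) <= K * e.
  have [<- _] := ramp_spectral_below y c12 (lexx c2).
  have [<- _] := ramp_spectral_above y ac1 c12.
  rewrite -(linear_sub _ _ (ramp_linear HR c12)).
  rewrite (le_trans ((ramp_linear HR c12).2 _ _))// ler_wpM2l// osc//.
  by rewrite ltW// (lt_trans ac1).
have -> : (b - a)%:C *: (rho a b y - spectral a y) =
    (c1 - a)%:C *: (rho a c1 y - spectral a y) +
    ((c2 - c1)%:C *: (rho c1 c2 y - spectral a y) +
     (b - c2)%:C *: (rho c2 b y - spectral a y)).
  rewrite scalerBr (ramp_split HR y ac1 (lt_trans c12 c2b)) (ramp_split HR y c12 c2b).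
  have -> : b - a = (c1 - a) + ((c2 - c1) + (b - c2)) by ring.
  move: (c1 - a) (c2 - c1) (b - c2) => p q s.
  rewrite (realCD p) (realCD q) !scalerDl !scalerBr.
  by rewrite opprD addrACA opprD (addrACA (_ *: rho c1 c2 y)).
have lin p q r : p < q -> nu i0 ((q - p)%:C *: r) <= (q - p) * nu i0 r.
  by move=> pq; apply: (familyZ_real H); lra.
have := lin _ _ (rho a c1 y - spectral a y) ac1.
have := lin _ _ (rho c1 c2 y - spectral a y) c12.
have := lin _ _ (rho c2 b y - spectral a y) c2b.
have := familyD H i0 ((c1 - a)%:C *: (rho a c1 y - spectral a y))
  ((c2 - c1)%:C *: (rho c1 c2 y - spectral a y) +
   (b - c2)%:C *: (rho c2 b y - spectral a y)).
have := familyD H i0 ((c2 - c1)%:C *: (rho c1 c2 y - spectral a y))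
   ((b - c2)%:C *: (rho c2 b y - spectral a y)).
have m1 : (c1 - a) * nu i0 (rho a c1 y - spectral a y) <= (c1 - a) * (2 * K * nu i0 y).
  by rewrite ler_wpM2l ?end_le// subr_ge0 ltW.
have m2 : (b - c2) * nu i0 (rho c2 b y - spectral a y) <= (b - c2) * (2 * K * nu i0 y).
  by rewrite ler_wpM2l ?end_le// subr_ge0 ltW.
have m3 : (c2 - c1) * nu i0 (rho c1 c2 y - spectral a y) <= (c2 - c1) * (K * e).
  by rewrite ler_wpM2l// subr_ge0 ltW.
have m4 : (c2 - c1) * (K * e) <= (b - a) * (K * e).
  by rewrite ler_wpM2r ?mulr_ge0//; lra.
have m5 : (c1 - a) * (2 * K * nu i0 y) = (b - a) * (4 * K * nu i0 y) * d / 6.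
  by rewrite /c1; field.
have m6 : (b - c2) * (2 * K * nu i0 y) = (b - a) * (4 * K * nu i0 y) * d / 6.
  by rewrite /c2; field.
have m7 : 0 <= (b - a) * (4 * K * nu i0 y) * d.
  by rewrite !mulr_ge0// ltW.
lra.
Qed.
End SpectralFamily.

(** * Polynomial approximation in the variation norm *)

Section VariationNorm.
Context {R : realType} {sigma : set R}.
Implicit Types (f g : BV sigma) (s : seq sigma).

Definition bvnorm f : R := supnorm f + total_variation_on f.

Lemma bvnormE f : `|f| = (bvnorm f)%:C.
Proof. by []. Qed.

Lemma bvnorm_ge0 f : 0 <= bvnorm f.
Proof. by rewrite addr_ge0 ?supnorm_ge0 ?Defs.total_variation_ge0. Qed.

Lemma bvnormD f g : bvnorm (f + g) <= bvnorm f + bvnorm g.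
Proof. by have := BV_ler_normD f g; rewrite -realCD lecR. Qed.

Lemma bvnormZ a f : bvnorm (a *: f) = normc a * bvnorm f.
Proof.
by have [] : BV_norm (a *: f) = (normc a * bvnorm f)%:C by rewrite BV_normrZ normr_normc -realCM.
Qed.

Lemma bvnormN f : bvnorm (- f) = bvnorm f.
Proof. by rewrite -scaleN1r bvnormZ normcN normc1 mul1r. Qed.

Lemma bvnorm_distC f g : bvnorm (f - g) = bvnorm (g - f).
Proof. by rewrite -bvnormN opprB. Qed.

Lemma bvnorm_le f c v : 0 <= c -> 0 <= v -> (forall t, normc (f t) <= c) ->
  (forall s, increasing_on s -> variation_on f s <= v) -> bvnorm f <= c + v.
Proof.
move=> c0 v0 fc fv; rewrite lerD//; apply: sup_le0 => //.
  by move=> _ [t _ <-].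
by move=> _ [s si <-]; exact: fv.
Qed.

Lemma bvnormM f g : bvnorm (f * g) <= bvnorm f * bvnorm g.
Proof.
have f0 := supnorm_ge0 f; have g0 := supnorm_ge0 g.
have tf := Defs.total_variation_ge0 f; have tg := Defs.total_variation_ge0 g.
apply: (@le_trans _ _ (supnorm f * supnorm g +
  (supnorm g * total_variation_on f + supnorm f * total_variation_on g))); last first.
  by rewrite /bvnorm; nra.
apply: bvnorm_le => [||t|s si].
- exact: mulr_ge0.
- by rewrite addr_ge0 ?mulr_ge0.
- rewrite [normc _](_ : _ = normc (f t) * normc (g t)); last exact: normcM.
  by rewrite ler_pM ?normc_ge0 ?le_supnorm.
rewrite (le_trans (_ : _ <= supnorm g * variation_on f s + supnorm f * variation_on g s))//.
  apply: le_variation_on => x y.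
  have -> : (f * g) y - (f * g) x = g y * (f y - f x) + f x * (g y - g x).
    rewrite -[LHS]/(f y * g y - f x * g x).
    by rewrite !mulrBr [g y * f y]mulrC [g y * f x]mulrC addrA subrK.
  rewrite (le_trans (normcD _ _))// !normcM lerD//.
    by rewrite ler_wpM2r ?normc_ge0// le_supnorm.
  by rewrite ler_wpM2r ?normc_ge0// le_supnorm.
by rewrite lerD// ler_wpM2l// le_total_variation.
Qed.

(** The increments of a monotone function telescope. *)
Lemma variation_antitone (g : R -> R) v s : (forall x y, x <= y -> g y <= g x) ->
  (forall x, 0 <= g x <= v) -> increasing_on s ->
  variation_on (fun t : sigma => (g (\val t))%:C) s <= v.
Proof.
move=> gd g0v; have v0 : 0 <= v by have /andP[] := g0v 0; exact: le_trans.
case: s => [_|x s]; first by rewrite /variation_on big_nil.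
suff : forall x, increasing_on (x :: s) ->
    variation_on (fun t : sigma => (g (\val t))%:C) (x :: s) <= g (\val x).
  by move=> /[apply] /le_trans; apply; have /andP[] := g0v (\val x).
elim: s {x} => [|y s IH] x.
  by rewrite /variation_on big_nil => _; have /andP[] := g0v (\val x).
move=> /andP[xy ys]; rewrite variation_on_cons normc_realB.
rewrite ler0_norm ?subr_le0 ?(gd _ _ (ltW xy))// opprB.
by have := IH y ys; lra.
Qed.

Lemma eq_variation_on (f g : sigma -> R[i]) s :
  (forall x y, normc (f y - f x) = normc (g y - g x)) ->
  variation_on f s = variation_on g s.
Proof. by move=> fg; apply: eq_bigr => p _; exact: fg. Qed.

Lemma variation_monotone (g : R -> R) v s : (forall x y, x <= y -> g x <= g y) ->
  (forall x, 0 <= g x <= v) -> increasing_on s ->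
  variation_on (fun t : sigma => (g (\val t))%:C) s <= v.
Proof.
move=> gi g0v si; rewrite (@eq_variation_on _ (fun t : sigma => (v - g (\val t))%:C)).
  apply: (@variation_antitone (fun t => v - g t)) si => [x y /gi|x].
    by rewrite lerD2l lerN2.
  by have /andP[] := g0v x; lra.
move=> x y; rewrite !normc_realB -normrN; congr `|_|; ring.
Qed.

End VariationNorm.

Section PolynomialApproximation.
Context {R : realType} {sigma : set R} (csigma : compact sigma).
Implicit Types (f g : BV sigma) (p q : {poly R[i]}).

Local Notation poly p := (polyBV csigma p).

Lemma polyBV_linear a p q : poly (a *: p + q) = a *: poly p + poly q.
Proof.
apply: val_inj; apply/funext => t.
rewrite -[RHS]/(a * p.[(\val t)%:C] + q.[(\val t)%:C]).
by rewrite -[LHS]/((a *: p + q).[(\val t)%:C]) !hornerE.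
Qed.

Lemma polyBV_mul p q : poly (p * q) = poly p * poly q.
Proof.
apply: val_inj; apply/funext => t.
rewrite -[RHS]/(p.[(\val t)%:C] * q.[(\val t)%:C]).
by rewrite -[LHS]/((p * q).[(\val t)%:C]) hornerM.
Qed.

Lemma polyBV1 : poly 1 = 1.
Proof. by apply: val_inj; apply/funext => t; rewrite -[LHS]/((1 : {poly _}).[_]) hornerC. Qed.

Definition approximable f := forall e, 0 < e -> exists p, bvnorm (f - poly p) <= e.

Lemma ACfun_approximable f : ACfun csigma f -> approximable f.
Proof.
move=> fAC e e0.
have [_ [[p _ <-]]] := fAC _ (nbhsx_ballx f e%:C ltac:(by rewrite ltcR)).
rewrite -ball_normE /ball_/= bvnormE ltcR => /ltW fp.
by exists p.
Qed.

Lemma approximable_poly p : approximable (poly p).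
Proof.
move=> e e0; exists p; rewrite subrr.
by rewrite -(scale0r 0) bvnormZ normc0 mul0r ltW.
Qed.

Lemma approximable_linear a f g : approximable f -> approximable g ->
  approximable (a *: f + g).
Proof.
move=> fa ga e e0; have c0 : 0 < normc a + 1 by rewrite ltr_wpDl ?normc_ge0.
have [p fp] := fa _ (divr_gt0 e0 c0); have [q gq] := ga _ (divr_gt0 e0 c0).
exists (a *: p + q); rewrite polyBV_linear.
have -> : a *: f + g - (a *: poly p + poly q) = a *: (f - poly p) + (g - poly q).
  by rewrite scalerBr opprD addrACA.
rewrite (le_trans (bvnormD _ _))// bvnormZ.
rewrite (@le_trans _ _ (normc a * (e / (normc a + 1)) + e / (normc a + 1)))//.
  by rewrite lerD ?ler_wpM2l ?normc_ge0.
by rewrite -[X in _ + X]mul1r -mulrDl mulrC divfK// gt_eqF.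
Qed.

Lemma approximable_mul f g : approximable f -> approximable g -> approximable (f * g).
Proof.
move=> fa ga e e0; pose B := bvnorm f + bvnorm g + 1.
have f0 := bvnorm_ge0 f; have g0 := bvnorm_ge0 g.
have B0 : 1 <= B by rewrite /B; lra.
pose d := Num.min 1 (e / B).
have B1 : 0 < B := lt_le_trans ltr01 B0.
have d0 : 0 < d by rewrite lt_min ltr01/= divr_gt0.
have [p fp] := fa _ d0; have [q gq] := ga _ d0; exists (p * q).
have d1 : d <= 1 by rewrite ge_min lexx.
have dB : d * B <= e by rewrite -ler_pdivlMr// ge_min lexx orbT.
rewrite polyBV_mul.
have -> : f * g - poly p * poly q =
    (f - poly p) * g + (f - (f - poly p)) * (g - poly q).
  by rewrite opprB addrCA subrr addr0 mulrBl mulrBr addrA subrK.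
rewrite (le_trans (bvnormD _ _))//.
have := bvnormM (f - poly p) g; have := bvnormM (f - (f - poly p)) (g - poly q).
have := bvnormD f (- (f - poly p)); rewrite bvnormN.
have := bvnorm_ge0 (f - (f - poly p)); have := bvnorm_ge0 (g - poly q).
have := bvnorm_ge0 (f - poly p).
move: dB; rewrite /B.
move: fp gq; move: (bvnorm (f - (f - _))) (bvnorm (f - _)) (bvnorm (g - _)) => x y z.
by move=> yd zd; nra.
Qed.

End PolynomialApproximation.

(** * Ramps are absolutely continuous *)

(** [sqrt_approx n (1 - w ^+ 2)] increases to [1 - w] for [0 <= w <= 1]: the
    iteration is [q |-> (x + q ^+ 2) / 2], whose fixed point is [1 - sqrt (1 - x)]. It converges
    in variation, and not only uniformly, because each error is a monotone function
    of [w]. *)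
Fixpoint sqrt_approx {R : realType} (n : nat) (x : R) : R :=
  if n is m.+1 then (x + sqrt_approx m x ^+ 2) / 2 else 0.

Definition sqrt_error {R : realType} (n : nat) (w : R) : R :=
  1 - w - sqrt_approx n (1 - w ^+ 2).

Section SqrtApprox.
Context {R : realType}.
Implicit Types w v : R.

Lemma sqrt_errorS n w : sqrt_error n.+1 w =
  sqrt_error n w * ((1 - w) + sqrt_approx n (1 - w ^+ 2)) / 2.
Proof. by rewrite /sqrt_error /=; field. Qed.

Lemma sqrt_approx_antitone n w v : 0 <= w -> w <= v -> v <= 1 ->
  0 <= sqrt_approx n (1 - v ^+ 2) <= sqrt_approx n (1 - w ^+ 2).
Proof.
move=> w0 wv v1; elim: n => [|n IH] /=; first by rewrite lexx.
move: IH; move: (sqrt_approx n (1 - v ^+ 2)) (sqrt_approx n (1 - w ^+ 2)) => x y.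
move=> /andP[x0 xy]; rewrite divr_ge0 ?ler_pM2r ?invr_gt0//=; nra.
Qed.

Lemma sqrt_error_antitone n w v : 0 <= w -> w <= v -> v <= 1 ->
  0 <= sqrt_error n v <= sqrt_error n w.
Proof.
move=> w0 wv v1; elim: n => [|n]; first by rewrite /sqrt_error /= !subr0; lra.
have := sqrt_approx_antitone n w0 wv v1.
rewrite !sqrt_errorS; move: (sqrt_error n v) (sqrt_error n w) => e f.
move: (sqrt_approx n _) (sqrt_approx n _) => x y /andP[x0 xy] /andP[e0 ef].
rewrite divr_ge0 ?mulr_ge0 ?ler_pM2r ?invr_gt0//=; last lra.
by rewrite ler_pM//; lra.
Qed.

(** The errors at [0] satisfy [x_(n+1) = x_n - x_n ^+ 2 / 2], so they decay like [2 / n]. *)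
Lemma sqrt_error0_le n : sqrt_error n (0 : R) <= 2 / n.+2%:R.
Proof.
elim: n => [|n]; first by rewrite /sqrt_error /= !subr0 divff.
have /andP[] := sqrt_error_antitone n (lexx 0) (lexx 0) (@ler01 R).
rewrite sqrt_errorS.
have -> : sqrt_approx n (1 - (0 : R) ^+ 2) = 1 - sqrt_error n (0 : R).
  by rewrite /sqrt_error; ring.
move: (sqrt_error n 0) => x x0 _ xn.
have n0 : (0 : R) <= n%:R by rewrite ler0n.
have -> : n.+3%:R = n%:R + 3 :> R by rewrite -natrD addn3.
move: xn; have -> : n.+2%:R = n%:R + 2 :> R by rewrite -natrD addn2.
rewrite !ler_pdivlMr; [|lra|lra].
by move: n%:R n0 => N N0 xN; nra.
Qed.

Lemma sqrt_error0_small (e : R) : 0 < e -> exists n, sqrt_error n (0 : R) <= e.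
Proof.
move=> e0; have [n hn] : exists n, 2 / e <= n%:R :> R.
  by exists (Num.bound (2 / e)); rewrite ltW// archi_boundP// divr_ge0// ltW.
exists n; rewrite (le_trans (sqrt_error0_le n))// ler_pdivrMr ?ltr0n//.
rewrite -ler_pdivrMl// mulrC (le_trans hn)// ler_nat.
by rewrite -addn2 leq_addr.
Qed.

End SqrtApprox.

Section Ramps.
Context {R : realType} {sigma : set R} (csigma : compact sigma).

Lemma sigma_bounded c : exists2 M : R, 0 < M & forall t : sigma, `|\val t - c| <= M.
Proof.
have [M [_ sM]] := compact_bounded csigma.
exists (`|M| + 1 + `|c|) => [|t]; first by rewrite ltr_wpDr// ltr_wpDl.
rewrite (le_trans (ler_normB _ _))// lerD2r.
have := sM (`|M| + 1); rewrite ltr_pwDr//; last exact: ler_norm.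
by move=> /(_ isT) /(_ (\val t) (set_valP t)).
Qed.

Fact abs_BV c : (fun t : sigma => `|\val t - c|%:C : R[i]) \in @BV_pred _ sigma.
Proof.
apply: (@BV_le _ _ _ _ _ 1 0 _ _ _ (BV_id csigma) (BV_id csigma)) => // x y.
rewrite mul0r addr0 mul1r !normc_realB.
have -> : \val y - \val x = (\val y - c) - (\val x - c) by ring.
exact: ler_dist_dist.
Qed.

Definition absBV c : BV sigma := Build_BV (abs_BV c).

(** Up to scaling, [|t - c|] is [1 - sqrt_approx n (1 - (t - c) ^+ 2)] plus the error, and the
    error is the sum of a monotone and an antitone function of [t], up to a constant; so its
    variation is at most twice its value at distance [0]. *)
Lemma approximable_abs c : approximable csigma (absBV c).
Proof.
have [M M0 sM] := sigma_bounded c => e e0.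
have [n hn] := @sqrt_error0_small R (e / (3 * M)) ltac:(by rewrite divr_gt0// mulr_gt0).
pose w := (M^-1)%:C *: ('X - (c%:C)%:P) : {poly R[i]}.
pose q := fix q n : {poly R[i]} :=
  if n is m.+1 then ((2^-1 : R)%:C) *: (1 - w ^+ 2 + q m ^+ 2) else 0.
have qE t m : (q m).[t%:C] = (sqrt_approx m (1 - ((t - c) / M) ^+ 2))%:C.
  elim: m => [|m IH]; first by rewrite horner0.
  rewrite /= !hornerE IH -!rmorphB -!rmorphM -!rmorphXn/=.
  rewrite -(rmorph1 (real_complex R)) -rmorphB -rmorphD -rmorphM; congr (_%:C).
  by rewrite [X in 1 - X]exprMn; field; exact: lt0r_neq0.
exists (M%:C *: (1 - q n)).
set f := absBV c - _.
have fE t : f t = (- (M * sqrt_error n (`|\val t - c| / M)))%:C.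
  rewrite -[LHS]/(`|\val t - c|%:C - (M%:C *: (1 - q n)).[(\val t)%:C]).
  rewrite !hornerE qE -(rmorph1 (real_complex R)) -rmorphB -rmorphM -rmorphB; congr (_%:C).
  rewrite /sqrt_error !exprMn real_normK ?num_real//.
  by field; exact: lt0r_neq0.
have w01 (t : sigma) : 0 <= `|\val t - c| / M <= 1.
  by rewrite divr_ge0 ?normr_ge0 ?(ltW M0)//= ler_pdivrMr// mul1r sM.
have err0 : 0 <= sqrt_error n (0 : R).
  by have /andP[] := sqrt_error_antitone n (lexx 0) (lexx 0) (@ler01 R).
pose cl (x : R) := Num.min 1 (Num.max 0 x).
have cl_mono x y : x <= y -> cl x <= cl y.
  by move=> xy; rewrite /cl le_min2// le_max2.
have cl01 x : 0 <= cl x <= 1.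
  by rewrite /cl ge_min lexx/= le_min ler01/= le_max lexx.
have err_cl x y : x <= y -> 0 <= sqrt_error n (cl y) <= sqrt_error n (cl x).
  move=> xy; apply: sqrt_error_antitone; first by have /andP[] := cl01 x.
    exact: cl_mono.
  by have /andP[] := cl01 y.
have errcl0 x : 0 <= sqrt_error n (cl x) <= sqrt_error n 0.
  by apply: sqrt_error_antitone => //; have /andP[] := cl01 x.
pose up (t : R) := sqrt_error n (cl ((c - t) / M)).
pose dn (t : R) := sqrt_error n (cl ((t - c) / M)).
have split_err (t : sigma) : sqrt_error n (`|\val t - c| / M) =
    up (\val t) + dn (\val t) - sqrt_error n 0.
  have := w01 t; rewrite /up /dn -(opprB _ c).
  have [tc|tc] := leP 0 (\val t - c).
    rewrite (ger0_norm tc) => /andP[x0 x1].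
    have -> : cl ((\val t - c) / M) = (\val t - c) / M.
      by rewrite /cl (max_idPr x0) (min_idPr x1).
    have -> : cl (- (\val t - c) / M) = 0.
      rewrite /cl (max_idPl _) ?(min_idPr ler01)//.
      by rewrite mulNr oppr_le0 x0.
    by rewrite addrAC subrr add0r.
  rewrite (ltr0_norm tc) => /andP[x0 x1].
  have -> : cl (- (\val t - c) / M) = - (\val t - c) / M.
    by rewrite /cl (max_idPr x0) (min_idPr x1).
  have -> : cl ((\val t - c) / M) = 0.
    rewrite /cl (max_idPl _) ?(min_idPr ler01)//.
    by rewrite -oppr_ge0 -mulNr x0.
  by rewrite addrK.
rewrite (@le_trans _ _ (M * sqrt_error n 0 + 2 * (M * sqrt_error n 0)))//.
  apply: bvnorm_le => [||t|s si].
  - by rewrite mulr_ge0 ?(ltW M0).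
  - by rewrite mulr_ge0 ?mulr_ge0 ?(ltW M0).
  - rewrite fE normc_real normrN normrM (ger0_norm (ltW M0)) ler_wpM2l ?(ltW M0)//.
    have /andP[x0 x1] := w01 t.
    have /andP[e1 e2] := sqrt_error_antitone n (lexx 0) x0 x1.
    by rewrite ger0_norm.
  rewrite (le_trans (_ : _ <= M * variation_on (fun t : sigma => (up (\val t))%:C) s +
     M * variation_on (fun t : sigma => (dn (\val t))%:C) s))//.
    apply: le_variation_on => x y; rewrite !fE !normc_realB !split_err.
    move: (up (\val x)) (up (\val y)) (dn (\val x)) (dn (\val y)) => ux uy dx dy.
    have -> : - (M * (uy + dy - sqrt_error n 0)) - - (M * (ux + dx - sqrt_error n 0)) =
        - (M * ((uy - ux) + (dy - dx))) by ring.
    rewrite normrN normrM (ger0_norm (ltW M0)) -mulrDr ler_wpM2l ?(ltW M0)//.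
    exact: ler_normD.
  rewrite mulr_natl mulr2n lerD// ler_wpM2l ?(ltW M0)//.
    apply: variation_monotone si => [x y xy|x]; last exact: errcl0.
    rewrite /up; have /err_cl /andP[]// : (c - y) / M <= (c - x) / M.
    by rewrite ler_pM2r ?invr_gt0// lerD2l lerN2.
  apply: variation_antitone si => [x y xy|x]; last exact: errcl0.
  rewrite /dn; have /err_cl /andP[]// : (x - c) / M <= (y - c) / M.
  by rewrite ler_pM2r ?invr_gt0// lerD2r.
rewrite ler_pdivlMr ?mulr_gt0// in hn.
by apply: le_trans hn; rewrite le_eqVlt; apply/orP; left; apply/eqP; ring.
Qed.

(** The function equal to [1] below [a], to [0] above [b] and affine between, written with
    absolute values because these are known to be approximable by polynomials. *)
Definition ramp (a b : R) : BV sigma :=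
  ((2 * (b - a))^-1)%:C *: (absBV b - absBV a) + (2^-1 : R)%:C *: (1 : BV sigma).

Definition ramp_val (a b t : R) : R := Num.min 1 (Num.max 0 ((b - t) / (b - a))).

Lemma rampE a b t : a < b -> ramp a b t = (ramp_val a b (\val t))%:C.
Proof.
move=> ab; have ba : 0 < b - a by rewrite subr_gt0.
rewrite -[LHS]/(((2 * (b - a))^-1)%:C * (`|\val t - b|%:C - `|\val t - a|%:C) + (2^-1 : R)%:C * 1).
rewrite mulr1 -rmorphB -rmorphM -rmorphD; congr (_%:C).
move: (\val t) => {}t; rewrite /ramp_val.
have ba0 : b - a != 0 by rewrite gt_eqF.
have [tb|tb] := leP t b; last first.
  rewrite (max_idPl _); last by rewrite pmulr_lle0 ?invr_gt0//; lra.
  rewrite (min_idPr ler01) !ger0_norm; try lra.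
  by field.
have q0 : 0 <= (b - t) / (b - a) by rewrite divr_ge0//; lra.
rewrite (max_idPr q0).
have [ta|ta] := leP t a.
  rewrite (min_idPl _); last by rewrite ler_pdivlMr// mul1r; lra.
  by rewrite !ler0_norm; try lra; field.
rewrite (min_idPr _); last by rewrite ler_pdivrMr// mul1r; lra.
by rewrite ler0_norm ?ger0_norm; try lra; field.
Qed.

Lemma ramp_val_eq1 a b t : a < b -> t <= a -> ramp_val a b t = 1.
Proof.
move=> ab ta; rewrite /ramp_val (min_idPl _)// le_max ler_pdivlMr ?subr_gt0// mul1r.
by apply/orP; right; lra.
Qed.

Lemma ramp_val_eq0 a b t : a < b -> b <= t -> ramp_val a b t = 0.
Proof.
move=> ab bt; rewrite /ramp_val (max_idPl _) ?(min_idPr ler01)//.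
by rewrite pmulr_lle0 ?invr_gt0 ?subr_gt0//; lra.
Qed.

Lemma ramp_val01 a b t : 0 <= ramp_val a b t <= 1.
Proof. by rewrite /ramp_val ge_min lexx/= le_min ler01/= le_max lexx. Qed.

Lemma approximable_ramp a b : approximable csigma (ramp a b).
Proof.
have a1 : approximable csigma 1 by rewrite -(polyBV1 csigma); exact: approximable_poly.
have a0 : approximable csigma 0.
  by rewrite -(addNr 1) -scaleN1r; exact: approximable_linear.
apply: approximable_linear; last first.
  by rewrite -[X in approximable _ X]addr0; exact: approximable_linear.
rewrite -[_ - _]scale1r scalerBr addrC -scaleNr.
apply: approximable_linear; first exact: approximable_abs.
by rewrite -[X in approximable _ X]addr0; apply: approximable_linear => //; exact: approximable_abs.
Qed.

Lemma bvnorm_ramp a b : a < b -> bvnorm (ramp a b) <= 2.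
Proof.
move=> ab; have -> : (2 : R) = 1 + 1 by rewrite -natr1.
apply: bvnorm_le => // [t|s si].
  rewrite rampE// normc_real; have /andP[r0 r1] := ramp_val01 a b (\val t).
  by rewrite ger0_norm.
have -> : variation_on (ramp a b) s =
    variation_on (fun t : sigma => (ramp_val a b (\val t))%:C) s.
  by apply: eq_variation_on => x y; rewrite !rampE.
apply: variation_antitone si => [x y xy|x]; last exact: ramp_val01.
rewrite /ramp_val le_min2// le_max2// ler_pM2r ?invr_gt0 ?subr_gt0//.
by rewrite lerD2l lerN2.
Qed.

Lemma ramp_mul a b c d : a < b -> b <= c -> c < d -> ramp a b * ramp c d = ramp a b.
Proof.
move=> ab bc cd; apply: val_inj; apply/funext => t.
rewrite -[LHS]/(ramp a b t * ramp c d t) -[RHS]/(ramp a b t) !rampE//.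
have [tc|tc] := leP (\val t) c; first by rewrite (ramp_val_eq1 cd tc) mulr1.
by rewrite (ramp_val_eq0 ab) ?mul0r// ltW// (le_lt_trans bc).
Qed.

Lemma ramp_splitE a m b : a < m -> m < b ->
  (b - a)%:C *: ramp a b = (m - a)%:C *: ramp a m + (b - m)%:C *: ramp m b.
Proof.
move=> am mb; have ab := lt_trans am mb.
apply: val_inj; apply/funext => t.
rewrite -[LHS]/((b - a)%:C * ramp a b t).
rewrite -[RHS]/((m - a)%:C * ramp a m t + (b - m)%:C * ramp m b t) !rampE//.
rewrite -!rmorphM -rmorphD; congr (_%:C); move: (\val t) => {}t.
have [ba [ma bm]] : b - a != 0 /\ m - a != 0 /\ b - m != 0.
  by rewrite !gt_eqF// subr_gt0.
have mid p q : p < q -> p <= t -> t <= q -> (q - p) * ramp_val p q t = q - t.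
  move=> pq pt tq; have qp : 0 < q - p by rewrite subr_gt0.
  rewrite /ramp_val (max_idPr _) ?divr_ge0 ?subr_ge0 ?(ltW qp)//; last lra.
  rewrite (min_idPr _) ?ler_pdivrMr ?mul1r//; last lra.
  by rewrite mulrC divfK// gt_eqF.
have [ta|at_] := leP t a.
  by rewrite !ramp_val_eq1//; [ring|lra].
have [bt|tb] := leP b t.
  by rewrite !ramp_val_eq0//; [ring|lra].
rewrite mid ?ltW//.
have [tm|mt] := leP t m.
  by rewrite (mid a m) ?(ltW at_)// ramp_val_eq1//; ring.
by rewrite (mid m b) ?(ltW mt) ?(ltW tb)// ramp_val_eq0 ?(ltW mt)//; ring.
Qed.

End Ramps.

(** * From polynomials to absolutely continuous functions *)

Lemma eq_ler {R : realType} (x y : R) : x = y -> x <= y. Proof. by move=> ->. Qed.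

Section Extension.
Context {R : realType} {W : lmodType R[i]} {I : Type}.
Variables (nu : I -> W -> R) (i0 : I) (sigma : set R) (csigma : compact sigma).
Hypothesis H : compact_family nu i0.

Local Notation poly p := (polyBV csigma p).

(** A functional calculus for polynomials that is bounded by the variation norm in all the
    seminorms, with the same constant. *)
Record poly_calculus (C : R) (Pol : {poly R[i]} -> W -> W) : Prop := PolyCalculus {
  calculus_bound_ge0 : 0 <= C;
  calculus_dominated : forall p, dominated_linear nu (C * bvnorm (poly p)) (Pol p);
  calculus_linear : forall a p q y, Pol (a *: p + q) y = a *: Pol p y + Pol q y;
  calculus_mul : forall p q y, Pol (p * q) y = Pol p (Pol q y);
  calculus_one : forall y, Pol 1 y = y }.

Variables (C : R) (Pol : {poly R[i]} -> W -> W).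
Hypothesis HP : poly_calculus C Pol.

Let C0 : 0 <= C := calculus_bound_ge0 HP.

Definition poly_approx (f : BV sigma) (n : nat) : {poly R[i]} :=
  xget 0 [set p | bvnorm (f - poly p) <= 2^-1 ^+ n].

Definition AC_calculus (f : BV sigma) (y : W) : W :=
  limit nu i0 (fun n => Pol (poly_approx f n) y).

Lemma poly_approxP f n : approximable csigma f ->
  bvnorm (f - poly (poly_approx f n)) <= 2^-1 ^+ n.
Proof.
move=> fa; have [p hp] := fa (2^-1 ^+ n) ltac:(by rewrite exprn_gt0// invr_gt0).
exact: (xgetI (P := [set p | bvnorm (f - poly p) <= 2^-1 ^+ n]) 0 hp).
Qed.

Lemma calculus_dist p q y i :
  nu i (Pol p y - Pol q y) <= C * bvnorm (poly p - poly q) * nu i y.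
Proof.
have <- : Pol (- 1 *: q + p) y = Pol p y - Pol q y.
  by rewrite (calculus_linear HP) scaleN1r addrC.
have <- : poly (- 1 *: q + p) = poly p - poly q.
  by rewrite polyBV_linear scaleN1r addrC.
exact: (calculus_dominated HP _).2.
Qed.

Lemma bvnorm_dist_trans (f g h : BV sigma) :
  bvnorm (f - h) <= bvnorm (f - g) + bvnorm (g - h).
Proof. by rewrite (le_trans _ (bvnormD _ _))// addrA subrK. Qed.

Lemma AC_calculus_cvgs f y : approximable csigma f ->
  cvgs nu i0 (fun n => Pol (poly_approx f n) y) (AC_calculus f y).
Proof.
move=> fa; apply: limitP; pose L := C * (bvnorm f + 1).
have close n p : bvnorm (poly (poly_approx f n) - poly (poly_approx f p)) <=
    2^-1 ^+ n + 2^-1 ^+ p.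
  apply: le_trans (bvnorm_dist_trans _ f _) _; apply: lerD; last exact: poly_approxP.
  by rewrite bvnorm_distC; exact: poly_approxP.
apply: (dominated_cauchy_cvgs H (K := L) (y := y)) => [n i|e e0].
  rewrite (le_trans ((calculus_dominated HP _).2 _ _))// ler_wpM2r ?(family_ge0 H)//.
  rewrite ler_wpM2l//.
  have -> : poly (poly_approx f n) = f - (f - poly (poly_approx f n)).
    by rewrite opprB addrCA subrr addr0.
  rewrite (le_trans (bvnormD _ _))// lerD2l bvnormN (le_trans (poly_approxP _ fa))//.
  by rewrite exprn_ile1// ?invr_ge0// invf_le1// ler1n.
have y0 := family_ge0 H i0 y.
have c0 : 0 < 2 * (C * nu i0 y + 1) by rewrite mulr_gt0// ltr_wpDl// mulr_ge0.
have [m hm] := exists_half_pow_le (divr_gt0 e0 c0).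
exists m => n p /hm mn /hm mp; rewrite (le_trans (calculus_dist _ _ _ _))//.
set d := e / _ in mn mp.
have d0 : 0 < d by rewrite divr_gt0.
have := divfK (lt0r_neq0 c0) e; rewrite -/d => de.
rewrite (@le_trans _ _ (C * (d + d) * nu i0 y))//; last by nra.
by rewrite ler_wpM2r// ler_wpM2l// (le_trans (close _ _))// lerD.
Qed.

Lemma AC_calculus_dist f p y i : approximable csigma f ->
  nu i (AC_calculus f y - Pol p y) <= C * bvnorm (f - poly p) * nu i y.
Proof.
move=> fa; apply: (family_lsc H) => e e0.
have y0 := family_ge0 H i y.
have c0 : 0 < C * nu i y + 1 by rewrite ltr_wpDl// mulr_ge0.
have [m hm] := exists_half_pow_le (divr_gt0 e0 c0).
have [k hk] := AC_calculus_cvgs y fa e0.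
pose n := maxn m k; exists (Pol (poly_approx f n) y - Pol p y).
  by rewrite opprB addrA subrK (family_distC H) hk// leq_maxr.
rewrite (le_trans (calculus_dist _ _ _ _))//.
have dn : bvnorm (poly (poly_approx f n) - poly p) <=
    e / (C * nu i y + 1) + bvnorm (f - poly p).
  apply: le_trans (bvnorm_dist_trans _ f _) _; rewrite lerD2r bvnorm_distC.
  by apply: le_trans (poly_approxP _ fa) _; apply: hm; exact: leq_maxl.
have := divfK (lt0r_neq0 c0) e; move: dn; set d := e / _ => dn de.
have d0 : 0 < d by rewrite divr_gt0.
rewrite (le_trans (ler_wpM2r y0 (ler_wpM2l C0 dn)))//.
have -> : C * (d + bvnorm (f - poly p)) * nu i y =
    C * bvnorm (f - poly p) * nu i y + C * nu i y * d by ring.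
by rewrite lerD2l -de mulrDr mulr1 mulrC lerDl ltW.
Qed.

Lemma AC_calculus_poly p y : AC_calculus (poly p) y = Pol p y.
Proof.
apply: (family_eq_small H (c := 0)) => e e0 _.
have := AC_calculus_dist p y i0 (approximable_poly csigma p).
by rewrite subrr -{1}(scale0r 0) bvnormZ normc0 !(mul0r, mulr0).
Qed.

Lemma AC_calculus_linear f g a y : approximable csigma f -> approximable csigma g ->
  AC_calculus (a *: f + g) y = a *: AC_calculus f y + AC_calculus g y.
Proof.
move=> fa ga; pose c := C * nu i0 y * (2 * normc a + 2).
apply: (family_eq_small H (c := c)) => e e0 e1.
have [p fp] := fa _ e0; have [q gq] := ga _ e0.
rewrite (le_trans (family_dist_trans H _ (Pol (a *: p + q) y) _ _))//.
have h1 := AC_calculus_dist (a *: p + q) y i0 (approximable_linear a fa ga).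
have h2 : nu i0 (Pol (a *: p + q) y - (a *: AC_calculus f y + AC_calculus g y)) <=
    normc a * nu i0 (AC_calculus f y - Pol p y) + nu i0 (AC_calculus g y - Pol q y).
  rewrite (family_distC H) (calculus_linear HP) opprD addrACA -scalerBr.
  exact: (family_sublinear H).
have h4 := AC_calculus_dist p y i0 fa; have h3 := AC_calculus_dist q y i0 ga.

have h5 : bvnorm (a *: f + g - poly (a *: p + q)) <= normc a * e + e.
  rewrite polyBV_linear opprD addrACA -scalerBr (le_trans (bvnormD _ _))// bvnormZ.
  by rewrite lerD// ler_wpM2l// normc_ge0.
have y0 := family_ge0 H i0 y; have a0 := normc_ge0 a.
have Cy : 0 <= C * nu i0 y by rewrite mulr_ge0.
have k1 := le_trans h1 (le_trans (eq_ler (mulrAC _ _ _)) (ler_wpM2l Cy h5)).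
have k4 := le_trans h4 (le_trans (eq_ler (mulrAC _ _ _)) (ler_wpM2l Cy fp)).
have k3 := le_trans h3 (le_trans (eq_ler (mulrAC _ _ _)) (ler_wpM2l Cy gq)).
rewrite (le_trans (lerD k1 (le_trans h2 (lerD (ler_wpM2l a0 k4) k3))))//.
by rewrite /c le_eqVlt; apply/orP; left; apply/eqP; ring.
Qed.

Lemma AC_calculus_dominated f : approximable csigma f ->
  dominated_linear nu (C * bvnorm f) (AC_calculus f).
Proof.
move=> fa; split=> [a u v|y i].
  apply: (limit_eq H).
  have := cvgs_linear H a (AC_calculus_cvgs u fa) (AC_calculus_cvgs v fa).
  by under [X in cvgs _ _ X]eq_fun do rewrite -(calculus_dominated HP _).1.
have poly0 : poly 0 = 0.
  by apply: val_inj; apply/funext => t; exact: horner0.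
have Pol0 : Pol 0 y = 0.
  have := calculus_linear HP (-1) 0 0 y.
  by rewrite scaler0 addr0 scaleN1r addNr.
by have := AC_calculus_dist 0 y i fa; rewrite Pol0 poly0 !subr0.
Qed.

Lemma AC_calculus_mul f g y : approximable csigma f -> approximable csigma g ->
  AC_calculus (f * g) y = AC_calculus f (AC_calculus g y).
Proof.
move=> fa ga; have y0 := family_ge0 H i0 y.
have f0 := bvnorm_ge0 f; have g0 := bvnorm_ge0 g.
pose z := AC_calculus g y; have z0 := family_ge0 H i0 z.
pose c := C * nu i0 y * (bvnorm f + bvnorm g + 1) +
  C * (bvnorm f + 1) * (C * nu i0 y) + C * nu i0 z.
apply: (family_eq_small H (c := c)) => e e0 e1.
have [p fp] := fa _ e0; have [q gq] := ga _ e0.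
have pb : bvnorm (poly p) <= bvnorm f + e.
  have -> : poly p = f - (f - poly p) by rewrite opprB addrCA subrr addr0.
  by rewrite (le_trans (bvnormD _ _))// lerD2l bvnormN.
rewrite (le_trans (family_dist_trans H _ (Pol (p * q) y) _ _))//.
have h1 := AC_calculus_dist (p * q) y i0 (approximable_mul fa ga).
have h2 : bvnorm (f * g - poly (p * q)) <= e * (bvnorm f + bvnorm g + 1).
  have -> : f * g - poly (p * q) = (f - poly p) * g + poly p * (g - poly q).
    by rewrite polyBV_mul mulrBl mulrBr addrA subrK.
  rewrite (le_trans (bvnormD _ _))//.
  have := bvnormM (f - poly p) g; have := bvnormM (poly p) (g - poly q).
  have := bvnorm_ge0 (g - poly q); have := bvnorm_ge0 (poly p).
  by have := ler_wpM2r g0 fp; nra.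
have h3 : nu i0 (Pol (p * q) y - AC_calculus f z) <=
    nu i0 (Pol p (Pol q y) - Pol p z) + nu i0 (AC_calculus f z - Pol p z).
  rewrite (calculus_mul HP) [X in _ <= _ + X](family_distC H).
  exact: (family_dist_trans H).
have h4 := AC_calculus_dist p z i0 fa.
have h5 : nu i0 (Pol p (Pol q y) - Pol p z) <= C * bvnorm (poly p) * nu i0 (z - Pol q y).
  rewrite -(linear_sub _ _ (calculus_dominated HP p)) (family_distC H _ z).
  exact: (calculus_dominated HP p).2.
have h6 := AC_calculus_dist q y i0 ga; rewrite -/z in h6.
have Cy : 0 <= C * nu i0 y by rewrite mulr_ge0.
have Cz : 0 <= C * nu i0 z by rewrite mulr_ge0.
have k1 := le_trans h1 (le_trans (eq_ler (mulrAC _ _ _)) (ler_wpM2l Cy h2)).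
have k3 := le_trans h4 (le_trans (eq_ler (mulrAC _ _ _)) (ler_wpM2l Cz fp)).
have k4 : C * bvnorm (poly p) <= C * (bvnorm f + 1).
  by rewrite ler_wpM2l// (le_trans pb)// lerD2l.
have k5 := le_trans h6 (le_trans (eq_ler (mulrAC _ _ _)) (ler_wpM2l Cy gq)).
have k6 : C * bvnorm (poly p) * nu i0 (z - Pol q y) <=
    C * (bvnorm f + 1) * (C * nu i0 y * e).
  by rewrite ler_pM ?mulr_ge0 ?bvnorm_ge0 ?(family_ge0 H).
rewrite (le_trans (lerD k1 (le_trans h3 (lerD (le_trans h5 k6) k3))))//.
by rewrite /c le_eqVlt; apply/orP; left; apply/eqP; ring.
Qed.

(** The constant is [2 * C] because a ramp has variation norm at most [2]. *)
Lemma AC_calculus_ramp_system :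
  ramp_system nu sigma (2 * C) (fun a b => AC_calculus (ramp csigma a b)).
Proof.
have ra a b : approximable csigma (ramp csigma a b) by exact: approximable_ramp.
have a0 : approximable csigma 0.
  move=> e e0; exists 0; have -> : poly 0 = 0.
    by apply: val_inj; apply/funext => t; exact: horner0.
  by rewrite subrr -(scale0r 0) bvnormZ normc0 mul0r ltW.
have calcZ a f y : approximable csigma f -> AC_calculus (a *: f) y = a *: AC_calculus f y.
  move=> fa; have := AC_calculus_linear a y fa a0; rewrite addr0 => ->.
  rewrite -[in AC_calculus 0 y](subrr (0 : BV sigma)).
  have -> : (0 : BV sigma) - 0 = -1 *: 0 + 0 by rewrite scaler0 addr0 subr0.
  by rewrite AC_calculus_linear// scaleN1r addNr addr0.
split=> [|a b ab|a b c d y ab bc cd|a m b y am mb|a b a' b' y ab ab' eqs|a b y ab la].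
- exact: mulr_ge0.
- have [l d] := AC_calculus_dominated (ra a b); split=> // y.
  apply: (dominated_le H) (d y); rewrite mulrC ler_wpM2r// bvnorm_ramp//.
- rewrite -(AC_calculus_mul y (ra a b) (ra c d)) -(AC_calculus_mul y (ra c d) (ra a b)).
  by rewrite (mulrC (ramp csigma c d)) ramp_mul.
- have rmb : approximable csigma ((b - m)%:C *: ramp csigma m b).
    by rewrite -[X in approximable _ X]addr0; exact: approximable_linear.
  rewrite -(calcZ _ _ y (ra a b)) (ramp_splitE csigma am mb)
    (AC_calculus_linear _ y (ra a m) rmb).
  by rewrite (calcZ _ _ y (ra m b)).
- congr (AC_calculus _ y); apply: val_inj; apply/funext => t.
  rewrite -[LHS]/(ramp csigma a b t) -[RHS]/(ramp csigma a' b' t) !rampE//.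
  have [[ta ta']|[tb tb']] := eqs (\val t) (set_valP t).
    by rewrite !ramp_val_eq1.
  by rewrite !ramp_val_eq0.
- rewrite -[RHS](calculus_one HP) -AC_calculus_poly polyBV1.
  congr (AC_calculus _ y); apply: val_inj; apply/funext => t.
  rewrite -[LHS]/(ramp csigma a b t) rampE// ramp_val_eq1//.
  exact: la (set_valP t).
Qed.

End Extension.

(** * Partitions of a compact set *)

Section Partitions.
Context {R : realType} {sigma : set R}.
Implicit Types (s t : sigma) (l : seq sigma).

(** An increasing sequence in [sigma], given by its first point and the others; [ok] is the
    requirement on consecutive points. *)
Fixpoint chain (ok : R -> R -> Prop) (s : sigma) (l : seq sigma) : Prop :=
  if l is s' :: l' then [/\ \val s < \val s', ok (\val s) (\val s') & chain ok s' l']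
  else True.

Definition endpoints (s : sigma) (l : seq sigma) : Prop :=
  (forall t : sigma, \val s <= \val t) /\ (forall t : sigma, \val t <= \val (last s l)).

Lemma chain_rcons ok s l t : chain ok s l -> \val (last s l) < \val t ->
  ok (\val (last s l)) (\val t) -> chain ok s (rcons l t).
Proof.
by elim: l s => [|s' l IH] s /= => [_ st okst|[ss' okss' cl] lt okl]; split=> //; exact: IH.
Qed.

Hypotheses (csigma : compact sigma) (sigma0 : sigma !=set0).

Let closed_sigma : closed sigma.
Proof. by apply: compact_closed csigma; exact: norm_hausdorff. Qed.

Let point (x : R) (hx : sigma x) : sigma := SigSub (mem_set hx).

Lemma sup_in_closed (A : set R) : A `<=` sigma -> A !=set0 -> sigma (sup A).
Proof.
move=> As A0; apply: closed_sigma => U.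
have [M [_ sM]] := compact_bounded csigma.
have supA : has_sup A.
  split=> //; exists (M + 1) => x /As sx.
  by apply: le_trans (ler_norm _) _; apply: (sM (M + 1)) => //; rewrite ltrDl.
case/nbhs_ballP => e /= e0 eU.
have [x Ax xe] := sup_adherent e0 supA.
exists x; split; first exact: As.
apply: eU; rewrite -ball_normE /ball_/= ger0_norm; last first.
  by rewrite subr_ge0; apply: sup_upper_bound.
by rewrite ltrBlDr addrC -ltrBlDr.
Qed.

Lemma inf_in_closed (A : set R) : A `<=` sigma -> A !=set0 ->
  sigma (inf A) /\ forall x, A x -> inf A <= x.
Proof.
move=> As A0.
have [M [_ sM]] := compact_bounded csigma.
have infA : has_inf A.
  split=> //; exists (- (M + 1)) => x /As sx.
  rewrite lerNl; apply: le_trans (ler_norm _) _; rewrite normrN.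
  by apply: (sM (M + 1)) => //; rewrite ltrDl.
split; last by move=> x Ax; apply: inf_lbound => //; case: infA.
apply: closed_sigma => U; case/nbhs_ballP => e /= e0 eU.
have [x Ax xe] := inf_adherent e0 infA.
exists x; split; first exact: As.
apply: eU; rewrite -ball_normE /ball_/= distrC ger0_norm; last first.
  by rewrite subr_ge0; apply: inf_lbound => //; case: infA.
by rewrite ltrBlDl.
Qed.

(** The supremum of the points that a chain from the minimum can reach is
    itself reached (by [left]) and cannot lie below another point of [sigma] (by
    [right], or by [gap] when the next point is isolated from it). *)
Lemma chain_exists (ok : R -> R -> Prop) :
  (forall a, exists2 d, 0 < d & forall b, a < b -> b < a + d -> ok a b) ->
  (forall b, exists2 d, 0 < d & forall a, b - d < a -> a < b -> ok a b) ->
  (forall a b, a < b -> (forall x, sigma x -> x <= a \/ b <= x) -> ok a b) ->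
  exists s l, chain ok s l /\ endpoints s l.
Proof.
move=> right left gap.
have [sm m_le] := inf_in_closed (@subset_refl _ sigma) sigma0.
pose m := point sm.
pose A := [set x | exists2 l, chain ok m l & x = \val (last m l)].
have As : A `<=` sigma by move=> _ [l _ ->]; exact: set_valP.
have A0 : A !=set0 by exists (\val m), [::].
have supA : has_sup A.
  split=> //; have [M [_ sM]] := compact_bounded csigma.
  exists (M + 1) => x /As sx.
  by apply: le_trans (ler_norm _) _; apply: (sM (M + 1)) => //; rewrite ltrDl.
have sc := sup_in_closed As A0.
have [l cl lE] : A (sup A).
  have [d d0 hd] := left (sup A).
  have [x [l cl xE] xd] := sup_adherent d0 supA.
  have := sup_upper_bound supA (ex_intro2 _ _ l cl xE); rewrite le_eqVlt => /orP[/eqP <-|xs].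
    by exists l.
  exists (rcons l (point sc)); last by rewrite last_rcons.
  by apply: chain_rcons; rewrite -?xE//; exact: hd.
exists m, l; split=> //; split=> [t|t]; first exact/m_le/set_valP.
rewrite -lE leNgt; apply/negP => ct.
pose B := [set x | sigma x /\ sup A < x].
have [sb b_le] := @inf_in_closed B (fun x h => h.1) (ex_intro _ (\val t) (conj (set_valP t) ct)).
have reach x (sx : sigma x) : sup A < x -> ok (sup A) x -> False.
  move=> cx okx; have : A x.
    exists (rcons l (point sx)); last by rewrite last_rcons.
    by apply: chain_rcons; rewrite -?lE.
  by move=> /(sup_upper_bound supA); rewrite leNgt cx.
have cb : sup A <= inf B.
  by apply: lb_le_inf => [|x [_ /ltW]//]; exists (\val t); split=> //; exact: set_valP.
have [cb'|] := ltP (sup A) (inf B).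
  apply: (reach _ sb cb'); apply: gap => // x sx; have [xc|cx] := leP x (sup A); first by left.
  by right; exact: b_le.
move=> bc; have {bc cb} bE : inf B = sup A by apply/eqP; rewrite eq_le bc cb.
have [d d0 hd] := right (sup A).
have infB : has_inf B.
  by split; [exists (\val t); split=> //; exact: set_valP|exists (sup A) => x [_ /ltW]].
have [x [sx cx] xd] := inf_adherent d0 infB.
by apply: (reach x sx cx); apply: hd => //; rewrite -bE.
Qed.

End Partitions.

(** * The Stieltjes calculus of a spectral family *)

Section Abel.
Context {R : realType} {W : lmodType R[i]} {I : Type}.
Variables (nu : I -> W -> R) (i0 : I) (sigma : set R).
Hypothesis H : compact_family nu i0.

(** [P] stands for jumps already met, which are moved one point to the right in each step
    at the price of one increment of [f]. *)
Lemma abel_sorted (i : I) (c : R) (f : sigma -> R[i]) (w : sigma -> W) (q : seq sigma)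
    (x : sigma) (P : W) :
  (forall n, nu i (P + \sum_(s <- take n.+1 (x :: q)) w s) <= c) ->
  nu i (f x *: P + \sum_(s <- x :: q) f s *: w s) <=
  c * (normc (f (last x q)) + variation_on f (x :: q)).
Proof.
elim: q x P => [|y q IH] x P hP.
  rewrite big_seq1 -scalerDr /variation_on big_nil addr0 mulrC.
  rewrite (le_trans (familyZ_le H _ _ _))// ler_wpM2l ?normc_ge0//.
  by have := hP 0; rewrite /= big_seq1.
have hP0 : nu i (P + w x) <= c by have := hP 0; rewrite /= big_seq1.
rewrite big_cons addrA -scalerDr variation_on_cons.
have -> : f x *: (P + w x) = f y *: (P + w x) - (f y - f x) *: (P + w x).
  by rewrite scalerBl opprB addrCA subrr addr0.
rewrite addrAC addrCA mulrDr [leRHS]addrC.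
apply: le_trans (familyB H _ _ _) _; apply: lerD; last first.
  by rewrite (le_trans (familyZ_le H _ _ _))// mulrC ler_wpM2r ?normc_ge0.
apply: IH => n; have := hP n.+1.
by rewrite /= big_cons addrA.
Qed.

(** Summation by parts: a sum [\sum f s *: w] over jumps [w] at points [s] is
    controlled by the partial sums of the jumps and the variation of [f]. *)
Lemma abel (i : I) (c : R) (f : BV sigma) (ws : seq (sigma * W)) : 0 <= c ->
  (forall u : sigma, nu i (\sum_(p <- ws | \val p.1 <= \val u) p.2) <= c) ->
  nu i (\sum_(p <- ws) f p.1 *: p.2) <= c * bvnorm f.
Proof.
move=> c0 wsc; pose leR (x y : sigma) := \val x <= \val y.
pose q := sort leR (undup (map fst ws)).
have qE (x : sigma * W) : x \in ws -> x.1 \in q.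
  by move=> xws; rewrite mem_sort mem_undup map_f.
have sq : increasing_on q.
  rewrite /increasing_on -(@sorted_map _ _ \val <%R) lt_sorted_uniq_le.
  rewrite (map_inj_uniq val_inj) sort_uniq undup_uniq/= sorted_map.
  by apply: sort_sorted => x y; exact: le_total.
pose w s := \sum_(p <- ws | p.1 == s) p.2.
have sumE (f' : sigma -> R[i]) : \sum_(p <- ws) f' p.1 *: p.2 = \sum_(s <- q) f' s *: w s.
  under [RHS]eq_bigr do rewrite scaler_sumr.
  rewrite (exchange_big_dep predT)//= !big_seq; apply: eq_bigr => p pws.
  rewrite (big_rem p.1) ?qE//= eqxx big_seq_cond big1 ?addr0// => s /andP[sq' /eqP ps].
  by move: sq'; rewrite -ps mem_rem_uniq ?sort_uniq ?undup_uniq// inE eqxx.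
have sumw q1 : uniq q1 -> \sum_(s <- q1) w s = \sum_(p <- ws | p.1 \in q1) p.2.
  move=> uq; rewrite (exchange_big_dep predT)//= [RHS]big_mkcond; apply: eq_bigr => p _.
  case: ifPn => pq; last first.
    by rewrite big_seq_cond big1// => s /andP[sq' /eqP ps]; rewrite ps sq' in pq.
  rewrite (big_rem p.1)//= eqxx big_seq_cond big1 ?addr0// => s /andP[sq' /eqP ps].
  by move: sq'; rewrite -ps mem_rem_uniq// inE eqxx.
rewrite sumE; case qq : q => [|x q'].
  by rewrite big_nil (family0 H) mulr_ge0 ?bvnorm_ge0.
have h := @abel_sorted i c f w q' x 0.
rewrite scaler0 add0r in h; apply: le_trans (h _) _ => [n|]; last first.
  rewrite ler_wpM2l// lerD ?le_supnorm//; apply: le_total_variation.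
  by rewrite -qq.
rewrite add0r -qq; have uq : uniq q by rewrite sort_uniq undup_uniq.
rewrite sumw ?take_uniq//.
pose u := last x (take n q').
rewrite [X in nu i X](_ : _ = \sum_(p <- ws | \val p.1 <= \val u) p.2) ?wsc//.
rewrite big_seq_cond [RHS]big_seq_cond; apply: eq_bigl => p.
case pws : (p \in ws) => //=; have pq := qE _ pws.
have tkE : take n.+1 q = rcons (belast x (take n q')) u by rewrite qq /= lastI.
have srt : pairwise (fun a b : sigma => \val a < \val b) (take n.+1 q ++ drop n.+1 q).
  rewrite cat_take_drop -sorted_pairwise//.
  by move=> a b c'; exact: lt_trans.
have : p.1 \in take n.+1 q ++ drop n.+1 q by rewrite cat_take_drop.
rewrite mem_cat; move: srt; rewrite tkE.
rewrite pairwise_cat pairwise_rcons => /and3P[/allrelP hr /andP[/allP hl _] _].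
have ul : u \in rcons (belast x (take n q')) u by rewrite mem_rcons inE eqxx.
have le_u s : s \in rcons (belast x (take n q')) u -> \val s <= \val u.
  by rewrite mem_rcons inE => /orP[/eqP ->//|/hl/ltW].
case pt : (p.1 \in rcons _ _) => /= pd; first by rewrite le_u.
by rewrite leNgt hr.
Qed.

End Abel.

Section StieltjesCalculus.
Context {R : realType} {W : lmodType R[i]} {I : Type}.
Variables (nu : I -> W -> R) (i0 : I) (sigma : set R).
Hypotheses (csigma : compact sigma) (sigma0 : sigma !=set0).
Hypothesis H : compact_family nu i0.
Variables (K : R) (rho : R -> R -> W -> W).
Hypothesis HR : ramp_system nu sigma K rho.
Implicit Types (s t : sigma) (l : seq sigma) (y : W) (f g : sigma -> R[i]).

Let K0 : 0 <= K := ramp_bound_ge0 HR.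

Local Notation E s := (spectral nu i0 rho (\val s)).

(** [F] is the value of the spectral family just before the first point of [l]. *)
Fixpoint riemann (F : W -> W) (l : seq sigma) (f : sigma -> R[i]) (y : W) : W :=
  if l is s :: l' then f s *: (E s y - F y) + riemann (E s) l' f y else 0.

Fixpoint jumps (u : W) (l : seq sigma) (y : W) : seq (sigma * W) :=
  if l is s :: l' then (s, E s y - u) :: jumps (E s y) l' y else [::].

Lemma riemannE F l f y : riemann F l f y = \sum_(p <- jumps (F y) l y) f p.1 *: p.2.
Proof.
elim: l F => [|s l IH] F /=; first by rewrite big_nil.
by rewrite big_cons IH.
Qed.

(** What makes the jumps along [l], counted from [F], disjoint projections: [F] is itself a
    projection, below all the [E s]. *)
Definition below (F : W -> W) (l : seq sigma) : Prop :=
  [/\ exists L, dominated_linear nu L F, forall y, F (F y) = F y &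
      forall s, s \in l -> forall y, E s (F y) = F y /\ F (E s y) = F y].

Lemma below_spectral ok s l : chain ok s l -> below (E s) l.
Proof.
move=> csl; split.
- by exists K; exact (spectral_linear H HR _).
- by move=> y; have [] := spectral_mul H HR y (lexx (\val s)).
have {csl} lt_s t : t \in l -> \val s <= \val t.
  elim: l s csl => // s' l IH s /= [ss' _ cl]; rewrite inE => /orP[/eqP ->|/(IH _ cl)].
    exact: ltW.
  by apply: le_trans; exact: ltW.
by move=> t /lt_s st y; have [] := spectral_mul H HR y st.
Qed.

Lemma below_zero l : below (fun=> 0) l.
Proof.
split=> //.
  by exists 0; split=> [a u v|y i]; rewrite ?scaler0 ?addr0// (family0 H) mul0r.
by move=> s _ y; rewrite (linear_zero (spectral_linear H HR _)).
Qed.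

(** [riemann F l f] is a combination of the disjoint projections
    [E s' - E s] over consecutive points. *)
Lemma riemann_orthogonal ok F s l f y : below F (s :: l) -> chain ok s l ->
  F (riemann F (s :: l) f y) = 0 /\ riemann F (s :: l) f (F y) = 0.
Proof.
elim: l F s y => [|s' l IH] F s y [[L lF] FF hF] csl.
  have [EF FE] := hF s (mem_head _ _) y.
  rewrite /= !addr0 (linear_scale _ _ lF) (linear_sub _ _ lF) FF EF FE.
  by rewrite subrr scaler0.
have [ss' _ cl] := csl; have bs := below_spectral csl.
have [Er rE] := IH _ _ (riemann F (s :: s' :: l) f y) bs cl.
have {Er}Er z : E s (riemann (E s) (s' :: l) f z) = 0 by have [] := IH _ _ z bs cl.
have {rE}rE z : riemann (E s) (s' :: l) f (E s z) = 0 by have [] := IH _ _ z bs cl.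
have EF z : E s (F z) = F z by have [] := hF s (mem_head _ _) z.
have FE z : F (E s z) = F z by have [] := hF s (mem_head _ _) z.
set r := riemann (E s) (s' :: l) f in Er rE *.
rewrite -![riemann F _ f _]/(f s *: (E s _ - F _) + r _).
rewrite (linear_add _ _ lF) (linear_scale _ _ lF) (linear_sub _ _ lF) FF FE EF !subrr scaler0.
split; rewrite ?scaler0 add0r; first by rewrite -FE Er (linear_zero lF).
by rewrite -EF rE.
Qed.

Lemma riemann_linear F L l f : dominated_linear nu L F ->
  forall a u v, riemann F l f (a *: u + v) = a *: riemann F l f u + riemann F l f v.
Proof.
elim: l F L => [|s l IH] F L lF a u v /=; first by rewrite scaler0 addr0.
have lE := spectral_linear H HR (\val s).
rewrite (IH _ _ lE) lF.1 lE.1 opprD addrACA -scalerBr scalerDr !scalerDr.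
by rewrite !scalerA [f s * a]mulrC addrACA.
Qed.

Lemma riemann_mul ok F s l f g y : below F (s :: l) -> chain ok s l ->
  riemann F (s :: l) f (riemann F (s :: l) g y) = riemann F (s :: l) (fun t => f t * g t) y.
Proof.
elim: l F s y => [|s' l IH] F s y bF csl.
  have [[L lF] FF hF] := bF; have [EF FE] := hF s (mem_head _ _) y.
  have lE := spectral_linear H HR (\val s).
  have [EE _] := spectral_mul H HR y (lexx (\val s)).
  rewrite /= !addr0 (linear_scale _ _ lF) (linear_sub _ _ lF) FF FE.
  by rewrite (linear_scale _ _ lE) (linear_sub _ _ lE) EE EF subrr scaler0 subr0 scalerA.
have [[L lF] FF hF] := bF; have [ss' _ cl] := csl; have bs := below_spectral csl.
have lE := spectral_linear H HR (\val s).
set h := fun t => f t * g t.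
have Er k z : E s (riemann (E s) (s' :: l) k z) = 0.
  by have [] := riemann_orthogonal k z bs cl.
have rE k z : riemann (E s) (s' :: l) k (E s z) = 0.
  by have [] := riemann_orthogonal k z bs cl.
have rr : riemann (E s) (s' :: l) f (riemann (E s) (s' :: l) g y) =
  riemann (E s) (s' :: l) h y by exact: IH.
have lr k := riemann_linear (s' :: l) k lE.
have EF z : E s (F z) = F z by have [] := hF s (mem_head _ _) z.
have FE z : F (E s z) = F z by have [] := hF s (mem_head _ _) z.
have EE z : E s (E s z) = E s z by have [] := spectral_mul H HR z (lexx (\val s)).
move: Er rE rr lr.
rewrite -![riemann F _ _ _]/(_ *: (E s _ - F _) + riemann (E s) (s' :: l) _ _).
move: (riemann (E s) (s' :: l)) => r Er rE rr lr.
set z := g s *: (E s y - F y).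
have Ez : E s z = z by rewrite /z (linear_scale _ _ lE) (linear_sub _ _ lE) EE EF.
have Fz : F z = 0 by rewrite /z (linear_scale _ _ lF) (linear_sub _ _ lF) FE FF subrr scaler0.
have Fr : F (r g y) = 0 by rewrite -FE Er (linear_zero lF).
have rz : r f (z + r g y) = r f z + r f (r g y).
  by have := lr f 1 z (r g y); rewrite !scale1r.
rewrite (linear_add _ _ lE) (linear_add _ _ lF) Ez Fz Er Fr !addr0 subr0.
by rewrite rz -{2}Ez rE add0r rr /z scalerA.
Qed.

Lemma riemann_one ok F s l y : chain ok s l -> F y = 0 ->
  riemann F (s :: l) (fun=> 1) y = E (last s l) y.
Proof.
move=> csl Fy; suff h : forall F, riemann F (s :: l) (fun=> 1) y = E (last s l) y - F y.
  by rewrite h Fy subr0.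
elim: l s csl {F Fy} => [|s' l IH] s csl F.
  by rewrite /= addr0 scale1r.
rewrite -[LHS]/(1 *: (E s y - F y) + riemann (E s) (s' :: l) (fun=> 1) y).
by have [_ _ cl] := csl; rewrite IH// scale1r addrC addrA subrK.
Qed.

Definition small_oscillation (e : R) (y : W) (a b : R) : Prop :=
  forall m, a <= m -> m < b ->
  nu i0 (spectral nu i0 rho m y - spectral nu i0 rho a y) <= e.

Definition fine_for (e : R) (y : W) (s : sigma) (l : seq sigma) : Prop :=
  chain (small_oscillation e y) s l /\ endpoints s l.

Lemma chain_imp (ok ok' : R -> R -> Prop) s l :
  (forall a b, ok a b -> ok' a b) -> chain ok s l -> chain ok' s l.
Proof. by move=> h; elim: l s => //= s' l IH s [? ? ?]; split; auto. Qed.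

(** One partition serves finitely many vectors: continuity from the right and limits from the
    left make small intervals harmless, and across a gap of [sigma] the spectral family is
    constant. *)
Lemma fine_for_exists e (ys : seq W) : 0 < e ->
  exists s l, forall y, y \in ys -> fine_for e y s l.
Proof.
move=> e0; case: (@chain_exists R sigma csigma sigma0
    (fun a b => forall y, y \in ys -> small_oscillation e y a b))
    => [a|b|a b ab gap|s [l [csl ep]]]; last first.
- by exists s, l => y yys; split=> //; apply: chain_imp csl => a b; exact.
- move=> y _ m am mb.
  by rewrite (spectral_gap H HR y ab gap am mb) subrr (family0 H) ltW.
- elim: ys => [|y ys [d d0 hd]]; first by exists 1.
  have [d' d'0 hd'] := spectral_left_cauchy H HR b y e0.
  exists (Num.min d d'); first by rewrite lt_min d0.
  move=> a; rewrite ltrBlDr -ltrBlDl lt_min !ltrBlDl => /andP[bd bd'] ab z.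
  rewrite inE => /orP[/eqP ->|zys]; last by apply: hd => //; rewrite ltrBlDr.
  move=> m am mb; apply: hd' => //; rewrite ltrBlDr//.
  by rewrite (lt_le_trans bd')// lerD2r.
- elim: ys => [|y ys [d d0 hd]]; first by exists 1.
  have [d' d'0 hd'] := spectral_right_cvg H HR a y e0.
  exists (Num.min d d'); first by rewrite lt_min d0.
  move=> b ab; rewrite -ltrBlDl lt_min !ltrBlDl => /andP[bd bd'] z.
  rewrite inE => /orP[/eqP ->|zys]; last exact: hd.
  by move=> m am mb; apply: hd' => //; exact: lt_trans bd'.
Qed.

Lemma jumps_above ok s l u y p : chain ok s l -> p \in jumps u l y -> \val s < \val p.1.
Proof.
elim: l s u => // s' l IH s u /= [ss' _ cl]; rewrite inE => /orP[/eqP ->//|/(IH _ _ cl)].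
exact: lt_trans.
Qed.

(** The jumps up to [t] add up to [E u y] for the last point [u <= t] of the partition, and
    [t] comes before the next point. *)
Lemma jumps_sum_near e s l y t : chain (small_oscillation e y) s l ->
  (forall t : sigma, \val t <= \val (last s l)) -> 0 <= e -> \val s <= \val t ->
  nu i0 (\sum_(p <- jumps (E s y) l y | \val p.1 <= \val t) p.2 + E s y - E t y) <= e.
Proof.
move=> + + e0; elim: l s => [|s' l IH] s.
  move=> _ mx st; rewrite /= big_nil add0r.
  have -> : s = t by apply: val_inj; apply/eqP; rewrite eq_le st mx.
  by rewrite subrr (family0 H).
move=> [ss' osc cl] mx st; rewrite /= big_cons /=.
have [s't|ts'] := leP (\val s') (\val t).
  have := IH s' cl mx s't; set X := \sum_(_ <- _ | _) _.
  by rewrite (addrAC _ X) subrK (addrC _ X).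
rewrite big1_seq ?add0r; last first.
  move=> p /andP[pt /(jumps_above cl) s'p].
  by have := lt_trans (lt_le_trans s'p pt) ts'; rewrite ltxx.
by rewrite (family_distC H); exact: osc.
Qed.

Lemma fine_step_near e s l y t : 0 <= e -> fine_for e y s l ->
  nu i0 (\sum_(p <- jumps 0 (s :: l) y | \val p.1 <= \val t) p.2 - E t y) <= e.
Proof.
move=> e0 [csl [mn mx]]; rewrite /= big_cons /= mn subr0.
by rewrite (addrC (E s y)); exact: jumps_sum_near.
Qed.

Definition riemann_sum s l (f : BV sigma) y := riemann (fun=> 0) (s :: l) f y.

(** The jumps of one partition and the opposites of those of the other form a single sum,
    whose partial sums are small because both compute [E t y] up to the oscillation. Thus no
    common refinement is needed. *)
Lemma fine_sums_near e e' s l s' l' (f : BV sigma) y : 0 <= e -> 0 <= e' ->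
  fine_for e y s l -> fine_for e' y s' l' ->
  nu i0 (riemann_sum s l f y - riemann_sum s' l' f y) <= (e + e') * bvnorm f.
Proof.
move=> e0 e'0 fe fe'; rewrite /riemann_sum !riemannE.
pose neg (p : sigma * W) := (p.1, - p.2).
rewrite -sumrN; under [X in _ + X]eq_bigr do rewrite -scalerN.
rewrite -(big_map neg predT (fun p => f p.1 *: p.2)) -big_cat.
apply: (abel H); first exact: addr_ge0.
move=> t; rewrite big_cat big_map /= sumrN.
apply: le_trans (family_dist_trans H _ (E t y) _ _) _.
by rewrite lerD// ?(family_distC H _ (E t y)); exact: fine_step_near.
Qed.

Lemma jumps_sum_dominated ok s l y t i : chain ok s l -> \val s <= \val t ->
  nu i (\sum_(p <- jumps (E s y) l y | \val p.1 <= \val t) p.2 + E s y) <= K * nu i y.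
Proof.
elim: l s => [|s' l IH] s.
  by move=> _ _; rewrite /= big_nil add0r; exact: (spectral_linear H HR _).2.
move=> [ss' _ cl] st; rewrite /= big_cons /=.
have [s't|ts'] := leP (\val s') (\val t).
  have := IH s' cl s't; set X := \sum_(_ <- _ | _) _.
  by rewrite (addrAC _ X) subrK (addrC _ X).
rewrite big1_seq ?add0r; last first.
  move=> p /andP[pt /(jumps_above cl) s'p].
  by have := lt_trans (lt_le_trans s'p pt) ts'; rewrite ltxx.
exact: (spectral_linear H HR _).2.
Qed.

(** The partial sums of the jumps are values of the spectral family, so summation by parts
    applies in every seminorm. *)
Lemma riemann_sum_dominated ok s l (f : BV sigma) y : chain ok s l -> endpoints s l ->
  dominated nu (K * bvnorm f) (riemann_sum s l f y) y.
Proof.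
move=> csl [mn _] i; rewrite /riemann_sum riemannE mulrAC; apply: (abel H).
  by rewrite mulr_ge0// (family_ge0 H).
move=> t; rewrite /= big_cons /= mn subr0 addrC.
exact: jumps_sum_dominated csl (mn t).
Qed.

Definition partition_of (n : nat) (y : W) : sigma * seq sigma :=
  xget (SigSub (mem_set (projT2 (cid sigma0))), [::])
    [set p | fine_for (2^-1 ^+ n) y p.1 p.2].

Lemma partition_ofP n y : fine_for (2^-1 ^+ n) y (partition_of n y).1 (partition_of n y).2.
Proof.
have [s [l h]] := @fine_for_exists (2^-1 ^+ n) [:: y] ltac:(by rewrite exprn_gt0// invr_gt0).
by apply: (xgetI (P := [set p | fine_for (2^-1 ^+ n) y p.1 p.2]) _ (_ : _ (s, l)));
  exact: h (mem_head _ _).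
Qed.

Definition BV_calculus (f : BV sigma) (y : W) : W :=
  limit nu i0 (fun n => riemann_sum (partition_of n y).1 (partition_of n y).2 f y).

Let h0 n : 0 <= (2^-1 : R) ^+ n. Proof. by rewrite exprn_ge0// invr_ge0. Qed.

Lemma BV_calculus_cvgs (f : BV sigma) y :
  cvgs nu i0 (fun n => riemann_sum (partition_of n y).1 (partition_of n y).2 f y)
    (BV_calculus f y).
Proof.
apply: limitP; apply: (dominated_cauchy_cvgs H (K := K * bvnorm f) (y := y)).
  move=> n; have [cp ep] := partition_ofP n y.
  exact: riemann_sum_dominated cp ep.
move=> e e0; have f0 := bvnorm_ge0 f.
have c0 : 0 < 2 * (bvnorm f + 1) by rewrite mulr_gt0// ltr_wpDl.
have [m hm] := exists_half_pow_le (divr_gt0 e0 c0).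
exists m => n p /hm mn /hm mp.
apply: le_trans (fine_sums_near f (h0 n) (h0 p) (partition_ofP n y) (partition_ofP p y)) _.
have := divfK (lt0r_neq0 c0) e; move: mn mp; set d := e / _ => mn mp de.
have d0 : 0 < d by rewrite divr_gt0.
rewrite (le_trans (ler_wpM2r f0 (lerD mn mp)))//.
by rewrite -de; nra.
Qed.

Lemma BV_calculus_near e s l (f : BV sigma) y : 0 <= e -> fine_for e y s l ->
  nu i0 (riemann_sum s l f y - BV_calculus f y) <= e * bvnorm f.
Proof.
move=> e0 fe; apply: (family_lsc H) => d d0; have f0 := bvnorm_ge0 f.
have c0 : 0 < bvnorm f + 1 by rewrite ltr_wpDl.
have [m hm] := exists_half_pow_le (divr_gt0 d0 c0).
have [k hk] := BV_calculus_cvgs f y d0.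
pose n := maxn m k; pose z := riemann_sum (partition_of n y).1 (partition_of n y).2 f y.
exists (riemann_sum s l f y - z).
  by rewrite opprB addrC addrA subrK hk// leq_maxr.
apply: le_trans (fine_sums_near f e0 (h0 n) fe (partition_ofP n y)) _.
rewrite mulrDl lerD2l.
apply: le_trans (ler_wpM2r f0 (hm n (leq_maxl _ _))) _.
by rewrite mulrAC ler_pdivrMr// ler_pM2l// lerDl.
Qed.

Lemma riemann_sum_linear s l a (f g : BV sigma) y :
  riemann_sum s l (a *: f + g) y = a *: riemann_sum s l f y + riemann_sum s l g y.
Proof.
rewrite /riemann_sum !riemannE scaler_sumr -big_split; apply: eq_bigr => p _ /=.
transitivity ((a * f p.1 + g p.1) *: p.2) => //.
by rewrite scalerDl scalerA.
Qed.

Lemma BV_calculus_linear a (f g : BV sigma) y :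
  BV_calculus (a *: f + g) y = a *: BV_calculus f y + BV_calculus g y.
Proof.
pose c := bvnorm (a *: f + g) + normc a * bvnorm f + bvnorm g.
apply: (family_eq_small H (c := c)) => e e0 _.
have [s [l h]] := fine_for_exists [:: y] e0; have fe := h y (mem_head _ _).
apply: le_trans (family_dist_trans H _ (riemann_sum s l (a *: f + g) y) _ _) _.
rewrite [X in _ + nu i0 X](_ : _ = a *: (riemann_sum s l f y - BV_calculus f y) +
    (riemann_sum s l g y - BV_calculus g y)); last first.
  by rewrite riemann_sum_linear scalerBr opprD addrACA.
have h1 := BV_calculus_near (a *: f + g) (ltW e0) fe.
have h2 := BV_calculus_near f (ltW e0) fe; have h3 := BV_calculus_near g (ltW e0) fe.
rewrite (family_distC H) in h1; apply: le_trans (lerD h1 (family_sublinear H _ _ _ _)) _.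
apply: le_trans (lerD (lexx _) (lerD (ler_wpM2l (normc_ge0 a) h2) h3)) _.
by rewrite /c le_eqVlt; apply/orP; left; apply/eqP; ring.
Qed.

Lemma BV_calculus_dominated (f : BV sigma) :
  dominated_linear nu (K * bvnorm f) (BV_calculus f).
Proof.
have dom y : dominated nu (K * bvnorm f) (BV_calculus f y) y.
  apply: (dominated_cvgs H _ (BV_calculus_cvgs f y)) => n.
  have [cp ep] := partition_ofP n y; exact: riemann_sum_dominated cp ep.
split=> // a u v; pose c := bvnorm f * (2 + normc a).
apply: (family_eq_small H (c := c)) => e e0 _.
have [s [l h]] := fine_for_exists [:: a *: u + v; u; v] e0.
have f1 := h _ (mem_head _ _).
have f2 : fine_for e u s l by apply: h; rewrite !inE eqxx orbT.
have f3 : fine_for e v s l by apply: h; rewrite !inE eqxx !orbT.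
apply: le_trans (family_dist_trans H _ (riemann_sum s l f (a *: u + v)) _ _) _.
have [[L lF] _ _] := below_zero (s :: l).
have rE : riemann_sum s l f (a *: u + v) =
    a *: riemann_sum s l f u + riemann_sum s l f v by exact: riemann_linear lF a u v.
have h1 := BV_calculus_near f (ltW e0) f1.
have h2 := BV_calculus_near f (ltW e0) f2; have h3 := BV_calculus_near f (ltW e0) f3.
rewrite (family_distC H) in h1.
rewrite [X in _ + nu i0 X](_ : _ = a *: (riemann_sum s l f u - BV_calculus f u) +
    (riemann_sum s l f v - BV_calculus f v)); last by rewrite rE scalerBr opprD addrACA.
apply: le_trans (lerD h1 (family_sublinear H _ _ _ _)) _.
apply: le_trans (lerD (lexx _) (lerD (ler_wpM2l (normc_ge0 a) h2) h3)) _.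
by rewrite /c le_eqVlt; apply/orP; left; apply/eqP; ring.
Qed.

(** On a partition that is fine both for [y] and for [BV_calculus g y] the identity holds
    exactly for the sums. *)
Lemma BV_calculus_mul (f g : BV sigma) y :
  BV_calculus (f * g) y = BV_calculus f (BV_calculus g y).
Proof.
set z := BV_calculus g y.
pose c := bvnorm (f * g) + K * bvnorm f * bvnorm g + bvnorm f.
apply: (family_eq_small H (c := c)) => e e0 _.
have [s [l h]] := fine_for_exists [:: y; z] e0.
have f1 := h _ (mem_head _ _).
have f2 : fine_for e z s l by apply: h; rewrite !inE eqxx orbT.
have [cp ep] := f1.
have rE : riemann_sum s l (f * g) y = riemann_sum s l f (riemann_sum s l g y).
  by rewrite /riemann_sum (riemann_mul _ _ _ (below_zero _) cp).
have h1 := BV_calculus_near (f * g) (ltW e0) f1.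
have h2 := BV_calculus_near f (ltW e0) f2; have h3 := BV_calculus_near g (ltW e0) f1.
have [[L lF] _ _] := below_zero (s :: l).
have rl : dominated_linear nu (K * bvnorm f) (riemann_sum s l f).
  split=> [a u v|u]; first exact: riemann_linear lF a u v.
  exact: riemann_sum_dominated cp ep.
have h4 : nu i0 (riemann_sum s l f (riemann_sum s l g y) - riemann_sum s l f z) <=
    K * bvnorm f * (e * bvnorm g).
  rewrite -(linear_sub _ _ rl); apply: le_trans (rl.2 _ _) _.
  by rewrite ler_wpM2l// mulr_ge0 ?bvnorm_ge0.
rewrite (family_distC H) rE in h1.
apply: le_trans (family_dist_trans H _ _ _ _) _.
apply: le_trans (lerD h1 (family_dist_trans H _ (riemann_sum s l f z) _ _)) _.
apply: le_trans (lerD (lexx _) (lerD h4 h2)) _.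
by rewrite /c le_eqVlt; apply/orP; left; apply/eqP; ring.
Qed.

Lemma BV_calculus_one y : BV_calculus 1 y = y.
Proof.
apply: (family_eq_small H (c := bvnorm (1 : BV sigma))) => e e0 _.
have [s [l h]] := fine_for_exists [:: y] e0; have fe := h y (mem_head _ _).
have := BV_calculus_near 1 (ltW e0) fe; rewrite mulrC (family_distC H).
have [cp [_ mx]] := fe.
rewrite /riemann_sum (riemann_one cp)// (spectral_top H HR)// => t ts.
exact: (mx (SigSub (mem_set ts))).
Qed.

(** The operator of [\val (last s l) - t] on [sigma], when [s] and [last s l] are its
    extreme points; in [base_sum] the ramps are replaced by the projections they are close to. *)
Fixpoint ramp_sum s l y : W :=
  if l is s' :: l' then (\val s' - \val s)%:C *: rho (\val s) (\val s') y + ramp_sum s' l' y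
  else 0.

Fixpoint base_sum s l y : W :=
  if l is s' :: l' then (\val s' - \val s)%:C *: E s y + base_sum s' l' y else 0.

Lemma riemann_id ok s l y : chain ok s l ->
  riemann (E s) l (fun t => (\val t)%:C) y + (\val s)%:C *: E s y =
  (\val (last s l))%:C *: E (last s l) y - base_sum s l y.
Proof.
elim: l s => [|s' l IH] s /=; first by rewrite subr0 add0r.
move=> [ss' _ cl]; rewrite opprD addrCA -(IH _ cl).
rewrite (rmorphB (real_complex R)) scalerBl opprB scalerBr.
have key (a b c r : W) : a - b + r + c = c - b + (r + a).
  by rewrite addrC -!addrA; congr (_ + _); rewrite addrC -addrA.
exact: key.
Qed.

Lemma ramp_sum_near e s l y : 0 <= e -> chain (small_oscillation e y) s l ->
  nu i0 (ramp_sum s l y - base_sum s l y) <= (\val (last s l) - \val s) * (K * e).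
Proof.
move=> e0; elim: l s => [|s' l IH] s /=; first by rewrite subrr (family0 H) subrr mul0r.
move=> [ss' osc cl]; rewrite opprD addrACA -scalerBr.
have := ramp_near_spectral H HR ss' e0 osc; have := IH s' cl.
move=> h1 h2; apply: le_trans (familyD H _ _ _) _; apply: le_trans (lerD h2 h1) _.
by rewrite -mulrDl addrC addrA subrK.
Qed.

Lemma BV_calculus_id (f : BV sigma) (A : W -> W) y :
  (forall t, f t = (\val t)%:C) ->
  (forall s l, chain (fun _ _ => True) s l -> endpoints s l ->
     A y = (\val (last s l))%:C *: y - ramp_sum s l y) ->
  BV_calculus f y = A y.
Proof.
move=> fid hA.
have [s1 [l1 h1]] := @fine_for_exists 1 [:: y] ltr01.
have [_ [mn1 mx1]] := h1 y (mem_head _ _).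
pose D := \val (last s1 l1) - \val s1.
apply: (family_eq_small H (c := bvnorm f + D * K)) => e e0 _.
have [s [l h]] := fine_for_exists [:: y] e0; have fe := h y (mem_head _ _).
have [cl [mn mx]] := fe.
apply: le_trans (family_dist_trans H _ (riemann_sum s l f y) _ _) _.
have := BV_calculus_near f (ltW e0) fe; rewrite (family_distC H) mulrC => b1.
have top : E (last s l) y = y.
  by rewrite (spectral_top H HR)// => t ts; exact: (mx (SigSub (mem_set ts))).
have eA : A y = (\val (last s l))%:C *: y - ramp_sum s l y.
  by apply: hA => //; apply: chain_imp cl.
have eR : riemann_sum s l f y = (\val (last s l))%:C *: y - base_sum s l y.
  have := riemann_id y cl; rewrite top => <-.
  rewrite /riemann_sum /= subr0 addrC fid; congr (_ + _).
  by rewrite !riemannE; apply: eq_bigr => p _; rewrite fid.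
have b2 : nu i0 (riemann_sum s l f y - A y) <= D * K * e.
  rewrite eA eR opprB addrC addrA subrK.
  apply: le_trans (ramp_sum_near (ltW e0) cl) _.
  rewrite mulrA ler_wpM2r ?(ltW e0)// ler_wpM2r//.
  by rewrite /D lerD// lerN2.
by apply: le_trans (lerD b1 b2) _; rewrite le_eqVlt; apply/orP; left; apply/eqP; ring.
Qed.

End StieltjesCalculus.

Section ExtensionTheorem.
Context {R : realType} {W : lmodType R[i]} {I : Type}.
Variables (nu : I -> W -> R) (i0 : I) (sigma : set R).
Hypotheses (csigma : compact sigma) (sigma0 : sigma !=set0).
Hypothesis H : compact_family nu i0.
Variables (C : R) (Pol : {poly R[i]} -> W -> W).
Hypothesis HP : poly_calculus nu csigma C Pol.
Implicit Types (s t : sigma) (l : seq sigma).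

Local Notation poly p := (polyBV csigma p).
Local Notation calc := (AC_calculus nu i0 csigma Pol).
Local Notation rho := (fun a b => calc (ramp csigma a b)).

Fixpoint ramps s l : BV sigma :=
  if l is s' :: l' then
    (\val s' - \val s)%:C *: ramp csigma (\val s) (\val s') + ramps s' l'
  else 0.

Lemma ramp_val_truncation (a c x : R) : a < c ->
  (c - a) * ramp_val a c x = Num.max x c - Num.max x a.
Proof.
move=> ac; have [xa|ax] := leP x a.
  by rewrite ramp_val_eq1// (max_idPr _) ?mulr1// ltW// (le_lt_trans xa).
have [cx|xc] := leP c x; first by rewrite ramp_val_eq0// mulr0 subrr.
have d0 : 0 < c - a by rewrite subr_gt0.
rewrite /ramp_val (max_idPr _); last by rewrite divr_ge0// ?(ltW d0)// subr_ge0 ltW.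
rewrite (min_idPr _); last by rewrite ler_pdivrMr// mul1r lerD2l lerN2 ltW.
by rewrite mulrC divfK// gt_eqF.
Qed.

(** A ramp multiplied by the length of its descent is a difference of two truncations, and
    these telescope. *)
Lemma ramps_value ok s l t : chain ok s l -> \val t <= \val (last s l) ->
  ramps s l t = (\val (last s l) - Num.max (\val t) (\val s))%:C.
Proof.
elim: l s => [|s' l IH] s.
  by move=> _ ts; rewrite /= (max_idPr ts) subrr.
move=> [ss' _ cl] tl.
transitivity ((\val s' - \val s)%:C * ramp csigma (\val s) (\val s') t + ramps s' l t) => //.
rewrite (IH _ cl tl) rampE// -rmorphM -rmorphD ramp_val_truncation//; congr (_%:C).
by rewrite addrC addrA subrK.
Qed.

Lemma approximable0 : approximable csigma 0.
Proof.
have -> : (0 : BV sigma) = -1 *: poly 1 + poly 1 by rewrite scaleN1r addNr.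
by apply: approximable_linear; exact: approximable_poly.
Qed.

Lemma approximable_ramps s l : approximable csigma (ramps s l).
Proof.
elim: l s => [|s' l IH] s /=; first exact: approximable0.
by apply: approximable_linear => //; exact: approximable_ramp.
Qed.

Lemma calc0 y : calc 0 y = 0.
Proof.
have := AC_calculus_linear H HP (-1) y approximable0 approximable0.
by rewrite scaler0 addr0 scaleN1r addNr.
Qed.

Lemma calc_ramps s l y : calc (ramps s l) y = ramp_sum rho s l y.
Proof.
elim: l s => [|s' l IH] s /=; first exact: calc0.
by rewrite (AC_calculus_linear H HP)// ?IH//; [exact: approximable_ramp|exact: approximable_ramps].
Qed.

Lemma calc_id s l y : chain (fun _ _ => True) s l -> endpoints s l ->
  Pol 'X y = (\val (last s l))%:C *: y - ramp_sum rho s l y.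
Proof.
move=> cl [mn mx]; rewrite -(AC_calculus_poly H HP).
have -> : poly 'X = -1 *: ramps s l + poly (\val (last s l))%:C%:P.
  apply: val_inj; apply/funext => t.
  transitivity ('X.[(\val t)%:C]) => //.
  transitivity (-1 * ramps s l t + ((\val (last s l))%:C%:P).[(\val t)%:C]) => //.
  rewrite hornerX hornerC (ramps_value cl (mx t)) (max_idPl (mn t)).
  by rewrite rmorphB mulN1r opprB subrK.
rewrite (AC_calculus_linear H HP); [|exact: approximable_ramps|exact: approximable_poly].
rewrite scaleN1r calc_ramps addrC (AC_calculus_poly H HP); congr (_ - _).
have -> : (\val (last s l))%:C%:P = (\val (last s l))%:C *: 1 + 0 :> {poly R[i]}.
  by rewrite addr0 alg_polyC.
have Pol0 : Pol 0 y = 0.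
  have := calculus_linear HP (-1) 0 0 y.
  by rewrite scaler0 addr0 scaleN1r addNr.
by rewrite (calculus_linear HP) (calculus_one HP) Pol0 addr0.
Qed.

Definition extended_calculus : BV sigma -> W -> W := BV_calculus nu i0 sigma0 rho.

Let HR := AC_calculus_ramp_system H HP.

Lemma extended_calculus_poly p y : extended_calculus (poly p) y = Pol p y.
Proof.
have lin := BV_calculus_linear csigma sigma0 H HR.
have psi0 z : extended_calculus 0 z = 0.
  have := lin (-1) 0 0 z.
  by rewrite scaler0 addr0 scaleN1r addNr.
have Pol0 z : Pol 0 z = 0.
  have := calculus_linear HP (-1) 0 0 z.
  by rewrite scaler0 addr0 scaleN1r addNr.
have psiX z : extended_calculus (poly 'X) z = Pol 'X z.
  apply: (BV_calculus_id csigma sigma0 H HR (A := Pol 'X)) => [t|s l cl ep].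
    by transitivity ('X.[(\val t)%:C]) => //; rewrite hornerX.
  exact: calc_id.
elim/poly_ind: p y => [|p c IH] y.
  rewrite Pol0 [X in extended_calculus X _](_ : _ = 0) ?psi0//.
  by apply: val_inj; apply/funext => t; exact: horner0.
have -> : p * 'X + c%:P = c *: 1 + p * 'X by rewrite alg_polyC addrC.
rewrite (calculus_linear HP) (calculus_mul HP) (calculus_one HP) polyBV_linear.
rewrite [LHS]lin; congr (_ + _).
  by congr (_ *: _); rewrite polyBV1 (BV_calculus_one csigma sigma0 H HR).
rewrite polyBV_mul [LHS](BV_calculus_mul csigma sigma0 H HR).
by rewrite -psiX -IH.
Qed.

End ExtensionTheorem.

(** * Complex integrals and Lebesgue spaces *)

Section ComplexIntegral.
Context d (T : measurableType d) (R : realType).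
Variable mu : {measure set T -> \bar R}.
Implicit Types (f g : T -> R[i]).

Definition cintegrable f : Prop :=
  mu.-integrable [set: T] (EFin \o (fun t => complex.Re (f t))) /\
  mu.-integrable [set: T] (EFin \o (fun t => complex.Im (f t))).

Lemma normRe_le (z : R[i]) : `|complex.Re z| <= normc z.
Proof.
case: z => a b /=; rewrite -[leLHS]sqrtr_sqr ler_wsqrtr// lerDl; exact: sqr_ge0.
Qed.

Lemma normIm_le (z : R[i]) : `|complex.Im z| <= normc z.
Proof.
case: z => a b /=; rewrite -[leLHS]sqrtr_sqr ler_wsqrtr// lerDr; exact: sqr_ge0.
Qed.

Lemma normc_le_ReIm (z : R[i]) : normc z <= `|complex.Re z| + `|complex.Im z|.
Proof.
case: z => a b /=; rewrite -[leRHS]ger0_norm ?addr_ge0// -sqrtr_sqr ler_wsqrtr//.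
by rewrite sqrrD !real_normK ?num_real// -addrA lerD2l lerDr mulrn_wge0// mulr_ge0.
Qed.

Lemma cmfun_mul f g : f \in @cmfun _ T R -> g \in @cmfun _ T R -> (fun t => f t * g t) \in @cmfun _ T R.
Proof.
move=> /cmfunP[f1 f2] /cmfunP[g1 g2]; apply/cmfunP; split.
- have -> : (fun t => complex.Re (f t * g t)) = (fun t =>
     complex.Re (f t) * complex.Re (g t) - complex.Im (f t) * complex.Im (g t)).
    by apply/funext => t; case: (f t) (g t) => [? ?] [? ?].
  by apply: measurable_realfun.measurable_funB; apply: measurable_realfun.measurable_funM.
- have -> : (fun t => complex.Im (f t * g t)) = (fun t =>
     complex.Re (f t) * complex.Im (g t) + complex.Im (f t) * complex.Re (g t)).
    by apply/funext => t; case: (f t) (g t) => [? ?] [? ?].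
  by apply: measurable_realfun.measurable_funD; apply: measurable_realfun.measurable_funM.
Qed.

Lemma cmfun_real (F : T -> R) : measurable_fun [set: T] F -> (fun t => (F t)%:C) \in @cmfun _ T R.
Proof. by move=> mF; apply/cmfunP; split => //=; exact: measurable_cst. Qed.

Lemma CMfunP (f : CMfun T R) : (f : T -> R[i]) \in @cmfun _ T R.
Proof. by case: f. Qed.

Lemma measurable_normc_fun f : f \in @cmfun _ T R -> measurable_fun [set: T] (fun t => normc (f t)).
Proof. by move=> mf; exact: (measurable_normc (Build_CMfun mf)). Qed.

(** Domination in absolute value, almost everywhere, bounds a complex integral;
    the factor 2 stands for the real and the imaginary part. *)
Lemma cintegral_le f (G : T -> R) (c : R) : f \in @cmfun _ T R ->
  measurable_fun [set: T] G -> (forall t, 0 <= G t) ->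
  (\int[mu]_t (G t)%:E <= c%:E)%E ->
  (\forall t \ae mu, normc (f t) <= G t) ->
  cintegrable f /\ normc (cintegral mu f) <= 2 * c.
Proof.
move=> /cmfunP[mRe mIm] mG G0 Gc fG.
have part (F : T -> R) : measurable_fun [set: T] F ->
    (forall t, `|F t| <= normc (f t)) ->
    mu.-integrable [set: T] (EFin \o F) /\ `|\int[mu]_t F t| <= c.
  move=> mF Ff; have le_c : (\int[mu]_t `|(F t)%:E| <= c%:E)%E.
    apply: le_trans Gc; apply: ae_ge0_le_integral => //.
    - by apply/measurable_EFinP; exact: (measurableT_comp (@normr_measurable R setT)).
    - by move=> t _; rewrite lee_fin.
    - exact/measurable_EFinP.
    - by apply: filterS fG => t ft _; rewrite lee_fin (le_trans (Ff t)).
  have iF : mu.-integrable [set: T] (EFin \o F).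
    apply/integrableP; split; first exact/measurable_EFinP.
    by rewrite (le_lt_trans le_c)// ltry.
  split=> //; rewrite -lee_fin EFin_normr_Rintegral//.
  by rewrite (le_trans (le_abse_integral _ _ _))//; exact/measurable_EFinP.
have [iRe lRe] := part _ mRe (fun t => normRe_le (f t)).
have [iIm lIm] := part _ mIm (fun t => normIm_le (f t)).
split; first by split.
rewrite (le_trans (normc_le_ReIm _))// mulr_natl mulr2n.
exact: lerD lRe lIm.
Qed.

Lemma cintegral_linear a f g : cintegrable f -> cintegrable g ->
  cintegral mu (fun t => a * f t + g t) = a * cintegral mu f + cintegral mu g.
Proof.
move=> [fR fI] [gR gI]; rewrite /cintegral.
have iZ (k : R) (F : T -> R) : mu.-integrable [set: T] (EFin \o F) ->
    mu.-integrable [set: T] (EFin \o (fun t => k * F t)).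
  by move=> iF; apply: eq_integrable (integrableZl measurableT k iF) => // t _.
have iB (F G : T -> R) : mu.-integrable [set: T] (EFin \o F) ->
    mu.-integrable [set: T] (EFin \o G) ->
    mu.-integrable [set: T] (EFin \o (fun t => F t - G t)).
  by move=> iF iG; apply: eq_integrable (integrableB measurableT iF iG) => // t _.
have iD (F G : T -> R) : mu.-integrable [set: T] (EFin \o F) ->
    mu.-integrable [set: T] (EFin \o G) ->
    mu.-integrable [set: T] (EFin \o (fun t => F t + G t)).
  by move=> iF iG; apply: eq_integrable (integrableD measurableT iF iG) => // t _.
case: a => p q.
have -> : \int[mu]_t complex.Re ((p +i* q) * f t + g t) =
    p * \int[mu]_t complex.Re (f t) - q * \int[mu]_t complex.Im (f t)
    + \int[mu]_t complex.Re (g t).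
  rewrite -!RintegralZl// -RintegralB ?iZ// -RintegralD ?iB ?iZ//.
  by apply: eq_Rintegral => t _; case: (f t) (g t) => [? ?] [? ?].
have -> : \int[mu]_t complex.Im ((p +i* q) * f t + g t) =
    p * \int[mu]_t complex.Im (f t) + q * \int[mu]_t complex.Re (f t)
    + \int[mu]_t complex.Im (g t).
  rewrite -!RintegralZl// -RintegralD ?iZ// -RintegralD ?iD ?iZ//.
  by apply: eq_Rintegral => t _; case: (f t) (g t) => [? ?] [? ?].
by [].
Qed.

Lemma cintegral_ae f g : f \in @cmfun _ T R -> g \in @cmfun _ T R -> f = g %[ae mu] ->
  cintegral mu f = cintegral mu g.
Proof.
move=> /cmfunP[fR fI] /cmfunP[gR gI] fg; rewrite /cintegral; congr (_ +i* _); congr (fine _);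
  apply: ae_eq_integral => //; try (exact/measurable_EFinP);
  by apply: filterS fg => t /= + _ => ->.
Qed.

End ComplexIntegral.

Section Lebesgue.
Context d (T : measurableType d) (R : realType).
Variable mu : {measure set T -> \bar R}.
Local Open Scope quotient_scope.

Lemma L0norm_pi p (f : CMfun T R) : (1 <= p)%E ->
  L0norm p (\pi_(L0 mu) f) = Lnormc mu p f.
Proof. by move=> p1; apply: ae_eq_Lnormc => //; exact: L0_repr. Qed.

Fact Lp_of_subproof p (p1 : (1 <= p)%E) (f : CMfun T R) :
  (Lnormc mu p f < +oo)%E -> \pi_(L0 mu) f \in Lp_pred p1.
Proof. by move=> foo; rewrite inE/= L0norm_pi. Qed.

Definition Lp_of p (p1 : (1 <= p)%E) (f : CMfun T R) (foo : (Lnormc mu p f < +oo)%E) :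
  Lp mu p1 := Build_Lp (Lp_of_subproof p1 foo).

Lemma Lp_ofE p (p1 : (1 <= p)%E) (f : CMfun T R) (foo : (Lnormc mu p f < +oo)%E) :
  (Lp_of p1 foo : T -> R[i]) = f %[ae mu].
Proof. exact: L0_repr. Qed.

Lemma Lp_linear_ae p (p1 : (1 <= p)%E) a (y z : Lp mu p1) :
  (a *: y + z : T -> R[i]) = (fun t => a * y t + z t) %[ae mu].
Proof.
have h1 := L0_reprD (a *: (y : L0 mu)) (z : L0 mu); have h2 := L0_reprZ a (y : L0 mu).
apply: filterS2 h1 h2 => t /= h1 h2 _; rewrite [LHS]h1//.
by transitivity (repr (a *: (y : L0 mu)) t + z t) => //; rewrite h2.
Qed.

Definition norm1 (y : L1 mu) : R := fine (L0norm 1%E y).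
Definition normoo (x : Linfty mu) : R := fine (L0norm +oo%E x).

Lemma norm1_integral (y : L1 mu) : (\int[mu]_t (normc (y t))%:E)%E = (norm1 y)%:E.
Proof.
rewrite /norm1 Lp_fin /L0norm /Lnormc Lnorm1; apply: eq_integral => t _ /=.
by rewrite ger0_norm// normc_ge0.
Qed.

Lemma norm1_ge0 (y : L1 mu) : 0 <= norm1 y.
Proof. by rewrite fine_ge0// L0norm_ge0. Qed.

Lemma normoo_ge0 (x : Linfty mu) : 0 <= normoo x.
Proof. by rewrite fine_ge0// L0norm_ge0. Qed.

Lemma Lnormc_ooP (f : T -> R[i]) (c : R) : 0 <= c ->
  (Lnormc mu +oo%E f <= c%:E)%E <-> \forall t \ae mu, normc (f t) <= c.
Proof.
move=> c0; rewrite /Lnormc unlock; case: ifPn => [_|]; last first.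
  rewrite -leNgt => mu0; split=> _; last by rewrite lee_fin.
  exists setT; split=> //; apply/eqP.
  by rewrite eq_le mu0 measure_ge0.
split=> [/ess_supP|] h.
  by apply: filterS h => t /=; rewrite lee_fin ger0_norm// normc_ge0.
apply/ess_supP; apply: filterS h => t /=.
by rewrite lee_fin ger0_norm// normc_ge0.
Qed.

Lemma normoo_ae (x : Linfty mu) : \forall t \ae mu, normc (x t) <= normoo x.
Proof.
by apply/Lnormc_ooP; rewrite ?normoo_ge0// /normoo Lp_fin.
Qed.

Lemma normoo_le (x : Linfty mu) c : 0 <= c -> (\forall t \ae mu, normc (x t) <= c) ->
  normoo x <= c.
Proof. by move=> c0 /(Lnormc_ooP _ c0); rewrite -lee_fin /normoo Lp_fin. Qed.

Lemma cmfun_pair (y : L1 mu) (x : Linfty mu) : (fun t => y t * x t) \in @cmfun _ T R.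
Proof. exact: cmfun_mul (CMfunP _) (CMfunP _). Qed.

Lemma pairing_le (y : L1 mu) (x : Linfty mu) :
  cintegrable mu (fun t => y t * x t) /\
  normc (pairing y x) <= 2 * (norm1 y * normoo x).
Proof.
apply: (@cintegral_le _ _ _ mu _ (fun t => normc (y t) * normoo x)).
- exact: cmfun_pair.
- by apply: measurable_realfun.measurable_funM => //; exact: measurable_normc.
- by move=> t; rewrite mulr_ge0 ?normc_ge0 ?normoo_ge0.
- under eq_integral do rewrite EFinM.
  rewrite ge0_integralZr//; first by rewrite norm1_integral EFinM.
  + by apply/measurable_EFinP; exact: measurable_normc.
  + by move=> t _; rewrite lee_fin normc_ge0.
  + by rewrite lee_fin normoo_ge0.
- apply: filterS (normoo_ae x) => t xt.
  by rewrite normcM ler_wpM2l ?normc_ge0.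
Qed.

Lemma pairing_linearl a (y z : L1 mu) (x : Linfty mu) :
  pairing (a *: y + z) x = a * pairing y x + pairing z x.
Proof.
rewrite -cintegral_linear; try exact: (pairing_le _ _).1.
apply: cintegral_ae; first exact: cmfun_pair.
  have -> : (fun t => a * (y t * x t) + z t * x t) =
      (a *: Build_CMfun (cmfun_pair y x) + Build_CMfun (cmfun_pair z x) : CMfun T R) by [].
  exact: CMfunP.
apply: filterS (Lp_linear_ae a y z) => t /= h _.
by rewrite h// mulrDl mulrA.
Qed.

Lemma pairing_linearr a (y : L1 mu) (x z : Linfty mu) :
  pairing y (a *: x + z) = a * pairing y x + pairing y z.
Proof.
rewrite -cintegral_linear; try exact: (pairing_le _ _).1.
apply: cintegral_ae; first exact: cmfun_pair.
  have -> : (fun t => a * (y t * x t) + y t * z t) =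
      (a *: Build_CMfun (cmfun_pair y x) + Build_CMfun (cmfun_pair y z) : CMfun T R) by [].
  exact: CMfunP.
apply: filterS (Lp_linear_ae a x z) => t /= h _.
by rewrite h// mulrDr mulrCA.
Qed.

Lemma norm1_le (y : L1 mu) (f : T -> R[i]) (c : R) : (y : T -> R[i]) = f %[ae mu] ->
  f \in @cmfun _ T R -> (\int[mu]_t (normc (f t))%:E <= c%:E)%E -> norm1 y <= c.
Proof.
move=> yf mf fc; rewrite -lee_fin -norm1_integral (le_trans _ fc)//.
rewrite le_eqVlt; apply/orP; left; apply/eqP; apply: ge0_ae_eq_integral => //.
- by apply/measurable_EFinP; exact: measurable_normc.
- by apply/measurable_EFinP; exact: measurable_normc_fun.
- by move=> t _; rewrite lee_fin normc_ge0.
- by move=> t _; rewrite lee_fin normc_ge0.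
- by apply: filterS yf => t /= + _ => ->.
Qed.

End Lebesgue.

(** * Norms on [L^1] dual to bounded functions in [L^r] *)

Section DualNorms.
Context d (T : measurableType d) (R : realType).
Variable mu : {measure set T -> \bar R}.
Variables (r : R) (r1 : (1 <= r%:E)%E).
Implicit Types (y z : L1 mu) (x : Linfty mu).

Definition in_Lr x : Prop := (L0norm r%:E (x : L0 mu) < +oo)%E.
Definition normLr x : R := fine (L0norm r%:E (x : L0 mu)).

Definition test_ball (a : R) : set (Linfty mu) :=
  [set x | in_Lr x /\ `|a| * normLr x + normoo x <= 1].

(** The norm dual to [|a| * normLr x + normoo x] on the bounded functions in [L^r];
    [a = 0] gives the [L^1] norm up to a constant, and the norms tend to [0]
    pointwise as [a] grows. *)
Definition dual_norm (a : R) y : R :=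
  sup [set normc (pairing y x) | x in test_ball a].

Lemma normLr_ge0 x : 0 <= normLr x.
Proof. by rewrite fine_ge0// L0norm_ge0. Qed.

Lemma in_LrZ c x : in_Lr x -> in_Lr (c *: x) /\ normLr (c *: x) = normc c * normLr x.
Proof.
move=> xr; have h : L0norm r%:E ((c *: x : Linfty mu) : L0 mu) =
    ((normc c)%:E * L0norm r%:E (x : L0 mu))%E.
  by have := @L0normZ _ _ _ mu r%:E r1 c (x : L0 mu); apply.
split; first by rewrite /in_Lr h lte_mul_pinfty// lee_fin normc_ge0.
by rewrite /normLr h fineM// ge0_fin_numE// L0norm_ge0.
Qed.

Lemma normooZ c x : normoo (c *: x) = normc c * normoo x.
Proof.
have h : L0norm +oo%E ((c *: x : Linfty mu) : L0 mu) =
    ((normc c)%:E * L0norm +oo%E (x : L0 mu))%E.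
  have := @L0normZ _ _ _ mu +oo%E (leey 1%E) c (x : L0 mu); apply.
  by case: x.
rewrite /normoo h fineM// ge0_fin_numE ?L0norm_ge0//.
by case: x {h}.
Qed.

Lemma in_Lr0 : in_Lr 0 /\ normLr 0 = 0.
Proof.
have h : L0norm r%:E ((0 : Linfty mu) : L0 mu) = 0%E by exact: L0norm0.
by rewrite /in_Lr /normLr h.
Qed.

Lemma normoo0 : normoo (0 : Linfty mu) = 0.
Proof.
have h : L0norm +oo%E ((0 : Linfty mu) : L0 mu) = 0%E by apply: L0norm0; exact: leey.
by rewrite /normoo h.
Qed.

Lemma pairing0l x : pairing (0 : L1 mu) x = 0.
Proof.
have := pairing_linearl (-1) 0 0 x.
by rewrite scaler0 addr0 mulN1r addNr.
Qed.

Lemma pairingZr c y x : pairing y (c *: x) = c * pairing y x.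
Proof.
have p0 : pairing y 0 = 0.
  have := pairing_linearr (-1) y 0 0.
  by rewrite scaler0 addr0 mulN1r addNr.
by have := pairing_linearr c y x 0; rewrite p0 !addr0.
Qed.

Lemma test_ball0 a : test_ball a 0.
Proof. by have [? h] := in_Lr0; split; rewrite ?h ?normoo0 ?mulr0 ?add0r. Qed.

Lemma test_ball_normoo a x : test_ball a x -> normoo x <= 1.
Proof.
by move=> [_]; apply: le_trans; rewrite lerDr mulr_ge0// normLr_ge0.
Qed.

Lemma le_dual_norm a y x : test_ball a x -> normc (pairing y x) <= dual_norm a y.
Proof.
move=> ax; apply: ub_le_sup; last by exists x.
exists (2 * norm1 y) => _ [z az <-]; rewrite (le_trans (pairing_le y z).2)//.
rewrite ler_wpM2l// ler_piMr ?norm1_ge0//; exact: test_ball_normoo az.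
Qed.

Lemma dual_norm_le a y c : (forall x, test_ball a x -> normc (pairing y x) <= c) ->
  dual_norm a y <= c.
Proof.
move=> h; apply: ge_sup; last by move=> _ [x ax <-]; exact: h.
by exists (normc (pairing y 0)), 0 => //; exact: test_ball0.
Qed.

Lemma dual_norm_ge0 a y : 0 <= dual_norm a y.
Proof. exact: le_trans (normc_ge0 _) (le_dual_norm y (test_ball0 a)). Qed.

Lemma pairing_le_dual_norm a y x : in_Lr x ->
  normc (pairing y x) <= dual_norm a y * (`|a| * normLr x + normoo x).
Proof.
move=> xr; set w := _ + normoo x; rewrite -subr_le0.
have w0 : 0 <= w by rewrite addr_ge0 ?mulr_ge0 ?normLr_ge0 ?normoo_ge0.
apply: (@le0_of_le_mul_eps _ _ (dual_norm a y)) => e e0 _.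
rewrite lerBlDl -mulrDr; have we : 0 < w + e by rewrite ltr_wpDl.
have nV : normc (((w + e)^-1)%:C : R[i]) = (w + e)^-1.
  by rewrite normc_real ger0_norm// invr_ge0 ltW.
(* [w] may vanish, so [x] is scaled by slightly more than [w] *)
have bx : test_ball a (((w + e)^-1)%:C *: x).
  have [xr' n'] := in_LrZ (((w + e)^-1)%:C) xr.
  split=> //; rewrite n' normooZ nV mulrCA -mulrDr mulrC ler_pdivrMr// mul1r.
  by rewrite lerDl ltW.
have := le_dual_norm y bx; rewrite pairingZr normcM nV.
by rewrite ler_pdivrMl// mulrC.
Qed.

Lemma dual_norm_sublinear a c y z :
  dual_norm a (c *: y + z) <= normc c * dual_norm a y + dual_norm a z.
Proof.
apply: dual_norm_le => x ax; rewrite pairing_linearl (le_trans (normcD _ _))//.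
by rewrite normcM lerD ?le_dual_norm// ler_wpM2l ?normc_ge0 ?le_dual_norm.
Qed.

Lemma dual_norm0 a : dual_norm a 0 = 0.
Proof.
apply/eqP; rewrite eq_le dual_norm_ge0 andbT; apply: dual_norm_le => x _.
by rewrite pairing0l normc0.
Qed.

Lemma pairing_subl y z x : pairing (y - z) x = pairing y x - pairing z x.
Proof.
have := pairing_linearl (-1) z y x; rewrite scaleN1r mulN1r addrC => ->.
by rewrite addrC.
Qed.

(** A supremum of functionals each of which is continuous for [dual_norm 1]. *)
Lemma dual_norm_lsc a c y :
  (forall e, 0 < e -> exists2 z, dual_norm 1 (y - z) <= e & dual_norm a z <= c + e) ->
  dual_norm a y <= c.
Proof.
move=> h; apply: dual_norm_le => x ax; rewrite -subr_le0.
apply: (@le0_of_le_mul_eps _ _ (2 + normLr x)) => e e0 _.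
have [z yz zc] := h e e0; rewrite lerBlDl.
have -> : pairing y x = pairing z x + pairing (y - z) x.
  by rewrite pairing_subl addrCA subrr addr0.
rewrite (le_trans (normcD _ _))//.
have h1 := le_trans (le_dual_norm z ax) zc.
have h2 := pairing_le_dual_norm 1 (y - z) ax.1; rewrite normr1 mul1r in h2.
have w0 : 0 <= normLr x + normoo x by rewrite addr_ge0 ?normLr_ge0 ?normoo_ge0.
have h3 := ler_wpM2r w0 yz; have h4 := test_ball_normoo ax.
have h5 := normLr_ge0 x.
rewrite (le_trans (lerD h1 (le_trans h2 h3)))// -addrA lerD2l.
have -> : (2 + normLr x) * e = e + e * (normLr x + 1) by ring.
by rewrite lerD2l ler_wpM2l ?(ltW e0)// lerD2l.
Qed.

(** Operators that have an adjoint with respect to the pairing which contracts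
    both norms of the test functions contract all dual norms. *)
Lemma dual_norm_adjoint a c y z : 0 <= c ->
  (forall x, in_Lr x -> exists2 x', in_Lr x' &
     [/\ pairing z x = pairing y x', normLr x' <= c * normLr x &
         normoo x' <= c * normoo x]) ->
  dual_norm a z <= c * dual_norm a y.
Proof.
move=> c0 h; apply: dual_norm_le => x ax; have [x' xr' [-> n1 n2]] := h x ax.1.
rewrite (le_trans (pairing_le_dual_norm a y xr'))// mulrC.
rewrite ler_wpM2r ?dual_norm_ge0// (@le_trans _ _ (c * (`|a| * normLr x + normoo x)))//.
  by rewrite mulrDr lerD// mulrCA ler_wpM2l.
by rewrite -[leRHS]mulr1 ler_wpM2l//; case: ax.
Qed.

End DualNorms.

Section IntegralTools.
Context d (T : measurableType d) (R : realType).
Variable mu : {measure set T -> \bar R}.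

Lemma markov_bound (F : T -> R) (c e : R) : measurable_fun [set: T] F ->
  (forall t, 0 <= F t) -> (\int[mu]_t (F t)%:E <= c%:E)%E -> 0 < e ->
  measurable [set t | e < F t] /\ (mu [set t | (e < F t)%R] <= (c / e)%:E)%E.
Proof.
move=> mF F0 Fc e0; have mA : measurable [set t | e < F t].
  have -> : [set t | e < F t] = [set: T] `&` F @^-1` `]e, +oo[%classic.
    by rewrite setTI; apply/seteqP; split=> t /=; rewrite in_itv/= andbT.
  exact: mF.
split=> //; rewrite -(setIT [set t | e < F t]) -integral_indic//.
apply: (@le_trans _ _ (\int[mu]_t ((e^-1)%:E * (F t)%:E))%E).
  apply: ge0_le_integral => //.
  - by apply/measurable_EFinP.
  - by apply/measurable_EFinP; apply: measurable_realfun.measurable_funM.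
  - move=> t _; rewrite -EFinM lee_fin indicE.
    case: (boolP (t \in _)) => [|_]; last by rewrite mulr_ge0// invr_ge0 ltW.
    by rewrite inE /= => /ltW eF; rewrite mulrC ler_pdivlMr// mul1r.
rewrite ge0_integralZl//.
- rewrite mulrC EFinM; apply: lee_pmul => //.
  + by rewrite lee_fin invr_ge0 ltW.
  + by apply: integral_ge0 => t _; rewrite lee_fin.
- exact/measurable_EFinP.
- by move=> t _; rewrite lee_fin.
- by rewrite lee_fin invr_ge0 ltW.
Qed.

Lemma fatou_bound (F : nat -> T -> R) (G : T -> R) (c : R) :
  (forall n, measurable_fun [set: T] (F n)) -> (forall n t, 0 <= F n t) ->
  (forall t, F ^~ t @ \oo --> G t) ->
  (forall n, (\int[mu]_t (F n t)%:E <= c%:E)%E) ->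
  (\int[mu]_t (G t)%:E <= c%:E)%E.
Proof.
move=> mF F0 FG Fc.
have := @fatou _ _ _ mu setT measurableT (fun n t => (F n t)%:E).
have -> : (fun t => limn_einf (fun n => (F n t)%:E)) = (fun t => (G t)%:E).
  apply/funext => t; have h : (fun n => (F n t)%:E) @ \oo --> (G t)%:E.
    by apply: cvg_EFin; [exact: nearW|exact: FG].
  by rewrite is_cvg_limn_einfE; [exact/cvg_lim|apply/cvg_ex; exists (G t)%:E].
move=> h; apply: le_trans (h _ _) _.
- by move=> n; exact/measurable_EFinP.
- by move=> n t _; rewrite lee_fin.
rewrite limn_einf_lim; apply: lime_le; first exact: is_cvg_einfs.
apply: nearW => n; apply: le_trans (Fc n).
by apply: ereal_inf_lbound; exists n => /=.
Qed.

End IntegralTools.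

Section TestFunctions.
Context d (T : measurableType d) (R : realType).
Variable mu : {measure set T -> \bar R}.
Variables (r : R) (r1 : (1 <= r%:E)%E).
Implicit Types (y z : L1 mu) (x : Linfty mu).

Let r_ge1 : 1 <= r. Proof. by rewrite -lee_fin. Qed.
Let r_gt0 : 0 < r. Proof. exact: lt_le_trans ltr01 r_ge1. Qed.

Lemma measurable_powR_normc (f : T -> R[i]) (s : R) : f \in @cmfun _ T R ->
  measurable_fun [set: T] (fun t => (normc (f t) / s) `^ r).
Proof.
move=> mf; apply: (@measurableT_comp _ _ _ _ _ _ (@powR R ^~ r)) => //.
apply: measurable_realfun.measurable_funM => //; exact: measurable_normc_fun.
Qed.

Lemma Linfty_exists (f : T -> R[i]) (c : R) : f \in @cmfun _ T R -> 0 <= c ->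
  (\forall t \ae mu, normc (f t) <= c) ->
  exists x, (x : T -> R[i]) = f %[ae mu] /\ normoo x <= c.
Proof.
move=> mf c0 fc; have le_c := (Lnormc_ooP mu f c0).2 fc.
have foo : (Lnormc mu +oo%E (Build_CMfun mf) < +oo)%E by rewrite (le_lt_trans le_c)// ltry.
exists (Lp_of (leey 1%E) foo); have h := Lp_ofE (leey 1%E) foo; split=> //.
apply: normoo_le => //; apply: filterS2 h fc => t /= ht ft.
by rewrite ht.
Qed.

Lemma L1_exists (f : T -> R[i]) (c : R) : f \in @cmfun _ T R ->
  (\int[mu]_t (normc (f t))%:E <= c%:E)%E ->
  exists y, (y : T -> R[i]) = f %[ae mu] /\ norm1 y <= c.
Proof.
move=> mf fc; have foo : (Lnormc mu 1%E (Build_CMfun mf) < +oo)%E.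
  rewrite /Lnormc Lnorm1 (le_lt_trans _ (ltry c))// (le_trans _ fc)//.
  rewrite le_eqVlt; apply/orP; left; apply/eqP; apply: eq_integral => t _ /=.
  by rewrite ger0_norm// normc_ge0.
exists (Lp_of (lexx 1%E) foo); have h := Lp_ofE (lexx 1%E) foo; split=> //.
exact: norm1_le h mf fc.
Qed.

Lemma in_Lr_ae x (f : T -> R[i]) m : (x : T -> R[i]) = f %[ae mu] -> f \in @cmfun _ T R ->
  0 <= m -> (\int[mu]_t (normc (f t) `^ r)%:E <= m%:E)%E ->
  in_Lr r x /\ normLr r x <= m `^ r^-1.
Proof.
move=> xf mf m0 fm.
have le_m : (L0norm r%:E (x : L0 mu) <= (m `^ r^-1)%:E)%E.
  rewrite /L0norm (ae_eq_Lnormc (g := Build_CMfun mf))// /Lnormc unlock /=.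
  have -> : (m `^ r^-1)%:E = ((m%:E) `^ r^-1)%E by rewrite poweR_EFin.
  have rV : 0 <= r^-1 by rewrite invr_ge0 ltW.
  apply: (gt0_ler_poweR rV).
  - by rewrite in_itv/= integral_ge0//= ?leey// => t _; rewrite poweR_ge0.
  - by rewrite in_itv/= leey lee_fin m0.
  apply: le_trans fm; rewrite le_eqVlt; apply/orP; left; apply/eqP.
  by apply: eq_integral => t _ /=; rewrite ger0_norm// normc_ge0.
have foo : in_Lr r x by rewrite /in_Lr (le_lt_trans le_m)// ltry.
by split=> //; rewrite -lee_fin /normLr fineK// ge0_fin_numE// L0norm_ge0.
Qed.

Lemma integral_Lr x s : in_Lr r x -> 0 < s ->
  (\int[mu]_t ((normc (x t) / s) `^ r)%:E = ((normLr r x / s) `^ r)%:E)%E.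
Proof.
move=> xr s0; have s'0 : 0 <= s^-1 by rewrite invr_ge0 ltW.
under eq_integral do rewrite powRM ?normc_ge0// EFinM.
rewrite ge0_integralZr//; last 3 first.
- apply/measurable_EFinP.
  have := measurable_powR_normc 1 (CMfunP (x : L0 mu)).
  by under eq_fun do rewrite divr1.
- by move=> t _; rewrite lee_fin powR_ge0.
- by rewrite lee_fin powR_ge0.
rewrite powRM ?normLr_ge0// EFinM; congr (_ * _)%E.
have := powR_Lnorm mu (EFin \o (fun t => normc (x t))) (lt0r_neq0 r_gt0).
rewrite -[Lnorm _ _ _]/(L0norm r%:E (x : L0 mu)).
have -> : L0norm r%:E (x : L0 mu) = (normLr r x)%:E.
  by rewrite /normLr fineK// ge0_fin_numE// L0norm_ge0.
rewrite poweR_EFin => ->; apply: eq_integral => t _ /=.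
by rewrite ger0_norm// normc_ge0.
Qed.

(** Either [a <= s], or [a / s] is at least [1] and then at most its [r]-th power. Applied to
    [a = |x t|] this plays the role of a Hoelder inequality. *)
Lemma le_scaled_powR (a s : R) : 0 <= a -> 0 < s -> a <= s + s * (a / s) `^ r.
Proof.
move=> a0 s0; have [as_|sa] := leP a s.
  by rewrite (le_trans as_)// lerDl mulr_ge0 ?powR_ge0// ltW.
have h : a / s <= (a / s) `^ r.
  rewrite -[leLHS]powRr1 ?divr_ge0 ?(ltW s0)//; apply: ler_powR => //.
  by rewrite ler_pdivlMr// mul1r ltW.
have : s * (a / s) <= s * (a / s) `^ r by rewrite ler_pM2l.
by rewrite mulrC divfK ?gt_eqF// => /le_trans; apply; rewrite lerDr ltW.
Qed.

Definition cutoff (A : set T) (f : T -> R[i]) : T -> R[i] := fun t => f t * (\1_A t)%:C.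

Lemma cutoff_cmfun A f : measurable A -> f \in @cmfun _ T R -> cutoff A f \in @cmfun _ T R.
Proof.
by move=> mA mf; apply: cmfun_mul => //; apply: cmfun_real; exact: measurable_indic.
Qed.

Lemma normc_cutoff A f t : normc (cutoff A f t) = normc (f t) * \1_A t.
Proof. by rewrite normcM normc_real ger0_norm// indicE; case: (_ \in _). Qed.

Lemma normc_cutoff_le A f t : normc (cutoff A f t) <= normc (f t).
Proof. by rewrite normc_cutoff ler_piMr ?normc_ge0// indicE; case: (_ \in _). Qed.

(** Cutting a test function off to a set of small measure makes its [L^r] norm
    small. *)
Lemma cutoff_exists A x m : measurable A -> normoo x <= 1 -> (mu A <= m%:E)%E ->
  exists2 x' : Linfty mu, (x' : T -> R[i]) = cutoff A x %[ae mu] &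
    [/\ in_Lr r x', normoo x' <= 1 & normLr r x' <= m `^ r^-1].
Proof.
move=> mA x1 Am; have mc := cutoff_cmfun mA (CMfunP (x : L0 mu)).
have m0 : 0 <= m by rewrite -lee_fin (le_trans _ Am).
have b1 : \forall t \ae mu, normc (x t) <= 1.
  by apply: filterS (normoo_ae x) => t /le_trans; apply.
have b2 : \forall t \ae mu, normc (cutoff A x t) <= 1.
  by apply: filterS b1 => t; apply: le_trans; exact: normc_cutoff_le.
have [x' [x'E x'1]] := Linfty_exists mc ler01 b2.
exists x' => //.
have [] := @in_Lr_ae x' _ m x'E mc m0; last by [].
apply: le_trans Am; have <- : (\int[mu]_t (\1_A t)%:E = mu A)%E.
  by rewrite integral_indic// setIT.
apply: ae_ge0_le_integral => //.
- by move=> t _; rewrite lee_fin powR_ge0.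
- have mp : measurable_fun [set: T] (fun t => normc (cutoff A x t) `^ r).
    by have := measurable_powR_normc 1 mc; under eq_fun do rewrite divr1.
  exact/measurable_EFinP.
- by apply/measurable_EFinP; exact: measurable_indic.
apply: filterS b1 => t xt _; rewrite lee_fin normc_cutoff indicE.
case: (t \in A); last by rewrite mulr0 powR0// gt_eqF.
rewrite mulr1; apply: (@le_trans _ _ (1 `^ r)); last by rewrite powR1.
apply: ge0_ler_powR => //.
- exact: ltW.
- by rewrite nnegrE normc_ge0.
- by rewrite nnegrE.
Qed.

Lemma pairing_ae y x (f g : T -> R[i]) : (y : T -> R[i]) = f %[ae mu] ->
  (x : T -> R[i]) = g %[ae mu] -> f \in @cmfun _ T R -> g \in @cmfun _ T R ->
  pairing y x = cintegral mu (fun t => f t * g t).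
Proof.
move=> yf xg mf mg; apply: cintegral_ae; [exact: cmfun_pair|exact: cmfun_mul|].
by apply: filterS2 yf xg => t /= hy hx _; rewrite hy// hx.
Qed.

(** The set where [Re y > n.+1^-1] has finite measure, so its indicator function is a
    test function, and pairing it with [y] gives the integral of [Re y] over this set; Fatou's
    lemma removes the restriction to the set. *)
Lemma integral_Re_pos_le y :
  (\int[mu]_t (Num.max (complex.Re (y t)) 0)%:E <= (dual_norm r 0 y)%:E)%E.
Proof.
pose A n := [set t | n.+1%:R^-1 < complex.Re (y t)].
have [mRe mIm] := cmfunP _ (CMfunP (y : L0 mu)).
have mpos : measurable_fun [set: T] (fun t => Num.max (complex.Re (y t)) 0).
  exact: measurable_realfun.measurable_maxr.
have pos_le : (\int[mu]_t (Num.max (complex.Re (y t)) 0)%:E <= (norm1 y)%:E)%E.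
  rewrite -norm1_integral; apply: ge0_le_integral => //.
  - by move=> t _; rewrite lee_fin le_max lexx orbT.
  - exact/measurable_EFinP.
  - by apply/measurable_EFinP; exact: measurable_normc.
  - move=> t _; rewrite lee_fin ge_max normc_ge0 andbT.
    by rewrite (le_trans (ler_norm _))// normRe_le.
have n0 n : (0 : R) < n.+1%:R^-1 by rewrite invr_gt0 ltr0n.
have AE n : A n = [set t | n.+1%:R^-1 < Num.max (complex.Re (y t)) 0].
  apply/seteqP; split=> t /=; rewrite /A/= lt_max; first by move=> ->.
  by rewrite (lt_gtF (n0 n)) orbF.
have mA n : measurable (A n) /\ (mu (A n) <= (norm1 y / n.+1%:R^-1)%:E)%E.
  rewrite AE; apply: markov_bound => // t; by rewrite le_max lexx orbT.
apply: (@fatou_bound _ _ _ _ (fun n t => complex.Re (y t) * \1_(A n) t)).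
- move=> n; apply: measurable_realfun.measurable_funM => //.
  by apply: measurable_indic; exact: (mA n).1.
- move=> n t; rewrite indicE; case: (boolP (t \in A n)); last by rewrite mulr0.
  by rewrite inE /A/= mulr1 => /(lt_trans (n0 n))/ltW.
- move=> t; have [yt|yt] := leP (complex.Re (y t)) 0.
    rewrite (_ : (fun n => _) = cst 0); first exact: cvg_cst.
    apply/funext => n /=; rewrite indicE memNset ?mulr0// /A /= => h.
    by have := lt_trans (n0 n) h; rewrite ltNge yt.
  apply: (@cvg_trans _ (cst (complex.Re (y t)) @ \oo)); last exact: cvg_cst.
  apply: near_eq_cvg; exists (Num.bound (complex.Re (y t))^-1) => // n /= Nn.
  rewrite indicE mem_set ?mulr1// /A/= invf_plt ?posrE//.
  apply: (lt_le_trans (archi_boundP _)); first by rewrite invr_ge0 ltW.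
  by rewrite ler_nat (leq_trans Nn).
move=> n; have mA1 := (mA n).1.
have m1 : (fun=> 1) \in @cmfun _ T R by apply: (cmfun_real (F := cst 1)).
have m1A := cutoff_cmfun mA1 m1.
have one1 : \forall t \ae mu, normc ((fun=> 1 : R[i]) t : R[i]) <= (1 : R).
  by apply: aeW => t; rewrite normc1.
have [e [eE e1]] := Linfty_exists m1 ler01 one1.
have [x xE [xr x1 _]] := cutoff_exists mA1 e1 (mA n).2.
have xE' : (x : T -> R[i]) = cutoff (A n) (fun=> 1) %[ae mu].
  by apply: filterS2 xE eE => t /= h1 h2 _; rewrite h1// /cutoff h2.
have bx : test_ball r 0 x by split=> //; rewrite normr0 mul0r add0r.
have yy : (y : T -> R[i]) = y %[ae mu] by apply: aeW.
have pE := pairing_ae yy xE' (CMfunP _) m1A.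
have le_x := le_dual_norm y bx; rewrite pE in le_x.
have reE : complex.Re (cintegral mu (fun t => y t * cutoff (A n) (fun=> 1) t)) =
    \int[mu]_t (complex.Re (y t) * \1_(A n) t).
  apply: eq_Rintegral => t _; rewrite /cutoff mul1r.
  by case: (y t) => a b /=; rewrite mulr0 subr0.
have := le_trans (normRe_le _) le_x; rewrite reE => /(le_trans (ler_norm _)).
rewrite -lee_fin /Rintegral fineK//.
rewrite ge0_fin_numE; last first.
  apply: integral_ge0 => t _; rewrite lee_fin indicE.
  case: (boolP (t \in A n)); last by rewrite mulr0.
  by rewrite inE /A/= mulr1 => /(lt_trans (n0 n))/ltW.
apply: le_lt_trans (ltry (norm1 y)); apply: le_trans pos_le.
apply: ge0_le_integral => //.
- move=> t _; rewrite lee_fin indicE.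
  case: (boolP (t \in A n)); last by rewrite mulr0.
  by rewrite inE /A/= mulr1 => /(lt_trans (n0 n))/ltW.
- have mAy : measurable_fun [set: T] (fun t => complex.Re (y t) * \1_(A n) t).
    by apply: measurable_realfun.measurable_funM => //; apply: measurable_indic.
  exact/measurable_EFinP.
- exact/measurable_EFinP.
- move=> t _; rewrite lee_fin indicE; case: (t \in A n).
    by rewrite mulr1 le_max lexx.
  by rewrite mulr0 le_max lexx orbT.
Qed.

(** [|y|] is at most the sum of the positive parts of the real parts of [y], [-y], [i y] and
    [- i y]. *)
Lemma norm1_le_dual_norm y : norm1 y <= 4 * dual_norm r 0 y.
Proof.
pose P c t := Num.max (complex.Re (c * y t)) 0.
have mP c : measurable_fun [set: T] (P c).
  apply: measurable_realfun.measurable_maxr => //.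
  by have [] := cmfunP _ (CMfunP (c *: (y : CMfun T R))).
have P0 c t : 0 <= P c t by rewrite le_max lexx orbT.
have PE c : normc c = 1 -> (\int[mu]_t (P c t)%:E <= (dual_norm r 0 y)%:E)%E.
  move=> c1; have := integral_Re_pos_le (c *: y).
  have le_y : dual_norm r 0 (c *: y) <= dual_norm r 0 y.
    have := dual_norm_sublinear r1 0 c y 0.
    by rewrite c1 mul1r !addr0 (dual_norm0 mu r1) addr0.
  rewrite -lee_fin in le_y; move=> /le_trans/(_ le_y); apply: le_trans.
  rewrite le_eqVlt; apply/orP; left; apply/eqP; apply: ge0_ae_eq_integral => //.
  - exact/measurable_EFinP.
  - apply/measurable_EFinP; apply: measurable_realfun.measurable_maxr => //.
    by have [] := cmfunP _ (CMfunP ((c *: y : L1 mu) : CMfun T R)).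
  - by move=> t _; rewrite lee_fin.
  - by move=> t _; rewrite lee_fin le_max lexx orbT.
  - have := L0_reprZ c (y : L0 mu); apply: filterS => t /= h _.
    by rewrite /P h.
have N1 : normc (-1 : R[i]) = 1 by rewrite normcN normc1.
have Ni : normc ('i : R[i]) = 1 by rewrite /= expr0n add0r expr1n sqrtr1.
have NNi : normc (- 'i : R[i]) = 1 by rewrite normcN.
rewrite -lee_fin -norm1_integral.
apply: (@le_trans _ _ (\int[mu]_t ((P 1 t)%:E + (P (-1) t)%:E +
   ((P 'i t)%:E + (P (- 'i) t)%:E)))%E).
  apply: ge0_le_integral => //.
  - by move=> t _; rewrite lee_fin normc_ge0.
  - by apply/measurable_EFinP; exact: measurable_normc.
  - by apply/measurable_EFinP; do !apply: measurable_realfun.measurable_funD.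
  move=> t _; rewrite -!EFinD lee_fin; apply: le_trans (normc_le_ReIm _) _.
  have absE (a : R) : `|a| = Num.max a 0 + Num.max (- a) 0.
    have [a0|a0] := leP 0 a.
      by rewrite ger0_norm// (max_idPr _) ?oppr_le0// addr0.
    by rewrite ltr0_norm// (max_idPl _) ?oppr_ge0 ?ltW// add0r.
  rewrite !absE /P; case: (y t) => a b /=.
  rewrite !(mul0r, mul1r, sub0r, subr0, mulN1r, mulNr, oppr0, opprK, addr0).
  by rewrite [X in _ <= _ + X]addrC.
rewrite ge0_integralD//; last 4 first.
- by move=> t _; rewrite -EFinD lee_fin addr_ge0.
- by apply/measurable_EFinP; apply: measurable_realfun.measurable_funD.
- by move=> t _; rewrite -EFinD lee_fin addr_ge0.
- by apply/measurable_EFinP; apply: measurable_realfun.measurable_funD.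
rewrite !ge0_integralD//; do ?[exact/measurable_EFinP|by move=> t _; rewrite lee_fin].
have -> : (4 * dual_norm r 0 y) = (dual_norm r 0 y + dual_norm r 0 y) +
  (dual_norm r 0 y + dual_norm r 0 y) by ring.
by rewrite !EFinD; do ![apply: leeD|apply: PE]; rewrite ?normc1.
Qed.

End TestFunctions.

Section Modulus.
Context d (T : measurableType d) (R : realType).
Variable mu : {measure set T -> \bar R}.
Variables (r : R) (r1 : (1 <= r%:E)%E).
Implicit Types (y z : L1 mu) (x : Linfty mu).

Lemma integral_leD (F G : T -> R) a b :
  measurable_fun [set: T] F -> measurable_fun [set: T] G ->
  (forall t, 0 <= F t) -> (forall t, 0 <= G t) ->
  (\int[mu]_t (F t)%:E <= a%:E)%E -> (\int[mu]_t (G t)%:E <= b%:E)%E ->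
  (\int[mu]_t (F t + G t)%:E <= (a + b)%:E)%E.
Proof.
move=> mF mG F0 G0 Fa Gb; under eq_integral do rewrite EFinD.
rewrite ge0_integralD//; first by rewrite EFinD; exact: leeD.
- by move=> t _; rewrite lee_fin.
- exact/measurable_EFinP.
- by move=> t _; rewrite lee_fin.
- exact/measurable_EFinP.
Qed.

Lemma integral_leZ (F : T -> R) k a : measurable_fun [set: T] F ->
  (forall t, 0 <= F t) -> 0 <= k -> (\int[mu]_t (F t)%:E <= a%:E)%E ->
  (\int[mu]_t (k * F t)%:E <= (k * a)%:E)%E.
Proof.
move=> mF F0 k0 Fa; under eq_integral do rewrite EFinM.
rewrite ge0_integralZl//.
- by rewrite EFinM; apply: lee_wpmul2l; rewrite ?lee_fin.
- exact/measurable_EFinP.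
- by move=> t _; rewrite lee_fin.
Qed.

Lemma indic_ge0 (A : set T) t : 0 <= \1_A t :> R.
Proof. by rewrite indicE. Qed.

Lemma indic_le1 (A : set T) t : \1_A t <= 1 :> R.
Proof. by rewrite indicE; case: (t \in A). Qed.

Lemma integral_tail_small (F : T -> R) (c e : R) : measurable_fun [set: T] F ->
  (forall t, 0 <= F t) -> (\int[mu]_t (F t)%:E <= c%:E)%E -> 0 < e ->
  exists n, (\int[mu]_t (F t * \1_(~` [set t | n.+1%:R^-1 < F t <= n.+1%:R]) t)%:E <= e%:E)%E.
Proof.
move=> mF F0 Fc e0; pose G n := [set t | n.+1%:R^-1 < F t <= n.+1%:R].
have mG n : measurable (~` G n).
  apply: measurableC; have -> : G n = [set: T] `&` F @^-1` `]n.+1%:R^-1, n.+1%:R]%classic.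
    by rewrite setTI; apply/seteqP; split=> t /=; rewrite in_itv.
  exact: mF.
have mFG n : measurable_fun [set: T] (fun t => F t * \1_(~` G n) t).
  by apply: measurable_realfun.measurable_funM => //; exact: measurable_indic.
have iF : mu.-integrable [set: T] (EFin \o F).
  apply/integrableP; split; first exact/measurable_EFinP.
  rewrite (le_lt_trans _ (ltry c))// (le_trans _ Fc)// le_eqVlt; apply/orP; left.
  by apply/eqP; apply: eq_integral => t _ /=; rewrite ger0_norm.
have [] := @dominated_convergence _ _ _ mu setT measurableT
  (fun n t => (F t * \1_(~` G n) t)%:E) (cst 0%E) (EFin \o F).
- by move=> n; exact/measurable_EFinP.
- exact: measurable_cst.
- apply: aeW => t _; apply: cvg_EFin; first exact: nearW.
  apply: (@cvg_trans _ (cst (0 : R) @ \oo)); last exact: cvg_cst.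
  apply: near_eq_cvg; have [Ft|] := ltP 0 (F t); last first.
    move=> Ft; have Ft0 : F t = 0 by apply/eqP; rewrite eq_le Ft F0.
    by apply: nearW => n /=; rewrite Ft0 mul0r.
  exists (maxn (Num.bound (F t)^-1) (Num.bound (F t))) => // n /=.
  rewrite geq_max => /andP[n1 n2].
  rewrite indicE memNset ?mulr0//= => h; apply: h; rewrite /G/=; apply/andP; split.
    rewrite invf_plt ?posrE// (lt_le_trans (archi_boundP _)) ?invr_ge0 ?(ltW Ft)//.
    by rewrite ler_nat (leq_trans n1).
  by rewrite ltW// (lt_le_trans (archi_boundP _)) ?(ltW Ft)// ler_nat (leq_trans n2).
- exact: iF.
- apply: aeW => t n _ /=; rewrite ger0_norm ?mulr_ge0 ?indic_ge0//.
  by rewrite lee_fin ler_piMr// indicE; case: (_ \in _).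
move=> _ _; rewrite integral0 => /fine_cvgP[fin].
move=> /cvgrPdist_le/(_ _ e0)[N _ hN]; have [M _ hM] := fin.
exists (maxn N M); have := hN (maxn N M) (leq_maxl _ _); have := hM (maxn N M) (leq_maxr _ _).
rewrite /= => fin_num; rewrite sub0r normrN => /(le_trans (ler_norm _)).
by rewrite -lee_fin fineK.
Qed.

(** Off a set of finite measure where [y] is bounded, [y] is small in [L^1]; on
    that set it pairs with test functions through their [L^r] norm. *)
Lemma dual_norm_small y e : 0 < e -> exists a, dual_norm r a y <= e.
Proof.
move=> e0; have e40 : 0 < e / 4 by rewrite divr_gt0.
have r0 : 0 < r by apply: lt_le_trans ltr01 _; rewrite -lee_fin.
have my := measurable_normc (y : L0 mu).
have yint : (\int[mu]_t (normc (y t))%:E <= (norm1 y)%:E)%E by rewrite norm1_integral.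
have [n hn] := integral_tail_small my (fun t => normc_ge0 _) yint e40.
set G := [set t | _] in hn; pose N : R := n.+1%:R.
have N0 : 0 < N by rewrite ltr0n.
have NV0 : 0 < N^-1 by rewrite invr_gt0.
have mG : measurable G.
  have -> : G = [set: T] `&` (fun t => normc (y t)) @^-1` `]N^-1, N]%classic.
    by rewrite setTI; apply/seteqP; split=> t /=; rewrite in_itv.
  exact: my.
have [mA muA] := markov_bound my (fun t => normc_ge0 _) yint NV0.
pose m := norm1 y / N^-1.
have muG : (\int[mu]_t (\1_G t)%:E <= m%:E)%E.
  rewrite integral_indic// setIT (le_trans _ muA)// le_measure ?inE//.
  by move=> t /andP[].
have m0 : 0 <= m by rewrite divr_ge0 ?norm1_ge0// ltW.
have nm : 0 < 4 * (N * (m + 1)) by rewrite !mulr_gt0// ltr_wpDl.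
(* with this scale the two terms on [G] add up to [e / 4] *)
pose s := e / (4 * (N * (m + 1))).
have s0 : 0 < s by rewrite divr_gt0.
exists s^-1; apply: (dual_norm_le r1) => x [xr]; rewrite ger0_norm ?invr_ge0 ?(ltW s0)// => bx.
have xs : normLr r x / s <= 1.
  by rewrite mulrC (le_trans _ bx)// lerDl normoo_ge0.
have x1 : normoo x <= 1.
  by rewrite (le_trans _ bx)// lerDr mulr_ge0 ?normLr_ge0// invr_ge0 ltW.
have mp := measurable_powR_normc r s (CMfunP (x : L0 mu)).
have pint : (\int[mu]_t ((normc (x t) / s) `^ r)%:E <= 1%:E)%E.
  rewrite (integral_Lr r1)// lee_fin; apply: (@le_trans _ _ (1 `^ r)); last by rewrite powR1.
  apply: ge0_ler_powR => //; [exact: ltW| |by rewrite nnegrE].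
  by rewrite nnegrE divr_ge0 ?normLr_ge0 ?(ltW s0).
pose D t := normc (y t) * \1_(~` G) t + N * (s * \1_G t + s * (normc (x t) / s) `^ r).
have mi : measurable_fun [set: T] (\1_G : T -> R) by exact: measurable_indic.
have mi' : measurable_fun [set: T] (\1_(~` G) : T -> R).
  by apply: measurable_indic; exact: measurableC.
have m1 : measurable_fun [set: T] (fun t => normc (y t) * \1_(~` G) t).
  exact: measurable_realfun.measurable_funM.
have m2 : measurable_fun [set: T] (fun t => s * \1_G t).
  exact: measurable_realfun.measurable_funM.
have m3 : measurable_fun [set: T] (fun t => s * (normc (x t) / s) `^ r).
  exact: measurable_realfun.measurable_funM.
have m4 : measurable_fun [set: T] (fun t => s * \1_G t + s * (normc (x t) / s) `^ r).
  exact: measurable_realfun.measurable_funD.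
have m5 : measurable_fun [set: T] (fun t => N * (s * \1_G t + s * (normc (x t) / s) `^ r)).
  exact: measurable_realfun.measurable_funM.
have p1 t : 0 <= normc (y t) * \1_(~` G) t by rewrite mulr_ge0 ?normc_ge0 ?indic_ge0.
have p2 t : 0 <= s * \1_G t by rewrite mulr_ge0 ?indic_ge0// ltW.
have p3 t : 0 <= s * (normc (x t) / s) `^ r by rewrite mulr_ge0 ?powR_ge0// ltW.
have p4 t : 0 <= s * \1_G t + s * (normc (x t) / s) `^ r by rewrite addr_ge0.
have p5 t : 0 <= N * (s * \1_G t + s * (normc (x t) / s) `^ r) by rewrite mulr_ge0// ltW.
have le_D : \forall t \ae mu, normc (y t * x t) <= D t.
  apply: filterS (normoo_ae x) => t /le_trans/(_ x1) xt.
  rewrite normcM /D; have [tG|tG] := pselect (G t).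
    rewrite !indicE (mem_set tG) memNset; last by apply.
    rewrite mulr0 add0r mulr1; move/andP : tG => [_ yN].
    by rewrite ler_pM ?normc_ge0// (le_scaled_powR r1)// normc_ge0.
  rewrite (indicE _ (~` G)) mem_set// mulr1; apply: (@le_trans _ _ (normc (y t))).
    by rewrite ler_piMr ?normc_ge0.
  by rewrite lerDl.
have [_ le_e] := cintegral_le (cmfun_pair y x) (measurable_realfun.measurable_funD m1 m5)
  (fun t => addr_ge0 (p1 t) (p5 t))
  (integral_leD m1 m5 p1 p5 hn (integral_leZ m4 p4 (ltW N0)
    (integral_leD m2 m3 p2 p3 (integral_leZ mi (indic_ge0 G) (ltW s0) muG)
      (integral_leZ mp (fun t => powR_ge0 _ _) (ltW s0) pint))))
  le_D.
apply: le_trans le_e _.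
have -> : N * (s * m + s * 1) = e / 4.
  by rewrite /s; field; rewrite !gt_eqF// ltr_wpDl.
by rewrite (_ : 2 * (e / 4 + e / 4) = e)//; field.
Qed.

End Modulus.

(** * Convex compactness in [L^1] *)

Section Gap.
Context {R : realType}.
Implicit Types (a b : R[i]).

(** The strictly convex integrand: the Euclidean norm of [(1, a)], less [1]. *)
Definition bracket (a : R[i]) : R := Num.sqrt (1 + normc a ^+ 2) - 1.

Definition gap a b : R := bracket a + bracket b - 2 * bracket (2^-1 * (a + b)).

Lemma normc2 a : normc a ^+ 2 = complex.Re a ^+ 2 + complex.Im a ^+ 2.
Proof. by case: a => p q /=; rewrite sqr_sqrtr// addr_ge0 ?sqr_ge0. Qed.

Lemma bracket_ge0 a : 0 <= bracket a.
Proof.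
rewrite /bracket subr_ge0 -[leLHS]sqrtr1 ler_wsqrtr// lerDl; exact: sqr_ge0.
Qed.

Lemma bracket_le a : bracket a <= normc a.
Proof.
have a0 := normc_ge0 a; rewrite /bracket lerBlDr -[leRHS]ger0_norm; last by lra.
rewrite -sqrtr_sqr ler_wsqrtr//; nra.
Qed.

(** With [P], [Q] and [S] the norms of [(1, a)], [(1, b)] and of their sum, the parallelogram
    identity gives [(P + Q)^2 - S^2 = |a - b|^2 - (P - Q)^2], and [P - Q] is smaller than
    [|a - b|] by a factor that depends on [k]. *)
Lemma gap_lower a b k : 0 < k -> normc a <= k -> normc b <= k ->
  normc (a - b) ^+ 2 <= 4 * (1 + k) * (1 + k ^+ 2) * gap a b.
Proof.
move=> k0 ak bk; set D := normc (a - b) ^+ 2.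
have A0 := normc_ge0 a; have B0 := normc_ge0 b.
set A := normc a in ak A0; set B := normc b in bk B0.
set P := Num.sqrt (1 + A ^+ 2); set Q := Num.sqrt (1 + B ^+ 2).
have P2 : P ^+ 2 = 1 + A ^+ 2 by rewrite sqr_sqrtr// addr_ge0 ?sqr_ge0.
have Q2 : Q ^+ 2 = 1 + B ^+ 2 by rewrite sqr_sqrtr// addr_ge0 ?sqr_ge0.
have P0 : 1 <= P by rewrite -[leLHS]sqrtr1 ler_wsqrtr// lerDl sqr_ge0.
have Q0 : 1 <= Q by rewrite -[leLHS]sqrtr1 ler_wsqrtr// lerDl sqr_ge0.
set M := Num.sqrt (1 + normc (2^-1 * (a + b)) ^+ 2); pose S := 2 * M.
have S2 : S ^+ 2 = 2 * P ^+ 2 + 2 * Q ^+ 2 - D.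
  rewrite exprMn sqr_sqrtr; last by rewrite addr_ge0 ?sqr_ge0.
  rewrite P2 Q2 /D /A /B normcM normc_half exprMn !normc2.
  by case: a {A ak A0 P P2 P0 M S D} => p q; case: b {B bk B0 Q Q2 Q0} => u v /=; field.
have S0 : 0 <= S by rewrite mulr_ge0 ?sqrtr_ge0.
have gE : gap a b = P + Q - S by rewrite /gap /bracket -/A -/B -/P -/Q -/M /S; ring.
have dAB : (A - B) ^+ 2 <= D.
  have h : `|A - B| <= normc (a - b).
    rewrite ler_norml; apply/andP; split.
      rewrite lerNl opprB lerBlDr -/B; have := normcD (b - a) a.
      by rewrite subrK -(opprB a b) normcN.
    by rewrite lerBlDr; have := normcD (a - b) b; rewrite subrK.
  by rewrite -real_normK ?num_real// ler_pXn2r ?nnegrE ?normc_ge0.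
have D0 : 0 <= D by exact: sqr_ge0.
have PQ : (P - Q) ^+ 2 * (1 + k ^+ 2) <= D * k ^+ 2.
  have e1 : (P - Q) ^+ 2 * (P + Q) ^+ 2 = (A - B) ^+ 2 * (A + B) ^+ 2.
    by rewrite -!exprMn -!subr_sqr P2 Q2; congr (_ ^+ 2); ring.
  have kP : (A + B) ^+ 2 * (1 + k ^+ 2) <= k ^+ 2 * (P + Q) ^+ 2.
    have AP : A ^+ 2 * (1 + k ^+ 2) <= k ^+ 2 * P ^+ 2 by rewrite P2; nra.
    have BQ : B ^+ 2 * (1 + k ^+ 2) <= k ^+ 2 * Q ^+ 2 by rewrite Q2; nra.
    have AB : A * B * (1 + k ^+ 2) <= k ^+ 2 * (P * Q).
      rewrite -(@ler_pXn2r _ 2)// ?nnegrE ?mulr_ge0 ?addr_ge0 ?sqr_ge0 ?ler01 ?(ltW k0)//; try lra.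
      have -> : (A * B * (1 + k ^+ 2)) ^+ 2 =
        (A ^+ 2 * (1 + k ^+ 2)) * (B ^+ 2 * (1 + k ^+ 2)) by ring.
      have -> : (k ^+ 2 * (P * Q)) ^+ 2 = (k ^+ 2 * P ^+ 2) * (k ^+ 2 * Q ^+ 2) by ring.
      by rewrite ler_pM// mulr_ge0 ?sqr_ge0// addr_ge0 ?sqr_ge0.
    have -> : (A + B) ^+ 2 * (1 + k ^+ 2) = A ^+ 2 * (1 + k ^+ 2) +
      B ^+ 2 * (1 + k ^+ 2) + 2 * (A * B * (1 + k ^+ 2)) by ring.
    have -> : k ^+ 2 * (P + Q) ^+ 2 = k ^+ 2 * P ^+ 2 + k ^+ 2 * Q ^+ 2 +
      2 * (k ^+ 2 * (P * Q)) by ring.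
    by rewrite lerD ?lerD// ler_pM2l.
  have PQ0 : 0 < (P + Q) ^+ 2 by rewrite exprn_gt0//; lra.
  rewrite -(ler_pM2r PQ0) mulrAC e1 -[leRHS]mulrA -[leLHS]mulrA.
  by rewrite ler_pM ?sqr_ge0 ?mulr_ge0 ?sqr_ge0// addr_ge0// sqr_ge0.
have Pk : P <= 1 + k by rewrite -(@ler_pXn2r _ 2)// ?nnegrE ?P2; nra.
have Qk : Q <= 1 + k by rewrite -(@ler_pXn2r _ 2)// ?nnegrE ?Q2; nra.
have DS : D <= (1 + k ^+ 2) * ((P + Q - S) * (P + Q + S)).
  have -> : (P + Q - S) * (P + Q + S) = D - (P - Q) ^+ 2.
    by rewrite -subr_sqr S2; ring.
  move: PQ; lra.
have k2 : 0 < 1 + k ^+ 2 by rewrite ltr_wpDr ?sqr_ge0.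
have SPQ : S <= P + Q.
  have : 0 <= (P + Q - S) * (P + Q + S).
    by rewrite -(pmulr_rge0 _ k2) (le_trans D0 DS).
  by rewrite pmulr_lge0 ?subr_ge0//; lra.
apply: le_trans DS _; rewrite gE.
have -> : 4 * (1 + k) * (1 + k ^+ 2) * (P + Q - S) =
  (1 + k ^+ 2) * ((P + Q - S) * (4 * (1 + k))) by ring.
rewrite ler_pM2l// ler_wpM2l ?subr_ge0//; lra.
Qed.

Lemma gap_ge0 a b : 0 <= gap a b.
Proof.
pose k := 1 + normc a + normc b.
have a0 := normc_ge0 a; have b0 := normc_ge0 b.
have k0 : 0 < k by rewrite /k; lra.
have := @gap_lower a b k k0 ltac:(rewrite /k; lra) ltac:(rewrite /k; lra).
move=> /(le_trans (sqr_ge0 _)); rewrite pmulr_rge0//.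
by rewrite !mulr_gt0 ?ltr_wpDr ?sqr_ge0// ltW.
Qed.

(** If [a] and [b] differ by more than [e], either one of them exceeds [k] or the gap is
    bounded below. *)
Lemma gap_indicator a b (k e : R) : 0 < k -> 0 < e ->
  (e < normc (a - b))%R%:R <= normc a / k + normc b / k +
    4 * (1 + k) * (1 + k ^+ 2) / e ^+ 2 * gap a b.
Proof.
move=> k0 e0; have g0 := gap_ge0 a b.
have C0 : 0 <= 4 * (1 + k) * (1 + k ^+ 2) / e ^+ 2.
  by rewrite divr_ge0 ?sqr_ge0// !mulr_ge0// addr_ge0 ?sqr_ge0// ltW.
have na : 0 <= normc a / k by rewrite divr_ge0 ?normc_ge0 ?ltW.
have nb : 0 <= normc b / k by rewrite divr_ge0 ?normc_ge0 ?ltW.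
have ng : 0 <= 4 * (1 + k) * (1 + k ^+ 2) / e ^+ 2 * gap a b by rewrite mulr_ge0.
case: ltP => [eab|_]; last by rewrite !addr_ge0.
rewrite [leLHS](_ : _ = 1)//.
have [ka|ak] := ltP k (normc a).
  by have : 1 <= normc a / k by [rewrite ler_pdivlMr// mul1r ltW]; lra.
have [kb|bk] := ltP k (normc b).
  by have : 1 <= normc b / k by [rewrite ler_pdivlMr// mul1r ltW]; lra.
suff : 1 <= 4 * (1 + k) * (1 + k ^+ 2) / e ^+ 2 * gap a b by lra.
rewrite mulrAC ler_pdivlMr ?exprn_gt0// mul1r (le_trans _ (gap_lower k0 ak bk))//.
by rewrite ler_pXn2r ?nnegrE ?normc_ge0 ?(ltW e0) ?(ltW eab).
Qed.

End Gap.

Section BracketFunctional.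
Context d (T : measurableType d) (R : realType).
Variable mu : {measure set T -> \bar R}.
Implicit Types (y z : L1 mu).

Lemma measurable_bracket (f : T -> R[i]) : f \in @cmfun _ T R ->
  measurable_fun [set: T] (fun t => bracket (f t)).
Proof.
move=> mf; apply: measurable_realfun.measurable_funB => //.
apply: (@measurableT_comp _ _ _ _ _ _ (@Num.sqrt R)).
  by apply: continuous_measurable_fun; exact: sqrt_continuous.
apply: measurable_realfun.measurable_funD => //.
by apply: measurable_funX; exact: measurable_normc_fun.
Qed.

Lemma bracket_integral_le (f : T -> R[i]) c : f \in @cmfun _ T R ->
  (\int[mu]_t (normc (f t))%:E <= c%:E)%E ->
  mu.-integrable [set: T] (EFin \o (fun t => bracket (f t))) /\
  \int[mu]_t bracket (f t) <= c.
Proof.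
move=> mf fc; have ma := measurable_bracket mf.
have le_c : (\int[mu]_t (bracket (f t))%:E <= c%:E)%E.
  apply: le_trans fc; apply: ge0_le_integral => //.
  - by move=> t _; rewrite lee_fin bracket_ge0.
  - exact/measurable_EFinP.
  - by apply/measurable_EFinP; exact: measurable_normc_fun.
  - by move=> t _; rewrite lee_fin bracket_le.
have ia : mu.-integrable [set: T] (EFin \o (fun t => bracket (f t))).
  apply/integrableP; split; first exact/measurable_EFinP.
  rewrite (le_lt_trans _ (ltry c))// (le_trans _ le_c)// le_eqVlt; apply/orP; left.
  by apply/eqP; apply: eq_integral => t _ /=; rewrite ger0_norm// bracket_ge0.
split=> //; rewrite -lee_fin /Rintegral fineK//.
exact: integrable_fin_num.
Qed.

Definition bracket_functional y : R := \int[mu]_t bracket (y t).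

Definition midpoint y z : L1 mu := 2^-1 *: (y + z).

Lemma midpoint_ae y z : (midpoint y z : T -> R[i]) = (fun t => 2^-1 * (y t + z t)) %[ae mu].
Proof.
have h1 := L0_reprZ (2^-1) ((y + z : L1 mu) : L0 mu).
have h2 := L0_reprD (y : L0 mu) (z : L0 mu).
apply: filterS2 h1 h2 => t /= h1 h2 _.
by rewrite [LHS]h1//; congr (_ * _); rewrite [LHS]h2.
Qed.

Lemma L1_norm_bound y : (\int[mu]_t (normc (y t))%:E <= (norm1 y)%:E)%E.
Proof. by rewrite norm1_integral. Qed.

Lemma bracket_functional_ge0 y : 0 <= bracket_functional y.
Proof. by apply: Rintegral_ge0 => t _; exact: bracket_ge0. Qed.

Lemma bracket_functional_le y : bracket_functional y <= norm1 y.
Proof. exact: (bracket_integral_le (CMfunP _) (L1_norm_bound y)).2. Qed.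

Lemma integral_gap y z :
  (\int[mu]_t (gap (y t) (z t))%:E =
   (bracket_functional y + bracket_functional z - 2 * bracket_functional (midpoint y z))%:E)%E.
Proof.
pose w := midpoint y z; pose g t := 2^-1 * (y t + z t).
have iy := (bracket_integral_le (CMfunP _) (L1_norm_bound y)).1.
have iz := (bracket_integral_le (CMfunP _) (L1_norm_bound z)).1.
have iw := (bracket_integral_le (CMfunP _) (L1_norm_bound w)).1.
have mg : g \in @cmfun _ T R.
  exact: (CMfunP (2^-1 *: ((y : CMfun T R) + (z : CMfun T R)))).
pose h t := bracket (y t) + bracket (z t) - 2 * bracket (w t).
have -> : (\int[mu]_t (gap (y t) (z t))%:E = \int[mu]_t (h t)%:E)%E.
  apply: ae_eq_integral => //.
  - apply/measurable_EFinP; apply: measurable_realfun.measurable_funB.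
      by apply: measurable_realfun.measurable_funD; apply: measurable_bracket; exact: CMfunP.
    by apply: measurable_realfun.measurable_funM => //; exact: measurable_bracket mg.
  - apply/measurable_EFinP; apply: measurable_realfun.measurable_funB.
      by apply: measurable_realfun.measurable_funD; apply: measurable_bracket; exact: CMfunP.
    by apply: measurable_realfun.measurable_funM => //; apply: measurable_bracket; exact: CMfunP.
  - apply: filterS (midpoint_ae y z) => t /= wt _.
    by rewrite /gap /h /w wt.
have i2 : mu.-integrable [set: T] (EFin \o (fun t => 2 * bracket (w t))).
  by apply: eq_integrable (integrableZl measurableT 2 iw) => // t _.
have i3 : mu.-integrable [set: T] (EFin \o (fun t => bracket (y t) + bracket (z t))).
  by apply: eq_integrable (integrableD measurableT iy iz) => // t _.
rewrite /bracket_functional -RintegralZl// -RintegralD// -RintegralB// /Rintegral fineK//.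
apply: integrable_fin_num => //.
by apply: eq_integrable (integrableB measurableT i3 i2) => // t _.
Qed.

(** Strict convexity of [bracket]: two elements of an [L^1] ball are close in
    measure as soon as their midpoint does not lower [bracket_functional] much. *)
Lemma close_in_measure M e : 0 <= M -> 0 < e -> exists2 c, 0 < c &
  forall y z, norm1 y <= M -> norm1 z <= M ->
    bracket_functional y + bracket_functional z - 2 * bracket_functional (midpoint y z) <= c ->
    measurable [set t | e < normc (y t - z t)] /\
    (mu [set t | (e < normc (y t - z t))%R] <= e%:E)%E.
Proof.
move=> M0 e0; (* this truncation level leaves at most [e / 2] for the sets where [y] or [z] exceeds it *)
pose k := 4 * M / e + 1.
have k0 : 0 < k by rewrite ltr_wpDl// divr_ge0 ?mulr_ge0// ltW.
pose C := 4 * (1 + k) * (1 + k ^+ 2) / e ^+ 2.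
have C0 : 0 < C.
  by rewrite divr_gt0 ?exprn_gt0// !mulr_gt0// ?ltr_wpDr ?sqr_ge0// ltW.
exists (e / (2 * C)); first by rewrite divr_gt0// mulr_gt0.
move=> y z yM zM gyz.
have msub : (fun t => y t - z t) \in @cmfun _ T R.
  exact: (CMfunP ((y : CMfun T R) - (z : CMfun T R))).
have mA : measurable [set t | e < normc (y t - z t)].
  have -> : [set t | e < normc (y t - z t)] =
      [set: T] `&` (fun t => normc (y t - z t)) @^-1` `]e, +oo[%classic.
    by rewrite setTI; apply/seteqP; split=> t /=; rewrite in_itv/= andbT.
  exact: measurable_normc_fun msub _ _ _.
split=> //.
have mgap : measurable_fun [set: T] (fun t => gap (y t) (z t)).
  apply: measurable_realfun.measurable_funB.
    by apply: measurable_realfun.measurable_funD; apply: measurable_bracket; exact: CMfunP.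
  apply: measurable_realfun.measurable_funM => //; apply: measurable_bracket.
  exact: (CMfunP (2^-1 *: ((y : CMfun T R) + (z : CMfun T R)))).
have my := measurable_normc (y : L0 mu); have mz := measurable_normc (z : L0 mu).
have my' : measurable_fun [set: T] (fun t => k^-1 * normc (y t)).
  exact: measurable_realfun.measurable_funM.
have mz' : measurable_fun [set: T] (fun t => k^-1 * normc (z t)).
  exact: measurable_realfun.measurable_funM.
have mg' : measurable_fun [set: T] (fun t => C * gap (y t) (z t)).
  exact: measurable_realfun.measurable_funM.
have kV : 0 <= k^-1 by rewrite invr_ge0 ltW.
have py t : 0 <= k^-1 * normc (y t) by rewrite mulr_ge0// normc_ge0.
have pz t : 0 <= k^-1 * normc (z t) by rewrite mulr_ge0// normc_ge0.
have pg t : 0 <= C * gap (y t) (z t) by rewrite mulr_ge0 ?gap_ge0 ?ltW.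
have igap : (\int[mu]_t (gap (y t) (z t))%:E <= (e / (2 * C))%:E)%E.
  by rewrite integral_gap lee_fin.
have ly : (\int[mu]_t (normc (y t))%:E <= M%:E)%E by rewrite norm1_integral lee_fin.
have lz : (\int[mu]_t (normc (z t))%:E <= M%:E)%E by rewrite norm1_integral lee_fin.
have total := integral_leD
  (measurable_realfun.measurable_funD my' mz') mg' (fun t => addr_ge0 (py t) (pz t)) pg
  (integral_leD my' mz' py pz (integral_leZ my (fun t => normc_ge0 _) kV ly)
     (integral_leZ mz (fun t => normc_ge0 _) kV lz))
  (integral_leZ mgap (fun t => gap_ge0 _ _) (ltW C0) igap).
have <- : (\int[mu]_t (\1_[set t | (e < normc (y t - z t))%R] t)%:E =
    mu [set t | (e < normc (y t - z t))%R])%E by rewrite integral_indic// setIT.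
apply: (@le_trans _ _ (\int[mu]_t (k^-1 * normc (y t) + k^-1 * normc (z t) +
    C * gap (y t) (z t))%:E)%E).
  apply: ge0_le_integral => //.
  - by apply/measurable_EFinP; exact: measurable_indic.
  - apply/measurable_EFinP; apply: measurable_realfun.measurable_funD => //.
    exact: measurable_realfun.measurable_funD.
  - move=> t _; rewrite lee_fin; have := gap_indicator (y t) (z t) k0 e0.
    rewrite -/C ![k^-1 * _]mulrC; apply: le_trans.
    by rewrite indicE (_ : (t \in _) = (e < normc (y t - z t)))//; apply/idP/idP; rewrite inE.
apply: le_trans total _; rewrite lee_fin.
have -> : C * (e / (2 * C)) = e / 2 by field; rewrite gt_eqF.
have kM : k^-1 * M <= e / 4.
  rewrite mulrC ler_pdivrMr//; have -> : e / 4 * k = M + e / 4.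
    by rewrite /k; field; rewrite gt_eqF.
  by rewrite lerDl divr_ge0// ltW.
lra.
Qed.

End BracketFunctional.

Section LimitInMeasure.
Context d (T : measurableType d) (R : realType).
Variable mu : {measure set T -> \bar R}.

Lemma fast_cauchy_limit (u : nat -> R) n :
  (forall k, (n <= k)%N -> `|u k - u k.+1| <= 2^-1 ^+ k) ->
  exists l, forall k, (n <= k)%N -> `|u k - l| <= 2 * 2^-1 ^+ k.
Proof.
move=> hu; have h0 k : 0 <= (2^-1 : R) ^+ k by rewrite exprn_ge0// invr_ge0.
have close k m : (n <= k)%N -> `|u k - u (k + m)%N| <= 2 * 2^-1 ^+ k - 2 * 2^-1 ^+ (k + m).
  move=> nk; elim: m => [|m IH]; first by rewrite addn0 !subrr normr0.
  have -> : u k - u (k + m.+1)%N = (u k - u (k + m)%N) + (u (k + m)%N - u (k + m).+1).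
    by rewrite addnS addrA subrK.
  apply: le_trans (ler_normD _ _) _.
  have := hu (k + m)%N (leq_trans nk (leq_addr _ _)); rewrite addnS exprS; lra.
have cross k m : (n <= k)%N -> (n <= m)%N -> u k - 2 * 2^-1 ^+ k <= u m + 2 * 2^-1 ^+ m.
  move=> nk nm; have hk := h0 k; have hm := h0 m.
  have [km|mk] := leqP k m.
    by have := close k (m - k)%N nk; rewrite subnKC// ler_norml => /andP[]; lra.
  have := close m (k - m)%N nm; rewrite subnKC ?(ltnW mk)// ler_norml => /andP[]; lra.
pose A := [set u k - 2 * 2^-1 ^+ k | k in [set k | (n <= k)%N]].
have A0 : A !=set0 by exists (u n - 2 * 2^-1 ^+ n), n => /=.
have ubA m : (n <= m)%N -> ubound A (u m + 2 * 2^-1 ^+ m).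
  by move=> nm _ [k /= nk <-]; exact: cross.
exists (sup A) => k nk; rewrite ler_norml; apply/andP; split.
  have := ge_sup A0 (ubA k nk); lra.
have : u k - 2 * 2^-1 ^+ k <= sup A.
  by apply: ub_le_sup; [exists (u n + 2 * 2^-1 ^+ n); exact: ubA|exists k].
lra.
Qed.

(** A sequence that is Cauchy in measure at a geometric rate, and bounded in
    [L^1], has a limit in [L^1]: it converges pointwise off a null set by the
    Borel-Cantelli lemma, and Fatou's lemma bounds the limit. *)
Lemma limit_in_measure (v : nat -> L1 mu) M :
  (forall n, norm1 (v n) <= M) ->
  (forall j, measurable [set t | 2^-1 ^+ j < normc (v j t - v j.+1 t)]) ->
  (forall j, (mu [set t | (2^-1 ^+ j < normc (v j t - v j.+1 t))%R] <= (2^-1 ^+ j)%:E)%E) ->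
  exists2 u : L1 mu, norm1 u <= M & forall e, 0 < e -> exists j0, forall j, (j0 <= j)%N ->
    exists B, [/\ measurable B, (mu B <= e%:E)%E &
      \forall t \ae mu, ~ B t -> normc (v j t - u t) <= e].
Proof.
move=> vM mF muF; pose F j := [set t | (2^-1 ^+ j < normc (v j t - v j.+1 t))%R].
pose B j := \bigcup_(k >= j) F k.
have mB j : measurable (B j) by apply: bigcup_measurable => k _; exact: mF.
have sumF : (\sum_(n <oo) mu (F n) < +oo)%E.
  apply: (@le_lt_trans _ _ 2%:E); last exact: ltry.
  apply: le_trans (epsilon_trick0 xpredT (_ : 0 <= (2 : R))); last by [].
  apply: lee_nneseries => [i _ _|i _]; first exact: measure_ge0.
  apply: le_trans (muF i) _; rewrite lee_fin expnS natrM invfM mulrA divff// mul1r.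
  by rewrite natrX exprVn.
have muB e : 0 < e -> exists j0, forall j, (j0 <= j)%N -> (mu (B j) <= e%:E)%E.
  move=> e0; have := nneseries_tail_cvg sumF (fun k _ => measure_ge0 mu (F k)).
  move=> /fine_cvgP[fin /cvgrPdist_le/(_ _ e0)[N _ hN]]; have [N' _ hN'] := fin.
  exists (maxn N N') => j; rewrite geq_max => /andP[Nj N'j].
  apply: (@le_trans _ _ (\sum_(j <= n <oo) mu (F n))%E).
    apply: measure_sigma_subadditive_tail => //.
    by rewrite /B -setC_I.
  have := hN j Nj; rewrite /= sub0r normrN => /(le_trans (ler_norm _)).
  by rewrite -lee_fin fineK//; exact: hN'.
pose Z := lim_sup_set F.
have mZ : measurable Z.
  by apply: bigcap_measurable => // k _; apply: bigcup_measurable => j _; exact: mF.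
have muZ : mu Z = 0 by exact: lim_sup_set_cvg0.
have notB t n : ~ B n t -> forall k, (n <= k)%N -> normc (v k t - v k.+1 t) <= 2^-1 ^+ k.
  by move=> nB k nk; rewrite leNgt; apply/negP => h; apply: nB; exists k.
have rate (G : R[i] -> R) : (forall a b, `|G a - G b| <= normc (a - b)) ->
    exists g : T -> R, forall t, (Z t -> g t = 0) /\
      (forall n, ~ B n t -> forall k, (n <= k)%N -> `|G (v k t) - g t| <= 2 * 2^-1 ^+ k).
  move=> Glip; have : forall t, exists l, (Z t -> l = 0) /\
      (forall n, ~ B n t -> forall k, (n <= k)%N -> `|G (v k t) - l| <= 2 * 2^-1 ^+ k).
    move=> t; have [Zt|nZ] := pselect (Z t).
      by exists 0; split=> // n nB; exfalso; apply: nB; exact: Zt.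
    have [n0 nB0] : exists n0, ~ B n0 t.
      by apply: contrapT => h; apply: nZ => n _; apply: contrapT => nB; apply: h; exists n.
    have [l hl] := @fast_cauchy_limit (fun k => G (v k t)) n0
      (fun k nk => le_trans (Glip _ _) (notB t n0 nB0 k nk)).
    exists l; split=> // n nB k nk.
    have [l' hl'] := @fast_cauchy_limit (fun k => G (v k t)) n
      (fun k nk => le_trans (Glip _ _) (notB t n nB k nk)).
    suff -> : l = l' by exact: hl'.
    apply: subr0_eq; apply/eqP; rewrite -normr_eq0; apply/eqP/eqP.
    rewrite eq_le normr_ge0 andbT; apply: (@le0_of_le_mul_eps _ _ 4) => e e0 _.
    have [m hm] := exists_half_pow_le e0; pose p := maxn m (maxn n n0).
    have pm : (m <= p)%N by exact: leq_maxl.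
    have pn : (n <= p)%N by rewrite /p maxnC -maxnA leq_maxl.
    have pn0 : (n0 <= p)%N by rewrite /p !leq_max leqnn !orbT.
    have -> : l - l' = - (G (v p t) - l) + (G (v p t) - l') by ring.
    apply: le_trans (ler_normD _ _) _; rewrite normrN.
    have := hl p pn0; have := hl' p pn; have := hm p pm.
    set q := 2^-1 ^+ p => q1 q2 q3; lra.
  by move=> /choice[g hg]; exists g.
have [a ha] := rate (@complex.Re R) (fun a b => le_trans (eq_ler (f_equal _
  (esym (raddfB (@complex.Re R) a b)))) (normRe_le (a - b))).
have [b hb] := rate (@complex.Im R) (fun a b => le_trans (eq_ler (f_equal _
  (esym (raddfB (@complex.Im R) a b)))) (normIm_le (a - b))).
have cvgZ (G : R[i] -> R) (g : T -> R) : (forall t, (Z t -> g t = 0) /\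
      (forall n, ~ B n t -> forall k, (n <= k)%N -> `|G (v k t) - g t| <= 2 * 2^-1 ^+ k)) ->
    forall t, (fun k => G (v k t) * \1_(~` Z) t) @ \oo --> g t.
  move=> hg t; have [g0 gr] := hg t; have [Zt|nZ] := pselect (Z t).
    rewrite g0// indicE memNset; last by apply.
    by under eq_fun do rewrite mulr0; exact: cvg_cst.
  rewrite indicE mem_set//; under eq_fun do rewrite mulr1.
  have [n0 nB0] : exists n0, ~ B n0 t.
    by apply: contrapT => h; apply: nZ => n _; apply: contrapT => nB; apply: h; exists n.
  apply/cvgrPdist_le => e e0; have e20 : 0 < e / 2 by rewrite divr_gt0.
  have [m hm] := exists_half_pow_le e20.
  exists (maxn m n0) => // k /=; rewrite geq_max => /andP[mk nk].
  rewrite distrC (le_trans (gr n0 nB0 k nk))//.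
  by have := hm k mk; lra.
have mnZ : measurable_fun [set: T] (\1_(~` Z) : T -> R).
  by apply: measurable_indic; exact: measurableC.
have part k := cmfunP _ (CMfunP (v k : L0 mu)).
have ma : measurable_fun [set: T] a.
  apply: (@measurable_fun_cvg _ _ _ _ (fun k t => complex.Re (v k t) * \1_(~` Z) t)).
    by move=> k; apply: measurable_realfun.measurable_funM => //; have [] := part k.
  by move=> t _; exact: cvgZ.
have mb : measurable_fun [set: T] b.
  apply: (@measurable_fun_cvg _ _ _ _ (fun k t => complex.Im (v k t) * \1_(~` Z) t)).
    by move=> k; apply: measurable_realfun.measurable_funM => //; have [] := part k.
  by move=> t _; exact: cvgZ.
pose f t : R[i] := a t +i* b t.
have mf : f \in @cmfun _ T R by apply/cmfunP.
have frate t n : ~ B n t -> forall k, (n <= k)%N -> normc (v k t - f t) <= 4 * 2^-1 ^+ k.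
  move=> nB k nk; apply: le_trans (normc_le_ReIm _) _.
  have := (ha t).2 n nB k nk; have := (hb t).2 n nB k nk.
  by rewrite !raddfB /=; lra.
have fM : (\int[mu]_t (normc (f t))%:E <= M%:E)%E.
  apply: (@fatou_bound _ _ _ _ (fun k t => normc (v k t) * \1_(~` Z) t)).
  - move=> k; apply: measurable_realfun.measurable_funM => //; exact: measurable_normc.
  - by move=> k t; rewrite mulr_ge0 ?normc_ge0 ?indic_ge0.
  - move=> t; have [Zt|nZ] := pselect (Z t).
      have -> : f t = 0 by rewrite /f (ha t).1// (hb t).1.
      rewrite normc0 indicE memNset; last by apply.
      by under eq_fun do rewrite mulr0; exact: cvg_cst.
    rewrite indicE mem_set//; under eq_fun do rewrite mulr1.
    have [n0 nB0] : exists n0, ~ B n0 t.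
      by apply: contrapT => h; apply: nZ => n _; apply: contrapT => nB; apply: h; exists n.
    apply/cvgrPdist_le => e e0; have e40 : 0 < e / 4 by rewrite divr_gt0.
    have [m hm] := exists_half_pow_le e40.
    exists (maxn m n0) => // k /=; rewrite geq_max => /andP[mk nk].
    apply: (@le_trans _ _ (normc (v k t - f t))); last first.
      by rewrite (le_trans (frate t n0 nB0 k nk))//; have := hm k mk; lra.
    rewrite distrC ler_norml; apply/andP; split.
      rewrite lerNl opprB lerBlDr; have := normcD (f t - v k t) (v k t).
      by rewrite subrK -(opprB (v k t)) normcN.
    by rewrite lerBlDr; have := normcD (v k t - f t) (f t); rewrite subrK.
  - move=> k; apply: (@le_trans _ _ (\int[mu]_t (normc (v k t))%:E)%E).
      apply: ge0_le_integral => //.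
      + by move=> t _; rewrite lee_fin mulr_ge0 ?normc_ge0 ?indic_ge0.
      + apply/measurable_EFinP; apply: measurable_realfun.measurable_funM => //.
        exact: measurable_normc.
      + by apply/measurable_EFinP; exact: measurable_normc.
      + by move=> t _; rewrite lee_fin ler_piMr ?normc_ge0 ?indic_le1.
    by rewrite norm1_integral lee_fin.
have [u [uf uM]] := L1_exists mf fM; exists u => // e e0.
have [j1 hj1] := muB e e0; have e40 : 0 < e / 4 by rewrite divr_gt0.
have [m hm] := exists_half_pow_le e40.
exists (maxn j1 m) => j; rewrite geq_max => /andP[j1j mj]; exists (B j); split=> //.
  exact: hj1.
apply: filterS uf => t /= + nB => ->//.
by apply: le_trans (frate t j nB j (leqnn j)) _; have := hm j mj; lra.
Qed.

End LimitInMeasure.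

Section HullCompactness.
Context d (T : measurableType d) (R : realType).
Variable mu : {measure set T -> \bar R}.
Variables (r : R) (r1 : (1 <= r%:E)%E).
Implicit Types (y z : L1 mu) (x : Linfty mu).

Let r_gt0 : 0 < r. Proof. by apply: lt_le_trans ltr01 _; rewrite -lee_fin. Qed.

Lemma L1_sub_ae y z : (y - z : T -> R[i]) = (fun t => y t - z t) %[ae mu].
Proof.
have -> : y - z = -1 *: z + y by rewrite scaleN1r addrC.
by apply: filterS (Lp_linear_ae (-1) z y) => t /= h _; rewrite h// mulN1r addrC.
Qed.

Lemma Linfty_sub_ae x x' : (x - x' : T -> R[i]) = (fun t => x t - x' t) %[ae mu].
Proof.
have -> : x - x' = -1 *: x' + x by rewrite scaleN1r addrC.
by apply: filterS (Lp_linear_ae (-1) x' x) => t /= h _; rewrite h// mulN1r addrC.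
Qed.

Lemma norm1_sub y z : norm1 (y - z) <= norm1 y + norm1 z.
Proof.
have my := measurable_normc (y : L0 mu); have mz := measurable_normc (z : L0 mu).
have mB : (fun t => y t - z t) \in @cmfun _ T R.
  exact: (CMfunP ((y : CMfun T R) - (z : CMfun T R))).
apply: (norm1_le (L1_sub_ae y z) mB).
apply: le_trans (integral_leD my mz (fun t => normc_ge0 _) (fun t => normc_ge0 _)
  (L1_norm_bound y) (L1_norm_bound z)).
apply: ge0_le_integral => //.
- by move=> t _; rewrite lee_fin normc_ge0.
- by apply/measurable_EFinP; exact: (measurable_normc_fun mB).
- by apply/measurable_EFinP; exact: measurable_realfun.measurable_funD.
- move=> t _; rewrite lee_fin; have := normcD (y t) (- z t).
  by rewrite normcN.
Qed.

Lemma norm1_midpoint_le y z M : norm1 y <= M -> norm1 z <= M -> norm1 (midpoint y z) <= M.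
Proof.
move=> yM zM; have my := measurable_normc (y : L0 mu); have mz := measurable_normc (z : L0 mu).
have mB : (fun t => 2^-1 * (y t + z t)) \in @cmfun _ T R.
  exact: (CMfunP (2^-1 *: ((y : CMfun T R) + (z : CMfun T R)))).
apply: (norm1_le (midpoint_ae y z) mB).
have h2 : (0 : R) <= 2^-1 by rewrite invr_ge0.
have ly : (\int[mu]_t (normc (y t))%:E <= M%:E)%E by rewrite norm1_integral lee_fin.
have lz : (\int[mu]_t (normc (z t))%:E <= M%:E)%E by rewrite norm1_integral lee_fin.
have ms := measurable_realfun.measurable_funD my mz.
have := integral_leZ ms (fun t => addr_ge0 (normc_ge0 _) (normc_ge0 _)) h2
  (integral_leD my mz (fun t => normc_ge0 _) (fun t => normc_ge0 _) ly lz).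
have -> : 2^-1 * (M + M) = M by field.
apply: le_trans; apply: ge0_le_integral => //.
- by move=> t _; rewrite lee_fin normc_ge0.
- by apply/measurable_EFinP; exact: (measurable_normc_fun mB).
- by apply/measurable_EFinP; exact: measurable_realfun.measurable_funM.
- by move=> t _; rewrite lee_fin normcM normc_half ler_wpM2l ?normcD.
Qed.

Lemma dual_norm_midpoint_le a y z c : dual_norm r a y <= c -> dual_norm r a z <= c ->
  dual_norm r a (midpoint y z) <= c.
Proof.
move=> yc zc; apply: (dual_norm_le r1) => x ax.
have zE : pairing (2^-1 *: z) x = 2^-1 * pairing z x.
  by have := pairing_linearl 2^-1 z 0 x; rewrite pairing0l !addr0.
rewrite /midpoint scalerDr pairing_linearl zE -mulrDr normcM normc_half ler_pdivrMl//.
rewrite (le_trans (normcD _ _))// mulr_natl mulr2n; apply: lerD.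
  exact: le_trans (le_dual_norm y ax) yc.
exact: le_trans (le_dual_norm z ax) zc.
Qed.

(** Convergence in measure implies convergence in [dual_norm r 1] for a sequence that
    is uniformly small in the other dual norms: the set where [v j] is far from [u] has
    small measure, and so small test functions; elsewhere the difference pairs with
    a test function through Hoelder-type bounds. *)
Lemma dual_norm_cvg (v : nat -> L1 mu) (u y : L1 mu) M K : 0 <= M -> 0 <= K ->
  (forall n, norm1 (v n) <= M) -> norm1 u <= M ->
  (forall n a, dual_norm r a (v n) <= K * dual_norm r a y) ->
  (forall e, 0 < e -> exists j0, forall j, (j0 <= j)%N ->
    exists B, [/\ measurable B, (mu B <= e%:E)%E &
      \forall t \ae mu, ~ B t -> normc (v j t - u t) <= e]) ->
  forall e, 0 < e -> exists j0, forall j, (j0 <= j)%N -> dual_norm r 1 (v j - u) <= e.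
Proof.
move=> M0 K0 vM uM vK cvm e e0.
have C0 : 0 < 2 * K + 4 * M + 4 by rewrite ltr_wpDl// addr_ge0// mulr_ge0.
pose h := e / (2 * K + 4 * M + 4); have h0 : 0 < h by rewrite divr_gt0.
have [a ah] := dual_norm_small r1 y h0; have [a' a'h] := dual_norm_small r1 u h0.
(* below, a test function supported on a set of measure at most [b = dl `^ r] has [L^r] norm
   at most [dl], which makes the weighted norms for [a] and [a'] bounded by [2] *)
pose dl : R := (`|a| + `|a'| + 1)^-1.
have aa0 : 0 < `|a| + `|a'| + 1 by rewrite ltr_wpDl// addr_ge0.
have dl0 : 0 < dl by rewrite invr_gt0.
have adl : `|a| * dl <= 1 by rewrite ler_pdivrMr// mul1r -addrA lerDl addr_ge0.
have a'dl : `|a'| * dl <= 1.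
  by rewrite ler_pdivrMr// mul1r addrAC [leRHS]addrC lerDl addr_ge0.
pose b := dl `^ r; have b0 : 0 < b by rewrite powR_gt0.
have bV : b `^ r^-1 = dl by rewrite /b -powRrM mulfV ?gt_eqF// powRr1// ltW.
pose w := (h^-1) `^ r; have w0 : 0 < w by rewrite powR_gt0// invr_gt0.
pose e' := Num.min b w^-1; have e'0 : 0 < e' by rewrite lt_min b0 invr_gt0.
have [j0 hj0] := cvm e' e'0; exists j0 => j /hj0[B [mB muB vjB]].
have muBb : (mu B <= b%:E)%E by rewrite (le_trans muB)// lee_fin ge_min lexx.
apply: (dual_norm_le r1) => x [xr]; rewrite normr1 mul1r => bx.
have xr1 : normLr r x <= 1 by rewrite (le_trans _ bx)// lerDl normoo_ge0.
have x1 : normoo x <= 1 by rewrite (le_trans _ bx)// lerDr normLr_ge0.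
have [x' x'E [x'r x'1 x'b]] := cutoff_exists r1 mB x1 muBb; rewrite bV in x'b.
pose D := v j - u.
have -> : pairing (v j - u) x = (pairing (v j) x' - pairing u x') + pairing D (x - x').
  have -> : pairing D (x - x') = pairing D x - pairing D x'.
    have := pairing_linearr (-1) D x' x; rewrite scaleN1r mulN1r addrC => ->.
    by rewrite addrC.
  by rewrite -pairing_subl addrCA subrr addr0.
have part1 : normc (pairing (v j) x') <= K * h * 2.
  apply: le_trans (pairing_le_dual_norm r1 a (v j) x'r) _.
  have wt : `|a| * normLr r x' + normoo x' <= 2.
    have : `|a| * normLr r x' <= 1 by rewrite (le_trans _ adl)// ler_wpM2l.
    by move: x'1; lra.
  apply: ler_pM => //; first exact: dual_norm_ge0.
    by rewrite addr_ge0 ?mulr_ge0 ?normLr_ge0 ?normoo_ge0.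
  by rewrite (le_trans (vK j a))// ler_wpM2l.
have part2 : normc (pairing u x') <= h * 2.
  apply: le_trans (pairing_le_dual_norm r1 a' u x'r) _.
  have wt : `|a'| * normLr r x' + normoo x' <= 2.
    have : `|a'| * normLr r x' <= 1 by rewrite (le_trans _ a'dl)// ler_wpM2l.
    by move: x'1; lra.
  apply: ler_pM => //; first exact: dual_norm_ge0.
  by rewrite addr_ge0 ?mulr_ge0 ?normLr_ge0 ?normoo_ge0.
have part3 : normc (pairing D (x - x')) <= 2 * (h * (2 * M) + e' * h * w).
  have mD := measurable_normc (D : L0 mu).
  have mp := measurable_powR_normc r h (CMfunP (x : L0 mu)).
  have hV0 : 0 <= h^-1 by rewrite invr_ge0 ltW.
  have pint : (\int[mu]_t ((normc (x t) / h) `^ r)%:E <= w%:E)%E.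
    rewrite (integral_Lr r1)// lee_fin /w; apply: ge0_ler_powR.
    - exact: ltW.
    - by rewrite nnegrE divr_ge0 ?normLr_ge0// ltW.
    - by rewrite nnegrE.
    - by rewrite ler_piMl.
  have Dint : (\int[mu]_t (normc (D t))%:E <= (2 * M)%:E)%E.
    rewrite norm1_integral lee_fin (le_trans (norm1_sub _ _))// mulr_natl mulr2n.
    by rewrite lerD.
  have eh0 : 0 <= e' * h by rewrite mulr_ge0 ?ltW.
  have m1 : measurable_fun [set: T] (fun t => h * normc (D t)).
    exact: measurable_realfun.measurable_funM.
  have m2 : measurable_fun [set: T] (fun t => e' * h * (normc (x t) / h) `^ r).
    exact: measurable_realfun.measurable_funM.
  have p1 t : 0 <= h * normc (D t) by rewrite mulr_ge0 ?normc_ge0 ?ltW.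
  have p2 t : 0 <= e' * h * (normc (x t) / h) `^ r by rewrite mulr_ge0 ?powR_ge0.
  have le_D : \forall t \ae mu, normc (D t * (x - x' : Linfty mu) t) <=
      h * normc (D t) + e' * h * (normc (x t) / h) `^ r.
    apply: filterS (filterI vjB (filterI (L1_sub_ae (v j) u)
      (filterI (Linfty_sub_ae x x') x'E))) => t /= [vjt [Dt [xxt x't]]].
    rewrite xxt// x't// /cutoff; have [Bt|nB] := pselect (B t).
      by rewrite ?indicE mem_set// mulr1 subrr mulr0 normc0 addr_ge0.
    rewrite ?indicE memNset// mulr0 subr0 normcM.
    have De : normc (D t) <= e' by rewrite /D Dt// vjt.
    have := le_scaled_powR r1 (normc_ge0 (x t)) h0.
    move=> /(ler_wpM2l (normc_ge0 (D t))) /le_trans; apply.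
    rewrite mulrDr mulrC lerD2l mulrA.
    by rewrite ler_wpM2r ?powR_ge0// ler_wpM2r// ltW.
  exact: (cintegral_le (cmfun_pair D (x - x')) (measurable_realfun.measurable_funD m1 m2)
    (fun t => addr_ge0 (p1 t) (p2 t))
    (integral_leD m1 m2 p1 p2 (integral_leZ mD (fun t => normc_ge0 _) (ltW h0) Dint)
       (integral_leZ mp (fun t => powR_ge0 _ _) eh0 pint)) le_D).2.
have ew : e' * h * w <= h.
  rewrite mulrAC ler_piMl ?(ltW h0)// -ler_pdivlMr// div1r.
  by rewrite ge_min lexx orbT.
have he : h * (2 * K + 4 * M + 4) = e by rewrite divfK// gt_eqF.
apply: le_trans (normcD _ _) _; have := normcD (pairing (v j) x') (- pairing u x').
rewrite normcN; nra.
Qed.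

Lemma tail_hull_mono (z : nat -> L1 mu) k l v : (k <= l)%N ->
  tail_hull z l v -> tail_hull z k v.
Proof. by move=> kl h P cP hP; apply: h => // n ln; apply: hP; exact: leq_trans ln. Qed.

Lemma tail_hull_midpoint (z : nat -> L1 mu) k v w :
  tail_hull z k v -> tail_hull z k w -> tail_hull z k (midpoint v w).
Proof. by move=> hv hw P cP hP; exact: (cP v w (hv P cP hP) (hw P cP hP)). Qed.

(** Every dominated sequence has convex combinations of its tails that
    minimize the strictly convex functional [bracket_functional] ever better, and
    these converge in measure. *)
Lemma dual_norm_hull_compact K y (z : nat -> L1 mu) :
  (forall n, dominated (dual_norm r) K (z n) y) ->
  exists u, forall e k, 0 < e -> exists2 v, tail_hull z k v & dual_norm r 1 (v - u) <= e.
Proof.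
move=> zy0; pose L := `|K|; have L0 : 0 <= L by exact: normr_ge0.
have zy n a : dual_norm r a (z n) <= L * dual_norm r a y.
  by rewrite (le_trans (zy0 n a))// ler_wpM2r ?dual_norm_ge0// ler_norm.
pose M := 4 * (L * dual_norm r 0 y).
have M0 : 0 <= M by rewrite !mulr_ge0// dual_norm_ge0.
have hullM k v : tail_hull z k v -> norm1 v <= M.
  move=> hv; apply: (hv (fun v => norm1 v <= M)).
    by move=> a b; exact: norm1_midpoint_le.
  by move=> n _; rewrite (le_trans (norm1_le_dual_norm r1 _))// ler_pM2l// zy.
have hullL k v : tail_hull z k v -> forall a, dual_norm r a v <= L * dual_norm r a y.
  move=> hv a; pose Q (v : L1 mu) := dual_norm r a v <= L * dual_norm r a y.
  have cQ : @midpoint_convex _ (L1 mu) Q by move=> p q; exact: dual_norm_midpoint_le.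
  exact: (hv Q cQ (fun n _ => zy n a)).
pose J := @bracket_functional _ _ _ mu.
pose A k := [set J v | v in tail_hull z k].
have zk k : tail_hull z k (z k) by move=> P _ hP; exact: hP.
have A0 k : A k !=set0 by exists (J (z k)), (z k).
have lbA k : has_lbound (A k) by exists 0 => _ [v _ <-]; exact: bracket_functional_ge0.
pose s := sup [set inf (A k) | k in [set: nat]].
have infM k : inf (A k) <= M.
  apply: le_trans (ge_inf (lbA k) _) _; first by exists (z k).
  by rewrite (le_trans (bracket_functional_le _))// (hullM k).
have infs k : inf (A k) <= s.
  by apply: ub_le_sup; [exists M => _ [l _ <-]; exact: infM|exists k].
have near_inf c k : 0 < c -> exists2 v, tail_hull z k v & J v <= s + c.
  move=> c0; have [_ [v hv <-] Jv] := inf_adherent c0 (conj (A0 k) (lbA k)).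
  by exists v => //; rewrite (le_trans (ltW Jv))// lerD2r.
have near_sup c : 0 < c -> exists k, s - c <= inf (A k).
  move=> c0; have hs : has_sup [set inf (A k) | k in [set: nat]].
    by split; [exists (inf (A 0)), 0|exists M => _ [l _ <-]; exact: infM].
  by have [_ [k _ <-] /ltW h] := sup_adherent c0 hs; exists k.
(* for each [j], a tolerance and a tail for which almost minimizers are [2^-j]-close *)
have hj j : exists p : R * nat, 0 < p.1 /\
    (forall v w, tail_hull z p.2 v -> tail_hull z p.2 w ->
      J v <= s + p.1 -> J w <= s + p.1 ->
      measurable [set t | 2^-1 ^+ j < normc (v t - w t)] /\
      (mu [set t | (2^-1 ^+ j < normc (v t - w t))%R] <= (2^-1 ^+ j)%:E)%E).
  have e0 : 0 < (2^-1 : R) ^+ j by rewrite exprn_gt0// invr_gt0.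
  have [c c0 hc] := @close_in_measure _ _ _ mu M _ M0 e0.
  have c40 : 0 < c / 4 by rewrite divr_gt0.
  have [k hk] := near_sup _ c40; exists (c / 4, k); split=> //= v w hv hw Jv Jw.
  apply: hc; [exact: hullM hv|exact: hullM hw|].
  have : inf (A k) <= J (midpoint v w).
    apply: (ge_inf (lbA k)); exists (midpoint v w) => //; exact: tail_hull_midpoint.
  by rewrite -/J; lra.
have [p hp] := choice hj.
(* consecutive terms are compared at the level of the first one, hence the two conditions *)
have hv j : exists v, [/\ tail_hull z (maxn j (maxn (p j).2 (p j.-1).2)) v,
    J v <= s + (p j).1 & J v <= s + (p j.-1).1].
  have c0 : 0 < Num.min (p j).1 (p j.-1).1 by rewrite lt_min (hp _).1 (hp _).1.
  have [v hv Jv] := near_inf _ (maxn j (maxn (p j).2 (p j.-1).2)) c0.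
  exists v; split=> //; apply: le_trans Jv _; rewrite lerD2l ge_min lexx ?orbT//.
have [v hvP] := choice hv.
have vj j : tail_hull z j (v j).
  by have [h _ _] := hvP j; apply: tail_hull_mono h; exact: leq_maxl.
have pair j := (hp j).2 (v j) (v j.+1).
have pairj j : measurable [set t | 2^-1 ^+ j < normc (v j t - v j.+1 t)] /\
    (mu [set t | (2^-1 ^+ j < normc (v j t - v j.+1 t))%R] <= (2^-1 ^+ j)%:E)%E.
  have [h1 J1 _] := hvP j; have [h2 _ J2] := hvP j.+1.
  apply: (hp j).2 => //; first by apply: tail_hull_mono h1; rewrite !leq_max leqnn orbT.
  by apply: tail_hull_mono h2; rewrite !leq_max leqnn !orbT.
have [u uM cvm] := limit_in_measure (fun j => hullM j _ (vj j))
  (fun j => (pairj j).1) (fun j => (pairj j).2).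
have cv := dual_norm_cvg M0 L0 (fun j => hullM j _ (vj j)) uM (fun j => hullL j _ (vj j)) cvm.
exists u => e k e0; have [j0 hj0] := cv e e0.
exists (v (maxn j0 k)); last by apply: hj0; exact: leq_maxl.
by apply: tail_hull_mono (vj _); exact: leq_maxr.
Qed.

(** If [dual_norm r 1] vanishes at [u], all bounded functions in [L^r] pair to zero with [u],
    so [dual_norm r 0] vanishes at [u], and with it the [L^1] norm. *)
Theorem dual_norm_compact_family : compact_family (@dual_norm _ _ _ mu r) 1.
Proof.
split.
- exact: dual_norm_sublinear.
- exact: dual_norm0.
- move=> u u0; have pu x : in_Lr r x -> pairing u x = 0.
    move=> xr; apply: eq0_normc; apply/eqP; rewrite eq_le normc_ge0 andbT.
    apply: le_trans (pairing_le_dual_norm r1 1 u xr) _.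
    by rewrite mulr_le0_ge0// addr_ge0 ?mulr_ge0 ?normLr_ge0 ?normoo_ge0.
  have u00 : dual_norm r 0 u <= 0.
    by apply: (dual_norm_le r1) => x [xr _]; rewrite pu// normc0.
  have n0 : norm1 u = 0.
    apply/eqP; rewrite eq_le norm1_ge0 andbT (le_trans (norm1_le_dual_norm r1 u))//.
    by rewrite mulr_ge0_le0.
  by apply: Lp_normr0_eq0; rewrite /Lp_norm -/(norm1 u) n0.
- exact: dual_norm_lsc.
- exact: dual_norm_hull_compact.
Qed.

End HullCompactness.

(** * The polynomial calculus on integrable functions *)

Lemma lipschitz_continuous {R : realType} (V W : normedModType R[i]) (f : V -> W) (K : R) :
  0 <= K -> (forall x y, `|f x - f y| <= K%:C * `|x - y|) -> continuous f.
Proof.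
move=> K0 fK x; apply/cvgrPdist_le => e e0.
have c0 : 0 < (K + 1)%:C :> R[i] by rewrite ltcR ltr_wpDl.
near=> y; apply: le_trans (fK x y) _.
have xy : `|x - y| <= e / (K + 1)%:C.
  by near: y; apply: cvgr_dist_le; [exact: cvg_id|exact: divr_gt0].
apply: le_trans (ler_wpM2l _ xy) _; first by rewrite realC_ge0.
rewrite mulrCA ler_piMr ?(ltW e0)// ler_pdivrMr// mul1r lecR lerDl; exact: ler01.
Unshelve. all: by end_near. Qed.

Section FunctionalCalculus.
Context {R : realType} {sigma : set R} (csigma : compact sigma).
Context {X : normedModType R[i]}.
Variables (A : bop X) (Phi : BV sigma -> bop X).
Hypothesis HA : AC_functional_calculus csigma A Phi.
Implicit Types (x : X).

Local Notation poly p := (polyBV csigma p).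

Lemma ACfun_poly p : ACfun csigma (poly p).
Proof. by apply: subset_closure; exists p. Qed.

Lemma approximable_ACfun f : approximable csigma f -> ACfun csigma f.
Proof.
move=> fa U /nbhs_ballP[e /= e0 eU].
have eE : e = (complex.Re e)%:C by rewrite RRe_real// realE ltW.
have e20 : 0 < complex.Re e / 2 by rewrite divr_gt0// -ltcR -eE.
have [p fp] := fa _ e20; exists (poly p); split; first by exists p.
apply: eU; rewrite -ball_normE /ball_/= bvnormE eE ltcR (le_lt_trans fp)//.
by rewrite ltr_pdivrMr// ltr_pMr ?ltr1n// -ltcR -eE.
Qed.

Lemma ACfun_sub f g : ACfun csigma f -> ACfun csigma g -> ACfun csigma (f - g).
Proof.
move=> /ACfun_approximable fa /ACfun_approximable ga; apply: approximable_ACfun.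
by have := approximable_linear (-1) ga fa; rewrite scaleN1r addrC.
Qed.

Lemma AC_calculus_sub f g x : ACfun csigma f -> ACfun csigma g ->
  Phi (f - g) x = Phi f x - Phi g x.
Proof.
move=> fAC gAC; have [[lin _] _ _ _] := HA.
by have := lin (-1) g f gAC fAC; rewrite scaleN1r addrC => ->; rewrite scaleN1r addrC.
Qed.

Lemma AC_calculus_poly_ind p c x :
  Phi (poly (p * 'X + c%:P)) x = Phi (poly p) (A x) + c *: x.
Proof.
have [[lin mul] _ one id] := HA.
have -> : p * 'X + c%:P = c *: 1 + p * 'X by rewrite alg_polyC addrC.
rewrite polyBV_linear polyBV_mul lin; try (by rewrite -?polyBV_mul; exact: ACfun_poly).
rewrite mul; try exact: ACfun_poly.
by rewrite polyBV1 one id addrC.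
Qed.

Lemma AC_calculus_poly0 x : Phi (poly 0) x = 0.
Proof.
have -> : poly 0 = poly 1 - poly 1.
  by have := polyBV_linear csigma (-1) 1 1; rewrite !scaleN1r !addNr subrr.
by rewrite AC_calculus_sub ?subrr//; exact: ACfun_poly.
Qed.

Lemma AC_calculus_bound : exists2 K : R, 0 <= K &
  forall f, ACfun csigma f -> forall x, `|Phi f x| <= (K * bvnorm f)%:C * `|x|.
Proof.
have [_ [K PK] _ _] := HA; exists `|K| => // f /PK fK x.
apply: le_trans (le_opnorm _ _) _; rewrite ler_wpM2r// lecR.
have : opnorm (Phi f) <= K * bvnorm f by rewrite -lecR realCM; exact: fK.
by move=> /le_trans; apply; rewrite ler_wpM2r ?bvnorm_ge0// ler_norm.
Qed.

End FunctionalCalculus.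

Section PolynomialCalculus.
Context d (T : measurableType d) (R : realType).
Variable mu : {measure set T -> \bar R}.
Variables (r : R) (r1 : (1 <= r%:E)%E) (sigma : set R) (csigma : compact sigma).
Variable A : partial_linear (L0 mu).
Variables (Ar : defines_bounded_on A r%:E) (Aoo : defines_bounded_on A +oo%E).
Variables (Phir : BV sigma -> bop (Lp mu r1)) (Phi : BV sigma -> bop (Linfty mu)).
Hypothesis HAr : AC_functional_calculus csigma (Lp_restrict r1 Ar) Phir.
Hypothesis HA : AC_functional_calculus csigma (Lp_restrict (leey 1%E) Aoo) Phi.
Variable S : bop (L1 mu).
Hypothesis AS : is_adjoint (Lp_restrict (leey 1%E) Aoo) S.
Implicit Types (x : Linfty mu) (y u v : L1 mu).

Local Notation poly p := (polyBV csigma p).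

(** Both functional calculi act on the functions common to their spaces through
    the polynomials in the same transformation [A]. *)
Lemma calculi_agree p x (x' : Lp mu r1) : (x : L0 mu) = (x' : L0 mu) ->
  (Phi (poly p) x : L0 mu) = (Phir (poly p) x' : L0 mu).
Proof.
elim/poly_ind: p x x' => [|p c IH] x x' xx'.
  by rewrite (AC_calculus_poly0 HA) (AC_calculus_poly0 HAr).
rewrite (AC_calculus_poly_ind HA) (AC_calculus_poly_ind HAr).
transitivity ((Phi (poly p) (Lp_restrict (leey 1%E) Aoo x) : L0 mu) + c *: (x : L0 mu)) => //.
rewrite (IH _ (Lp_restrict r1 Ar x')) ?xx'//=.
by rewrite /Lp_restrict_fun/= xx'.
Qed.

Lemma pairing_separates u v : (forall x, pairing u x = pairing v x) -> u = v.
Proof.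
move=> uv; apply/eqP; rewrite -subr_eq0; apply/eqP.
apply: (family_separates (dual_norm_compact_family mu r1)).
by apply: (dual_norm_le r1) => x _; rewrite pairing_subl uv subrr normc0.
Qed.

(** By induction on [p]: multiplying [p] by the variable composes with the operator that has
    [S] for pre-adjoint. *)
Lemma preadjoint_exists p y : exists u, forall x, pairing u x = pairing y (Phi (poly p) x).
Proof.
elim/poly_ind: p y => [|p c IH] y.
  exists 0 => x; rewrite (AC_calculus_poly0 HA) pairing0l.
  by rewrite -(scale0r x) pairingZr mul0r.
have [u uP] := IH y; exists (c *: y + S u) => x.
rewrite (AC_calculus_poly_ind HA) pairing_linearl addrC [Phi _ _ + _]addrC.
by rewrite pairing_linearr addrC -AS uP.
Qed.

(** The value at [y] of the operator on [L^1] whose adjoint is [Phi p]. *)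
Definition preadjoint (p : {poly R[i]}) y : L1 mu :=
  xget 0 [set u | forall x, pairing u x = pairing y (Phi (poly p) x)].

Lemma preadjointP p y x : pairing (preadjoint p y) x = pairing y (Phi (poly p) x).
Proof.
have [u uP] := preadjoint_exists p y.
exact: (xgetI (P := [set u | forall x, pairing u x = pairing y (Phi (poly p) x)]) 0 uP).
Qed.

(** The bounds of the two calculi on test functions, in the [L^r] norm and in the [L^oo]
    norm, pass to all the dual norms by duality. *)
Lemma preadjoint_calculus :
  exists2 K, 0 <= K & poly_calculus (@dual_norm _ _ _ mu r) csigma K preadjoint.
Proof.
have [Kr Kr0 PKr] := AC_calculus_bound HAr; have [K K0 PK] := AC_calculus_bound HA.
have [[lin mul] _ one _] := HA; have ac p := @ACfun_poly _ _ csigma p.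
exists (Kr + K); first exact: addr_ge0.
split; first exact: addr_ge0.
- move=> p; split=> [a u v|y a].
    apply: pairing_separates => x.
    by rewrite pairing_linearl !preadjointP pairing_linearl.
  have b0 := bvnorm_ge0 (poly p).
  have c0 : 0 <= (Kr + K) * bvnorm (poly p) by rewrite mulr_ge0// addr_ge0.
  apply: (dual_norm_adjoint r1 a c0) => x xr; pose x' : Lp mu r1 := @Build_Lp _ _ _ mu r%:E r1 (x : L0 mu) xr.
  have agree := @calculi_agree p x x' erefl.

  exists (Phi (poly p) x); first by rewrite /in_Lr agree; exact: Lp_finite.
  split; first exact: preadjointP.
  + have := PKr _ (ac p) x'.
    rewrite -[leLHS]/((fine (L0norm r%:E (Phir (poly p) x' : L0 mu)))%:C).
    rewrite -agree -[`|x'|]/((normLr r x)%:C) -realCM lecR => /le_trans; apply.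
    by rewrite ler_wpM2r ?normLr_ge0// ler_wpM2r// lerDl.
  + have := PK _ (ac p) x; rewrite -[leLHS]/((normoo (Phi (poly p) x))%:C).
    rewrite -[`|x|]/((normoo x)%:C) -realCM lecR => /le_trans; apply.
    by rewrite ler_wpM2r ?normoo_ge0// ler_wpM2r// lerDr.
- move=> a p q y; apply: pairing_separates => x.
  rewrite pairing_linearl !preadjointP polyBV_linear lin//.
  by rewrite -pairing_linearr.
- move=> p q y; apply: pairing_separates => x.
  by rewrite !preadjointP mulrC polyBV_mul mul.
- by move=> y; apply: pairing_separates => x; rewrite preadjointP polyBV1 one.
Qed.

End PolynomialCalculus.

(** * Operators on bounded functions as adjoints *)

Section Duality.
Context d (T : measurableType d) (R : realType).
Variable mu : {measure set T -> \bar R}.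
Hypothesis dual_L1 : Linfty_is_dual_of_L1 mu.
Implicit Types (x : Linfty mu) (y u v : L1 mu).

Lemma dual_represents (phi : L1 mu -> R[i]) (c : R) : 0 <= c ->
  (forall a u v, phi (a *: u + v) = a * phi u + phi v) ->
  (forall y, normc (phi y) <= c * norm1 y) ->
  exists! x, forall y, phi y = pairing y x.
Proof.
move=> c0 lin bnd.
pose L : {linear L1 mu -> R[i]^o} :=
  HB.pack phi (GRing.isLinear.Build R[i] (L1 mu) R[i]^o *:%R phi lin).
apply: (dual_L1 (phi := L)); apply: (lipschitz_continuous c0) => u v.
have -> : L u - L v = phi (u - v).
  by have := lin (-1) v u; rewrite scaleN1r mulN1r addrC => ->; rewrite addrC.
rewrite -[`|u - v|]/((norm1 (u - v))%:C) -realCM.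
by rewrite -[leLHS]/(`|phi (u - v) : R[i]|) normr_normc lecR.
Qed.

Lemma pairing_inj x x' : (forall y, pairing y x = pairing y x') -> x = x'.
Proof.
move=> xx'; have c0 : 0 <= 2 * normoo x by rewrite mulr_ge0// normoo_ge0.
have [|y|z [_ uz]] := @dual_represents (fun y => pairing y x) _ c0.
- by move=> a u v; exact: pairing_linearl.
- by rewrite (le_trans (pairing_le y x).2)// [norm1 y * _]mulrC mulrA.
- by rewrite -(uz x)// -(uz x').
Qed.

(** If [x] were larger than [c + e] on a set [B], then testing against
    functions of the form [|y| conj x] on [B] shows that [x] pairs to zero with every
    integrable function on [B]; uniqueness in the duality then makes it vanish on [B]. *)
Lemma normoo_le_pairing x c : 0 <= c ->
  (forall y, normc (pairing y x) <= c * norm1 y) -> normoo x <= c.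
Proof.
move=> c0 xc; rewrite -subr_le0; apply: (@le0_of_le_mul_eps _ _ 1) => e e0 _.
rewrite mul1r lerBlDl; have ce0 : 0 <= c + e by rewrite addr_ge0// ltW.
have mx := measurable_normc (x : L0 mu); pose B := [set t | c + e < normc (x t)].
have mB : measurable B.
  rewrite [X in measurable X](_ : _ = (fun t => normc (x t)) @^-1` `]c + e, +oo[); last first.
    by apply/seteqP; split=> t; rewrite /B/= in_itv/= andbT.
  by rewrite -[X in measurable X]setTI; exact: mx.
have mc := cutoff_cmfun mB (CMfunP (x : L0 mu)).
have c_le t : normc (cutoff B x t) <= normc (x t) by exact: normc_cutoff_le.
have [w [wE _]] := Linfty_exists mc (normoo_ge0 x)
  (filterS (fun t => le_trans (c_le t)) (normoo_ae x)).
have w0 : w = 0.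
  apply: pairing_inj => y; have -> : pairing y 0 = 0.
    by rewrite -(scale0r x) pairingZr mul0r.
  pose F t := normc (y t) * normc (cutoff B x t).
  have my := measurable_normc (y : L0 mu); have mcn := measurable_normc_fun mc.
  have mF : measurable_fun [set: T] F by exact: measurable_realfun.measurable_funM.
  have F0 t : 0 <= F t by rewrite mulr_ge0 ?normc_ge0.
  have [I FI] : exists I : R, (\int[mu]_t (F t)%:E = I%:E)%E.
    exists (fine (\int[mu]_t (F t)%:E)%E); rewrite fineK// ge0_fin_numE; last first.
      by apply: integral_ge0 => t _; rewrite lee_fin.
    have ly : (\int[mu]_t (normc (y t))%:E <= (norm1 y)%:E)%E by rewrite norm1_integral.
    apply: le_lt_trans (ltry (normoo x * norm1 y)).
    apply: le_trans (integral_leZ my (fun t => normc_ge0 _) (normoo_ge0 x) ly).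
    apply: ae_ge0_le_integral => //.
    - by move=> t _; rewrite lee_fin.
    - exact/measurable_EFinP.
    - by move=> t _; rewrite lee_fin mulr_ge0 ?normc_ge0 ?normoo_ge0.
    - by apply/measurable_EFinP; exact: measurable_realfun.measurable_funM.
    - apply: filterS (normoo_ae x) => t xt _; rewrite lee_fin /F mulrC.
      by rewrite ler_wpM2r ?normc_ge0// (le_trans (c_le t)).
  suff I0 : I <= 0.
    apply: eq0_normc; apply/eqP; rewrite eq_le normc_ge0 andbT.
    have yy : (y : T -> R[i]) = y %[ae mu] by apply: aeW.
    rewrite (pairing_ae yy wE (CMfunP _) mc).
    have Fle : (\int[mu]_t (F t)%:E <= I%:E)%E by rewrite FI.
    apply: le_trans (cintegral_le _ mF F0 Fle _).2 _; last by rewrite mulr_ge0_le0.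
    - exact: cmfun_mul (CMfunP _) mc.
    - by apply: aeW => t; rewrite normcM.
  (* pairing [f] with [x] gives the integral of [|y| |x|^2] over [B] *)
  pose f t := (normc (y t))%:C * conjc (cutoff B x t).
  have mf : f \in @cmfun _ T R.
    apply: cmfun_mul; first exact: cmfun_real.
    have /cmfunP[mR mI] := mc; apply/cmfunP; split.
      by apply: eq_measurable_fun mR => t _; case: (cutoff B x t).
    have := measurable_realfun.measurable_funB (@measurable_cst _ _ _ _ [set: T] (0 : R)) mI.
    by apply: eq_measurable_fun => t _ /=; case: (cutoff B x t) => a b; rewrite /= sub0r.
  have nf t : normc (f t) = F t.
    rewrite normcM normc_real ger0_norm ?normc_ge0//; congr (_ * _).
    by case: (cutoff B x t) => a b /=; rewrite sqrrN.
  have fI : (\int[mu]_t (normc (f t))%:E <= I%:E)%E.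
    by rewrite -FI le_eqVlt; under eq_integral do rewrite nf; rewrite eqxx.
  have [y' [y'E y'1]] := L1_exists mf fI.
  have [iRe _] := (pairing_le y' x).1.
  pose G t := F t * normc (x t).
  have GE : (\int[mu]_t (G t)%:E)%E = (complex.Re (pairing y' x))%:E.
    rewrite /= fineK; last exact: integrable_fin_num.
    apply: ae_eq_integral => //.
    - by apply/measurable_EFinP; exact: measurable_realfun.measurable_funM.
    - exact: measurable_int iRe.
    apply: filterS y'E => t /= yt _; rewrite yt// /f /G /F /cutoff indicE; congr (_%:E).
    case: (t \in B); last by rewrite mulr0 conjc0 normc0 !(mulr0, mul0r).
    rewrite mulr1; case: (x t) => a b /=.
    by rewrite -mulrA -expr2 sqr_sqrtr ?addr_ge0 ?sqr_ge0//; ring.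
  have key : (c + e) * I <= complex.Re (pairing y' x).
    rewrite -lee_fin -GE EFinM -FI -ge0_integralZl//.
    - apply: ge0_le_integral => //.
      + by move=> t _; rewrite mule_ge0 ?lee_fin.
      + by apply/measurable_EFinP; exact: measurable_realfun.measurable_funM.
      + by apply/measurable_EFinP; exact: measurable_realfun.measurable_funM.
      + move=> t _; rewrite -EFinM lee_fin /G /F /cutoff mulrC indicE.
        have [Bt|nB] := pselect (B t).
          by rewrite ler_wpM2l ?mulr_ge0 ?normc_ge0// ltW.
        by rewrite memNset// !mulr0 normc0 !(mulr0, mul0r).
    - exact/measurable_EFinP.
    - by move=> t _; rewrite lee_fin.
  have := le_trans key (le_trans (ler_norm _) (normRe_le _)).
  move=> /le_trans/(_ (xc y')) h; have := ler_wpM2l c0 y'1.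
  by move=> /(le_trans h); rewrite mulrDl gerDl pmulr_rle0.
apply: normoo_le => //; have := normoo_ae w; rewrite w0 normoo0 => ae0.
rewrite w0 in wE; apply: filterS2 wE ae0 => t /= wt; rewrite wt// => xt0.
rewrite leNgt; apply/negP => Bt; move: xt0.
rewrite /cutoff indicE mem_set// mulr1 => xt.
by have := lt_le_trans Bt xt; rewrite ltNge ce0.
Qed.

End Duality.

Section Adjoint.
Context d (T : measurableType d) (R : realType).
Variable mu : {measure set T -> \bar R}.
Hypothesis dual_L1 : Linfty_is_dual_of_L1 mu.
Implicit Types (x : Linfty mu) (y u v : L1 mu).

(** The bound is obtained in [L^oo] from the [L^1] bound of [P] through the pairing. *)
Lemma adjoint_exists (P : L1 mu -> L1 mu) (K : R) : 0 <= K ->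
  (forall a u v, P (a *: u + v) = a *: P u + P v) ->
  (forall y, norm1 (P y) <= K * norm1 y) ->
  exists B : bop (Linfty mu), (forall y x, pairing (P y) x = pairing y (B x)) /\
    forall x, normoo (B x) <= 2 * K * normoo x.
Proof.
move=> K0 lin PK.
have bnd x y : normc (pairing (P y) x) <= 2 * K * normoo x * norm1 y.
  rewrite (le_trans (pairing_le (P y) x).2)//.
  have -> : 2 * K * normoo x * norm1 y = 2 * (K * norm1 y * normoo x) by ring.
  by rewrite ler_wpM2l// ler_wpM2r ?normoo_ge0.
have c0 x : 0 <= 2 * K * normoo x by rewrite !mulr_ge0// normoo_ge0.
have ex x : exists z, forall y, pairing (P y) x = pairing y z.
  have plin a u v : pairing (P (a *: u + v)) x = a * pairing (P u) x + pairing (P v) x.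
    by rewrite lin pairing_linearl.
  by have [z [zP _]] := dual_represents dual_L1 (c0 x) plin (bnd x); exists z.
have [B BP] := choice ex.
have Boo x : normoo (B x) <= 2 * K * normoo x.
  by apply: (normoo_le_pairing dual_L1) => // y; rewrite -BP.
have Bb : B \in @bounded_op R (Linfty mu).
  apply/bounded_opP; split=> [a x z|].
    apply: (pairing_inj dual_L1) => y.
    by rewrite pairing_linearr -!BP pairing_linearr.
  exists (2 * K) => x; rewrite -[`|B x|]/((normoo (B x))%:C) -[`|x|]/((normoo x)%:C).
  by rewrite -realCM lecR.
by exists (Bop Bb).
Qed.

End Adjoint.

Lemma dual_norm0_le_norm1 d (T : measurableType d) (R : realType)
    (mu : {measure set T -> \bar R}) (r : R) (r1 : (1 <= r%:E)%E) (y : L1 mu) :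
  dual_norm r 0 y <= 2 * norm1 y.
Proof.
apply: (dual_norm_le r1) => x bx; rewrite (le_trans (pairing_le y x).2)//.
by rewrite ler_wpM2l// ler_piMr ?norm1_ge0//; exact: test_ball_normoo bx.
Qed.

Theorem proposition4p4 (d : measure_display) (Omega : measurableType d)
    (R : realType) (mu : {measure set Omega -> \bar R})
    (dual_L1 : Linfty_is_dual_of_L1 mu)
    (r : R) (r1 : (1 <= r%:E)%E)
    (sigma : set R) (sigma_neq0 : sigma !=set0) (csigma : compact sigma)
    (T : partial_linear (L0 mu))
    (Tr : defines_bounded_on T r%:E) (Too : defines_bounded_on T +oo%E)
    (AC_Tr : real_AC_operator csigma (Lp_restrict r1 Tr))
    (AC_Too : real_AC_operator csigma (Lp_restrict (leey 1%E) Too))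
    (S : bop (L1 mu)) (TooE : is_adjoint (Lp_restrict (leey 1%E) Too) S) :
  has_BV_functional_calculus csigma (Lp_restrict (leey 1%E) Too).
Proof.
have [Phir HPr] := AC_Tr; have [Phi HP] := AC_Too.
have H := dual_norm_compact_family mu r1.
have [C C0 HC] := preadjoint_calculus HPr HP TooE.
have HR := AC_calculus_ramp_system H HC.
pose Psi1 := extended_calculus (@dual_norm _ _ _ mu r) 1 csigma sigma_neq0 (preadjoint csigma Phi).
have lin1 a f g y : Psi1 (a *: f + g) y = a *: Psi1 f y + Psi1 g y.
  exact: (BV_calculus_linear csigma sigma_neq0 H HR).
have mul1 f g y : Psi1 (f * g) y = Psi1 f (Psi1 g y).
  exact: (BV_calculus_mul csigma sigma_neq0 H HR).
have dom1 f := BV_calculus_dominated csigma sigma_neq0 H HR f.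
(* a factor [2 * C] from the ramps, and the factors [4] and [2] of the comparison of
   [dual_norm r 0] with the [L^1] norm *)
pose K := 16 * C; have K0 : 0 <= K by rewrite mulr_ge0.
have Kf0 (f : BV sigma) : 0 <= K * bvnorm f by rewrite mulr_ge0// bvnorm_ge0.
have bnd1 f y : norm1 (Psi1 f y) <= K * bvnorm f * norm1 y.
  apply: le_trans (norm1_le_dual_norm r1 _) _.
  have h1 : dual_norm r 0 (Psi1 f y) <= 2 * C * bvnorm f * dual_norm r 0 y := (dom1 f).2 y 0.
  have c0 : 0 <= 2 * C * bvnorm f by rewrite !mulr_ge0// bvnorm_ge0.
  have := le_trans h1 (ler_wpM2l c0 (dual_norm0_le_norm1 r1 y)).
  by rewrite /K; lra.
have [Psi PsiP] := choice (fun f => adjoint_exists dual_L1 (Kf0 f) (dom1 f).1 (bnd1 f)).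
have adj f y x : pairing (Psi1 f y) x = pairing y (Psi f x) := (PsiP f).1 y x.
have Psi_le f x : `|Psi f x| <= (2 * (K * bvnorm f))%:C * `|x|.
  rewrite -[`|Psi f x|]/((normoo (Psi f x))%:C) -[`|x|]/((normoo x)%:C) -realCM lecR.
  exact: (PsiP f).2.
have inj := pairing_inj dual_L1.
have bop_eq (A B : bop (Linfty mu)) : (forall x, A x = B x) -> A = B.
  by move=> AB; apply: val_inj; apply/funext.
have Plin a f g : Psi (a *: f + g) = a *: Psi f + Psi g.
  apply: bop_eq => x; apply: inj => y; apply: etrans (esym (adj _ _ _)) _.
  rewrite lin1 pairing_linearl; have := pairing_linearr a y (Psi f x) (Psi g x).
  by rewrite -(adj f y x) -(adj g y x) => <-.
have Psub f g : Psi (f - g) = Psi f - Psi g.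
  by have := Plin (-1) g f; rewrite !scaleN1r addrC => ->; rewrite addrC.
have Ppoly p : Psi (polyBV csigma p) = Phi (polyBV csigma p).
  apply: bop_eq => x; apply: inj => y.
  rewrite -(adj (polyBV csigma p)) /Psi1 (extended_calculus_poly sigma_neq0 H HC).
  exact: (preadjointP HP TooE).
exists Phi, Psi; split=> //.
- split=> [a f g _ _|f g _ _]; first exact: Plin.
  (* taking adjoints reverses products, which are commutative here *)
  rewrite mulrC; apply: bop_eq => x; apply: inj => y; apply: etrans (esym (adj _ _ _)) _.
  have mulE := congr1 (fun u => pairing u x) (mul1 g f y).
  exact: etrans mulE (etrans (adj g (Psi1 f y) x) (adj f y (Psi g x))).
- have c0 : 0 <= 2 * K by rewrite mulr_ge0.
  apply: (lipschitz_continuous c0) => f g; rewrite -Psub bvnormE -realCM lecR.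
  apply: opnorm_le; first by rewrite -mulrA !mulr_ge0// bvnorm_ge0.
  by move=> x; rewrite -mulrA; exact: Psi_le.
- move=> f fAC; apply: bop_eq => x.
  have [L L0 PL] := AC_calculus_bound HP.
  apply/eqP; rewrite -subr_eq0 -normr_le0 norm_RRe lecR.
  apply: (@le0_of_le_mul_eps _ _ ((2 * K + L) * normoo x)) => e e0 _.
  have [p fp] := ACfun_approximable fAC e0; have pAC := @ACfun_poly _ _ csigma p.
  have -> : Psi f x - Phi f x =
      Psi (f - polyBV csigma p) x - Phi (f - polyBV csigma p) x.
    rewrite (AC_calculus_sub HP)// Psub Ppoly.
    by rewrite -[X in _ = X - _]/(Psi f x - Phi (polyBV csigma p) x) opprB addrA subrK.
  rewrite -lecR -norm_RRe; apply: le_trans (ler_normB _ _) _.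
  have h1 := Psi_le (f - polyBV csigma p) x.
  have h2 := PL _ (ACfun_sub fAC pAC) x.
  apply: le_trans (lerD h1 h2) _; rewrite -[`|x|]/((normoo x)%:C) -mulrDl -realCD -realCM lecR.
  rewrite [leRHS]mulrAC ler_wpM2r ?normoo_ge0// mulrA -mulrDl.
  by rewrite ler_wpM2l// addr_ge0// mulr_ge0.
Qed.
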